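(* Let $\Sigma$ be a connected, nonspherical surface without boundary, endowed with a smooth structure. Then there exists a homeomorphism $f:\Sigma\to\Sigma$ such that $f$ and $f^{-1}$ preserve the set of smooth curves and preserve transversality of smooth curves, but such that neither $f$ nor $f^{-1}$ is differentiable. In particular, the natural map $\mathrm{Diff}(\Sigma)\to\mathrm{Aut}(\mathcal{NC}_\pitchfork^{\dagger\infty}(\Sigma))$, $h\mapsto(a\mapsto h(a))$, is not surjective.
   Context: A surface may be compact or not, orientable or not; it is nonspherical if it cannot be embedded in the 2-sphere, or equivalently if it contains at least one nonseparating simple closed curve (one whose complement is connected). Smooth curves are $C^\infty$ embedded simple closed curves, viewed as subsets of $\Sigma$. A map preserves transversality if it sends pairs of smooth curves that are transverse (in the differentiable sense) to pairs that are transverse. ''Not differentiable'' means not differentiable at every point of $\Sigma$, i.e. differentiability fails at some point. The graph $\mathcal{NC}_\pitchfork^{\dagger\infty}(\Sigma)$ has as vertices the smooth nonseparating simple closed curves in $\Sigma$, with an edge between two distinct vertices $a$ and $b$ if they are disjoint or have exactly one intersection point, which is transverse in the differentiable sense. $\mathrm{Diff}(\Sigma)$ is the group of smooth diffeomorphisms of $\Sigma$. *)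

(* Defs.v *)
From HB Require Import structures.
From mathcomp Require Import all_boot all_order all_algebra.
From mathcomp Require Import all_classical all_reals all_analysis.

Set Implicit Arguments.
Unset Strict Implicit.
Unset Printing Implicit Defensive.

Import Order.TTheory GRing.Theory Num.Theory.
Import numFieldNormedType.Exports.
Local Open Scope classical_set_scope.
Local Open Scope ring_scope.

Section SmoothFunctions.
Context {R : realType} {V W : normedModType R}.

(* Meant for open [U] and finite-dimensional [V], where testing the
   differential [x |-> 'd f x] on each fixed vector [v] is the same as testing
   it as a map into the space of linear maps. *)
Fixpoint class_Ck (k : nat) (U : set V) (f : V -> W) : Prop :=
  match k with
  | 0 => forall x, U x -> {for x, continuous f}
  | k'.+1 => (forall x, U x -> differentiable f x) /\
             (forall v, class_Ck k' U (fun x => 'd f x v))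
  end.

Definition smooth_on (U : set V) (f : V -> W) : Prop :=
  forall k, class_Ck k U f.

End SmoothFunctions.

Section Surfaces.
Context {R : realType} {S : topologicalType}.

Local Notation plane := 'rV[R]_2.

(* [chart_fun] and [chart_inv] are total; only their restrictions to
   [chart_dom] and to its image are meaningful. *)
Record chart := Chart {
  chart_dom : set S;
  chart_fun : S -> plane;
  chart_inv : plane -> S;
  chart_dom_open : open chart_dom;
  chart_cod_open : open (chart_fun @` chart_dom);
  chart_funK : forall p, chart_dom p -> chart_inv (chart_fun p) = p;
  chart_fun_continuous :
    forall p, chart_dom p -> {for p, continuous chart_fun};
  chart_inv_continuous :
    forall x, (chart_fun @` chart_dom) x -> {for x, continuous chart_inv} }.

Definition smooth_transition (c d : chart) : Prop :=
  smooth_on (chart_fun c @` (chart_dom c `&` chart_dom d))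
            (chart_fun d \o chart_inv c).

Definition smooth_structure (A : set chart) : Prop :=
  [/\ forall p, exists2 c, A c & chart_dom c p,
      forall c d, A c -> A d -> smooth_transition c d
    & forall d, (forall c, A c ->
                   smooth_transition c d /\ smooth_transition d c) -> A d].

Definition smooth_surface (A : set chart) : Prop :=
  [/\ hausdorff_space S, @second_countable S & smooth_structure A].

Definition homeomorphism_pair (f g : S -> S) : Prop :=
  [/\ continuous f, continuous g, cancel f g & cancel g f].

(* The circle is R / Z. *)
Definition simple_closed_param (gamma : R -> S) : Prop :=
  continuous gamma /\
  forall s t, gamma s = gamma t <-> exists n : int, s = t + n%:~R.

Definition simple_closed_curve (a : set S) : Prop :=
  exists2 gamma, simple_closed_param gamma & range gamma = a.

Definition nonseparating (a : set S) : Prop := connected (~` a).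

Definition nonspherical : Prop :=
  exists a, simple_closed_curve a /\ nonseparating a.

Context (A : set chart).

(* The circle being compact, an injective immersion of it is an embedding. *)
Definition smooth_param (gamma : R -> S) : Prop :=
  simple_closed_param gamma /\
  forall c, A c ->
    smooth_on (gamma @^-1` chart_dom c) (chart_fun c \o gamma) /\
    forall t, chart_dom c (gamma t) -> derive1 (chart_fun c \o gamma) t != 0.

Definition smooth_curve (a : set S) : Prop :=
  exists2 gamma, smooth_param gamma & range gamma = a.

(* The tangent line of [a] at [p], read in the chart [c]. *)
Definition tangent_space (c : chart) (a : set S) (p : S) : set plane :=
  [set v | exists gamma t l,
     [/\ smooth_param gamma, range gamma = a, gamma t = p
       & v = l *: derive1 (chart_fun c \o gamma) t]].

Definition transverse (a b : set S) : Prop :=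
  forall p, (a `&` b) p -> forall c, A c -> chart_dom c p ->
  forall u, exists v w,
    [/\ tangent_space c a p v, tangent_space c b p w & u = v + w].

Definition preserves_smooth_curves (f : S -> S) : Prop :=
  forall a, smooth_curve a -> smooth_curve (f @` a).

Definition preserves_transversality (f : S -> S) : Prop :=
  forall a b, smooth_curve a -> smooth_curve b ->
    transverse a b -> transverse (f @` a) (f @` b).

(* Only used for continuous [h]. *)
Definition differentiable_at (h : S -> S) (p : S) : Prop :=
  forall c d, A c -> A d -> chart_dom c p -> chart_dom d (h p) ->
    differentiable (chart_fun d \o h \o chart_inv c) (chart_fun c p).

Definition differentiable_map (h : S -> S) : Prop :=
  forall p, differentiable_at h p.

Definition smooth_map (h : S -> S) : Prop :=
  continuous h /\
  forall c d, A c -> A d ->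
    smooth_on (chart_fun c @` (chart_dom c `&` h @^-1` chart_dom d))
              (chart_fun d \o h \o chart_inv c).

Definition Diff : Type :=
  {h : S -> S | smooth_map h /\
     exists k, [/\ smooth_map k, cancel h k & cancel k h]}.

Definition NC_vertex : Type :=
  {a : set S | smooth_curve a /\ nonseparating a}.

Definition NC_edge (x y : NC_vertex) : Prop :=
  let a := sval x in let b := sval y in
  a <> b /\
  (a `&` b = set0 \/ (exists p, a `&` b = [set p]) /\ transverse a b).

Definition NC_Aut : Type :=
  {phi : NC_vertex -> NC_vertex | bijective phi /\
     forall x y, NC_edge (phi x) (phi y) <-> NC_edge x y}.

(* This determines [N] uniquely; its existence amounts to the fact that
   diffeomorphisms act on the graph. *)
Definition natural_map (N : Diff -> NC_Aut) : Prop :=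
  forall h x, sval (sval (N h) x) = sval h @` sval x.

End Surfaces.

Arguments chart : clear implicits.
Arguments nonspherical : clear implicits.

(* Main.v *)
Require Import Defs.
From HB Require Import structures.
From mathcomp Require Import all_boot all_order all_algebra.
From mathcomp Require Import all_classical all_reals all_analysis.
From mathcomp Require Import ring lra zify.

(** The homeomorphism is supported in a chart around one point, where it reads
    as the plane map [loops lam]. The closed loops on which
    [y^3 / (x^2 + y^2)^2] ([level]) is a given positive number are all tangent
    to the horizontal axis at the origin, along which [y] is of the order of
    [|x|^(4/3)]. The map preserves each of these loops, and moves points only on
    those whose level lies in a compact interval of positive numbers. Away from
    the origin it is a local diffeomorphism. A smooth regular curve through the
    origin sees no motion at all near it: the level tends to infinity in
    absolute value along the curve when its velocity is not horizontal, and to 0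
    when it is, since then [|y| <= M x^2] ([loops_curve]). So smooth curves go
    to smooth curves and keep their tangent lines at the origin, whence
    transversality is preserved ([good_curve], [good_transverse]). But along a
    loop the abscissa is multiplied by nearly [l^-3], with [l != 1], while the
    horizontal axis is fixed: the map has no differential at the origin
    ([loops_not_differentiable]). The inverse is obtained by inverting [lam].

    Such a homeomorphism [f] acts on the graph of curves ([graph_aut]). Place
    its special point on a smooth nonseparating curve. If a diffeomorphism [h]
    had the same action, then [f^-1 \o h] would map every vertex to itself. A
    continuous injective map with this property is the identity near the base
    point of any parametrised vertex ([vertex_rigid]): vertices can be pushed by
    diffeomorphisms so as to contain one given point and avoid another. Hence
    [f] would coincide with [h] near its special point and be differentiable
    there.

    The hypothesis on the surface only provides a topological nonseparating
    curve [g], so a smooth one has to be found ([smooth_nonseparating_exists]).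
    Suppose that every smooth simple closed curve separates. Take a small round
    circle [C] around a point [p] of [g], with another point [q] of [g] outside;
    these points cut [g] into two arcs. Finitely many points of [C] off [g]
    divide [C] into pieces meeting at most one of the two arcs ([breaks]). The
    complement of [g] being connected, these points can be gathered in a single
    disc disjoint from [g] ([gather]), and each excursion of [C] out of this
    disc is closed up by a chord and smoothed ([excursion_curve]). The resulting
    curve separates by assumption. Its two sides colour the points off [C], with
    a change of colour across the excursion, and the same colour at [p] and [q]
    because one arc of [g] avoids the curve ([col_excursion]). Adding these
    colourings modulo 2 ([col_glue]) gives a colouring that changes along [g]
    exactly across [C], yet agrees at [p] and [q]. This is absurd, since [C]
    separates [p] from [q] ([no_full_coloring]). *)

Set Implicit Arguments.
Unset Strict Implicit.
Unset Printing Implicit Defensive.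

Import Order.TTheory GRing.Theory Num.Theory.
Import numFieldNormedType.Exports.
Local Open Scope classical_set_scope.
Local Open Scope ring_scope.

(** * Smooth functions on normed spaces *)

Section Calculus.
Context {R : realType}.
Implicit Types (U V W : normedModType R).

Lemma near_eq_diff V W (f g : V -> W) (x : V) :
  {near x, f =1 g} -> differentiable f x ->
  differentiable g x /\ 'd g x = 'd f x :> (V -> W).
Proof.
move=> fg df.
have fgx : f x = g x by exact: nbhs_singleton fg.
have dc : continuous ('d f x) by exact: diff_continuous.
have H : g \o shift x = cst (g x) + 'd f x +o_ 0 id.
  have := diff_locally df; move/eqaddoP => H.
  apply/eqaddoP => _/posnumP[e]; have := H e%:num ltac:(by []).
  have fg0 : \forall h \near (0 : V), f (h + x) = g (h + x).
    have := fg; rewrite (near_shift 0) /=.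
    by apply: filterS => h /=; rewrite subr0.
  apply: filterS2 fg0 => h e1 /=; rewrite /cst /= -fgx => He.
  suff -> : ((g \o shift x) - ((fun=> f x) + 'd f x : V -> W)) h =
    ((f \o shift x) - ((fun=> f x) + 'd f x : V -> W)) h by exact: He.
  by rewrite !fctE /= e1.
have E : 'd g x = 'd f x :> (V -> W) by apply: diff_unique.
split=> //; apply/diff_locallyP; rewrite E; split=> //.
Qed.

(** Every clause of [class_Ck] quantifies over the points of [U], so the
    property can be tested one point at a time; smoothness near each point of a
    set then gives smoothness on the set ([smooth_onP]). *)
Lemma class_CkP V W k (U : set V) (f : V -> W) :
  class_Ck k U f <-> forall x, U x -> class_Ck k [set x] f.
Proof.
elim: k f => [|k IH] f /=.
  by split=> [H x Ux y ->|H x Ux]; [exact: H|exact: (H x Ux x erefl)].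
split=> [[H1 H2] x Ux|H].
  split=> [y ->|v]; first exact: H1.
  by move/IH: (H2 v); apply.
split=> [x Ux|v]; first by have [H1 _] := H _ Ux; exact: H1.
by apply/IH => x Ux; have [_ H2] := H _ Ux; exact: H2.
Qed.

Lemma class_Ck_sub V W k (A B : set V) (f : V -> W) :
  A `<=` B -> class_Ck k B f -> class_Ck k A f.
Proof. by move=> AB /class_CkP H; apply/class_CkP => x /AB; exact: H. Qed.

Lemma class_Ck_congr V W k (A : set V) (f g : V -> W) : open A ->
  (forall x, A x -> f x = g x) -> class_Ck k A f -> class_Ck k A g.
Proof.
move=> oA; elim: k f g => [|k IH] f g fg.
  move=> H x Ax; have near_fg : {near x, f =1 g}.
    by apply: filterS (open_nbhs_nbhs (conj oA Ax)) => y /fg.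
  have := H x Ax; rewrite /prop_for /continuous_at (fg x Ax).
  by apply: cvg_trans; apply: near_eq_cvg.
have nfg x : A x -> {near x, f =1 g}.
  by move=> Ax; apply: filterS (open_nbhs_nbhs (conj oA Ax)) => y /fg.
move=> [H1 H2]; split=> [x Ax|v].
  by have [] := near_eq_diff (nfg _ Ax) (H1 _ Ax).
apply: IH (H2 v) => x Ax.
by have [_ ->] := near_eq_diff (nfg _ Ax) (H1 _ Ax).
Qed.

Lemma class_CkS V W k (A : set V) (f : V -> W) :
  class_Ck k.+1 A f -> class_Ck k A f.
Proof.
elim: k f => [|k IH] f [H1 H2].
  by move=> x Ax; apply: differentiable_continuous; exact: H1.
by split=> // v; apply: IH; exact: H2.
Qed.

Lemma class_Ck_cst V W k (A : set V) (c : W) : class_Ck k A (cst c).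
Proof.
elim: k c => [|k IH] c; first by move=> x _; exact: cst_continuous.
split=> [x _|v]; first exact: differentiable_cst.
have -> : (fun x : V => 'd (cst c) x v) = cst 0; last exact: IH.
by apply/funext => x; rewrite diff_cst.
Qed.

Lemma class_Ck_lin V W k (A : set V) (f : {linear V -> W}) :
  continuous f -> class_Ck k A f.
Proof.
move=> cf; case: k => [|k]; first by move=> x _; exact: cf.
split=> [x _|v]; first exact: linear_differentiable.
have -> : (fun x : V => 'd f x v) = cst (f v); last exact: class_Ck_cst.
by apply/funext => x; rewrite diff_lin.
Qed.

Lemma class_Ck_id V k (A : set V) : class_Ck k A (@id V).
Proof. by apply: (@class_Ck_lin V V k A idfun) => x. Qed.

Lemma class_Ck_linl U V W k (A : set V) (f : V -> W) (l : {linear W -> U}) :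
  open A -> continuous l -> class_Ck k A f -> class_Ck k A (l \o f).
Proof.
move=> oA cl; elim: k f => [|k IH] f.
  by move=> H x Ax; apply: continuous_comp; [exact: H|exact: cl].
move=> [H1 H2]; have dl y : differentiable l y by exact: linear_differentiable.
split=> [x Ax|v]; first by apply: differentiable_comp; [exact: H1|exact: dl].
apply: class_Ck_congr (IH _ (H2 v)) => // x Ax /=.
by rewrite (diff_comp (H1 _ Ax) (dl _)) /= diff_lin.
Qed.

Lemma class_CkD V W k (A : set V) (f g : V -> W) : open A ->
  class_Ck k A f -> class_Ck k A g -> class_Ck k A (fun x => f x + g x).
Proof.
move=> oA; elim: k f g => [|k IH] f g.
  by move=> Hf Hg x Ax; apply: continuousD; [exact: Hf|exact: Hg].
move=> [Hf1 Hf2] [Hg1 Hg2]; split=> [x Ax|v].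
  by apply: differentiableD; [exact: Hf1|exact: Hg1].
apply: class_Ck_congr (IH _ _ (Hf2 v) (Hg2 v)) => // x Ax /=.
by rewrite -[fun y => f y + g y]/(f + g) diffD //; [exact: Hf1|exact: Hg1].
Qed.

Lemma class_Ck_sum V W k (A : set V) n (f : 'I_n -> V -> W) : open A ->
  (forall i, class_Ck k A (f i)) -> class_Ck k A (fun x => \sum_i f i x).
Proof.
move=> oA; elim: n f => [|n IH] f Hf.
  have -> : (fun x : V => \sum_(i < 0) f i x) = cst 0.
    by apply/funext => x; rewrite big_ord0.
  exact: class_Ck_cst.
have -> : (fun x : V => \sum_(i < n.+1) f i x) =
  (fun x => \sum_(i < n) f (widen_ord (leqnSn n) i) x + f ord_max x).
  by apply/funext => x; rewrite big_ord_recr.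
by apply: class_CkD => //; apply: IH => i; exact: Hf.
Qed.

Lemma class_CkM V k (A : set V) (f g : V -> R) : open A ->
  class_Ck k A f -> class_Ck k A g -> class_Ck k A (fun x => f x * g x).
Proof.
move=> oA; elim: k f g => [|k IH] f g.
  by move=> Hf Hg x Ax; apply: continuousM; [exact: Hf|exact: Hg].
move=> Cf Cg; have Cf' := class_CkS Cf; have Cg' := class_CkS Cg.
case: Cf Cg => [Hf1 Hf2] [Hg1 Hg2]; split=> [x Ax|v].
  by apply: differentiableM; [exact: Hf1|exact: Hg1].
have := class_CkD oA (IH _ _ Cf' (Hg2 v)) (IH _ _ Cg' (Hf2 v)).
apply: class_Ck_congr => // x Ax /=.
by rewrite -[fun y => f y * g y]/(f * g) diffM //; [exact: Hf1|exact: Hg1].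
Qed.

Lemma class_CkV V k (A : set V) (f : V -> R) : open A ->
  (forall x, A x -> f x != 0) ->
  class_Ck k A f -> class_Ck k A (fun x => (f x)^-1).
Proof.
move=> oA f0; elim: k => [|k IH].
  by move=> Hf x Ax; apply: continuousV; [exact: f0|exact: Hf].
move=> Cf; have CV := IH (class_CkS Cf); case: Cf => [Hf1 Hf2].
split=> [x Ax|v].
  by apply: differentiableV; [exact: Hf1|exact: f0].
have := class_CkM oA (class_Ck_cst k A (-1 : R))
  (class_CkM oA (class_CkM oA CV CV) (Hf2 v)).
apply: class_Ck_congr => // x Ax /=.
rewrite diffV //; [|exact: Hf1|exact: f0].
by rewrite /= mulN1r /GRing.scale /= mulNr -invfM expr2.
Qed.

Lemma coord_linear n (i : 'I_n) :
  {l : {linear 'rV[R]_n -> R} | l = (fun v => v 0 i) :> ('rV[R]_n -> R)}.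
Proof.
have lin : linear (fun v : 'rV[R]_n => v 0 i) by move=> a u v; rewrite !mxE.
pose lM := GRing.isLinear.Build _ _ _ _ _ lin.
by exists (HB.pack (fun v : 'rV[R]_n => v 0 i) lM : {linear _ -> _}).
Qed.

Lemma scalel_linear W (w : W) :
  {l : {linear R -> W} | l = (fun a => a *: w) :> (R -> W)}.
Proof.
have lin : linear (fun a : R => a *: w).
  by move=> a u v; rewrite scalerDl scalerA.
pose lM := GRing.isLinear.Build _ _ _ _ _ lin.
by exists (HB.pack (fun a : R => a *: w) lM : {linear _ -> _}).
Qed.

Lemma class_Ck_coord V n k (A : set V) (f : V -> 'rV[R]_n.+1) : open A ->
  class_Ck k A f <-> forall i, class_Ck k A (fun x => f x 0 i).
Proof.
move=> oA; split=> [H i|H].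
  have [l El] := coord_linear i.
  have -> : (fun x => f x 0 i) = l \o f by rewrite El.
  by apply: class_Ck_linl => //; rewrite El; exact: coord_continuous.
have -> : f = (fun x => \sum_i f x 0 i *: delta_mx 0 i).
  by apply/funext => x; rewrite -row_sum_delta.
apply: class_Ck_sum => // i.
have [l El] := scalel_linear (delta_mx 0 i : 'rV[R]_n.+1).
have -> : (fun x => f x 0 i *: delta_mx 0 i : 'rV[R]_n.+1) =
   l \o (fun x => f x 0 i) by rewrite El.
by apply: class_Ck_linl => //; rewrite El; exact: scalel_continuous.
Qed.

(** A finite basis [e] with continuous coordinates [l], needed to reduce the
    differential of a composite to derivatives along fixed vectors. *)
Definition framed U := exists n (e : 'I_n -> U) (l : 'I_n -> {linear U -> R}),
  (forall i, continuous (l i)) /\ forall u, u = \sum_i l i u *: e i.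

Lemma framed_R : framed R.
Proof.
have [l El] := scalel_linear (1 : R).
exists 1%N, (fun=> 1), (fun=> l); split=> [i|u].
  by rewrite El; exact: scalel_continuous.
by rewrite big_ord1 El /GRing.scale /= !mulr1.
Qed.

Lemma framed_rV n : framed 'rV[R]_n.+1.
Proof.
exists n.+1, (fun i => delta_mx 0 i), (fun i => projT1 (coord_linear i)).
split=> [i|u]; first by rewrite (projT2 (coord_linear i)); exact: coord_continuous.
rewrite [LHS]row_sum_delta; apply: eq_bigr => i _.
by rewrite (projT2 (coord_linear i)).
Qed.

(** In a frame, the differential of [g \o f] along [v] is a sum of products of a
    coordinate of ['d f x v] with a derivative of [g] along a fixed vector; the
    induction hypothesis applies to the latter composed with [f]. *)
Lemma class_Ck_compR U V k (A : set U) (B : set V) (f : U -> V) (g : V -> R) :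
  framed V -> open A -> open B -> (forall x, A x -> B (f x)) ->
  class_Ck k A f -> class_Ck k B g -> class_Ck k A (g \o f).
Proof.
move=> [n [e [l [cl El]]]] oA oB AB; elim: k f g AB => [|k IH] f g AB.
  by move=> Cf Cg x Ax; apply: continuous_comp; [exact: Cf|exact/Cg/AB].
move=> Cf; have Cf' := class_CkS Cf; case: Cf => Hf1 Hf2 [Hg1 Hg2].
split=> [x Ax|v].
  by apply: differentiable_comp; [exact: Hf1|exact/Hg1/AB].
have H i : class_Ck k A (fun x => l i ('d f x v) * 'd g (f x) (e i)).
  apply: class_CkM => //.
    exact: (class_Ck_linl oA (cl i) (Hf2 v)).
  exact: (IH f (fun y => 'd g y (e i)) AB Cf' (Hg2 (e i))).
apply: class_Ck_congr (class_Ck_sum oA H) => // x Ax /=.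
rewrite (diff_comp (Hf1 _ Ax) (Hg1 _ (AB _ Ax))) /=.
rewrite {2}(El ('d f x v)) linear_sum; apply: eq_bigr => i _.
by rewrite linearZ.
Qed.

Lemma class_Ck_comp U V n k (A : set U) (B : set V) (f : U -> V)
    (g : V -> 'rV[R]_n.+1) :
  framed V -> open A -> open B -> (forall x, A x -> B (f x)) ->
  class_Ck k A f -> class_Ck k B g -> class_Ck k A (g \o f).
Proof.
move=> FV oA oB AB Cf Cg; apply/class_Ck_coord => // i.
have Cgi := (class_Ck_coord k g oB).1 Cg i.
exact: (class_Ck_compR FV oA oB AB Cf Cgi).
Qed.

(** An open set is part of the definition, so that the property passes to nearby
    points and to derivatives. *)
Definition smooth_at V W (f : V -> W) (x : V) :=
  exists A : set V, [/\ open A, A x & smooth_on A f].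

Lemma smooth_onP V W (A : set V) (f : V -> W) :
  (forall x, A x -> smooth_at f x) -> smooth_on A f.
Proof.
move=> H k; apply/class_CkP => x Ax; have [B [_ Bx SB]] := H x Ax.
by apply: class_Ck_sub (SB k) => y ->.
Qed.

Lemma smooth_at_congr V W (f g : V -> W) x :
  {near x, f =1 g} -> smooth_at f x -> smooth_at g x.
Proof.
move=> fg [A [oA Ax SA]].
pose B := [set z : V | f z = g z]^°.
have oB : open B by exact: open_interior.
exists (A `&` B); split; [exact: openI|by []|].
move=> k; apply: class_Ck_congr (class_Ck_sub _ (SA k)).
- exact: openI.
- by move=> y [_ /interior_subset].
- by move=> y [].
Qed.

Lemma smooth_at_continuous V W (f : V -> W) x :
  smooth_at f x -> {for x, continuous f}.
Proof. by move=> [A [oA Ax /(_ 0%N)]]; exact. Qed.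

Lemma smooth_at_differentiable V W (f : V -> W) x :
  smooth_at f x -> differentiable f x.
Proof. by move=> [A [oA Ax /(_ 1%N) [H _]]]; exact: H. Qed.

Lemma smooth_at_near V W (f : V -> W) x :
  smooth_at f x -> \forall y \near x, smooth_at f y.
Proof.
move=> [A [oA Ax SA]]; apply: filterS (open_nbhs_nbhs (conj oA Ax)) => y Ay.
by exists A.
Qed.

Lemma smooth_at_diff V W (f : V -> W) x v :
  smooth_at f x -> smooth_at (fun y => 'd f y v) x.
Proof.
by move=> [A [oA Ax SA]]; exists A; split => // k; have [_] := SA k.+1; exact.
Qed.

Lemma smooth_at_cst V W (c : W) (x : V) : smooth_at (fun=> c) x.
Proof.
by exists setT; split; [exact: openT| |move=> k; exact: class_Ck_cst].
Qed.

Lemma smooth_at_id V (x : V) : smooth_at id x.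
Proof. by exists setT; split; [exact: openT| |move=> k; exact: class_Ck_id]. Qed.

Lemma smooth_atD V W (f g : V -> W) x :
  smooth_at f x -> smooth_at g x -> smooth_at (fun y => f y + g y) x.
Proof.
move=> [A [oA Ax SA]] [B [oB Bx SB]]; exists (A `&` B).
have oAB := openI oA oB; split => // k.
by apply: class_CkD => //; [apply: class_Ck_sub (SA k)|apply: class_Ck_sub (SB k)];
  move=> y [].
Qed.

Lemma smooth_atM V (f g : V -> R) x :
  smooth_at f x -> smooth_at g x -> smooth_at (fun y => f y * g y) x.
Proof.
move=> [A [oA Ax SA]] [B [oB Bx SB]]; exists (A `&` B).
have oAB := openI oA oB; split => // k.
by apply: class_CkM => //; [apply: class_Ck_sub (SA k)|apply: class_Ck_sub (SB k)];
  move=> y [].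
Qed.

Lemma smooth_atN V (f : V -> R) x : smooth_at f x -> smooth_at (fun y => - f y) x.
Proof.
move=> Sf; have -> : (fun y => - f y) = (fun y => (-1) * f y).
  by apply/funext => y; rewrite mulN1r.
by apply: smooth_atM => //; exact: smooth_at_cst.
Qed.

Lemma smooth_atB V (f g : V -> R) x :
  smooth_at f x -> smooth_at g x -> smooth_at (fun y => f y - g y) x.
Proof. by move=> Sf Sg; apply: smooth_atD => //; exact: smooth_atN. Qed.

Lemma smooth_atV V (f : V -> R) x : f x != 0 ->
  smooth_at f x -> smooth_at (fun y => (f y)^-1) x.
Proof.
move=> fx0 Sf; have [A [oA Ax SA]] := Sf.
have cf := smooth_at_continuous Sf.
have nf : nbhs x [set y | f y != 0].
  exact: cvgr_neq0 fx0.
have oB := openI oA (@open_interior V [set y : V | f y != 0]).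
exists (A `&` [set y : V | f y != 0]^°); split => // k.
apply: (class_CkV oB); first by move=> y [_ /interior_subset].
by apply: class_Ck_sub (SA k) => y [].
Qed.

Lemma smooth_at_coord V n (f : V -> 'rV[R]_n.+1) x :
  smooth_at f x <-> forall i, smooth_at (fun y => f y 0 i) x.
Proof.
split=> [[A [oA Ax SA]] i|H].
  by exists A; split => // k; have /(class_Ck_coord k f oA) := SA k; exact.
pose P := [set y : V | forall i, smooth_at (fun y => f y 0 i) y].
have Px : nbhs x P by apply: filter_forall => i; exact/smooth_at_near/H.
exists P^°; split => //; first exact: open_interior.
move=> k; apply/class_Ck_coord; first exact: open_interior.
move=> i; have : smooth_on P^° (fun y => f y 0 i); last exact.
by apply: smooth_onP => y /interior_subset; exact.
Qed.

Lemma smooth_at_comp U V n (f : U -> V) (g : V -> 'rV[R]_n.+1) x :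
  framed V -> smooth_at f x -> smooth_at g (f x) -> smooth_at (g \o f) x.
Proof.
move=> FV Sf [B [oB Bx SB]]; have cf := smooth_at_continuous Sf.
case: Sf => A [oA Ax SA].
have oC := openI oA (@open_interior U (f @^-1` B)).
exists (A `&` (f @^-1` B)^°); split => //.
  by split => //; apply: cf; exact: open_nbhs_nbhs.
move=> k; apply: (class_Ck_comp (B := B)) => //.
- by move=> y [_ /interior_subset].
- by apply: class_Ck_sub (SA k) => y [].
Qed.

Lemma smooth_at_compR U V (f : U -> V) (g : V -> R) x :
  framed V -> smooth_at f x -> smooth_at g (f x) -> smooth_at (g \o f) x.
Proof.
move=> FV Sf [B [oB Bx SB]]; have cf := smooth_at_continuous Sf.
case: Sf => A [oA Ax SA].
have oC := openI oA (@open_interior U (f @^-1` B)).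
exists (A `&` (f @^-1` B)^°); split => //.
  by split => //; apply: cf; exact: open_nbhs_nbhs.
move=> k; apply: (class_Ck_compR (B := B)) => //.
- by move=> y [_ /interior_subset].
- by apply: class_Ck_sub (SA k) => y [].
Qed.

Lemma smooth_at_derive1 W (f : R -> W) x :
  smooth_at f x -> smooth_at (derive1 f) x.
Proof.
move=> Sf; have := smooth_at_diff (1 : R) Sf; apply: smooth_at_congr.
apply: filterS (smooth_at_near Sf) => y Sy.
by rewrite diff1E ?scale1r //; exact: smooth_at_differentiable.
Qed.

Lemma class_Ck_derive1 W k (A : set R) (f f' : R -> W) : open A ->
  (forall x, A x -> is_derive x 1 f (f' x)) ->
  (forall v, class_Ck k A (fun x => v *: f' x)) -> class_Ck k.+1 A f.
Proof.
move=> oA H C; split=> [x Ax|v].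
  by apply/derivable1_diffP; have [] := H x Ax.
apply: class_Ck_congr (C v) => // x Ax.
have [d1 d2] := H x Ax.
by rewrite deriv1E // derive1E d2.
Qed.

Lemma derive1_chain V W (g : R -> V) (f : V -> W) x :
  differentiable g x -> differentiable f (g x) ->
  derive1 (f \o g) x = 'd f (g x) (derive1 g x).
Proof.
move=> dg df; rewrite !derive1E'; last 2 first.
- exact: dg.
- exact: differentiable_comp.
by rewrite diff_comp.
Qed.

Lemma is_derive_comp1 W (g : R -> R) (f : R -> W) (x : R) dg df :
  is_derive x (1 : R) g dg -> is_derive (g x) (1 : R) f df ->
  is_derive x (1 : R) (f \o g) (dg *: df).
Proof.
move=> [d1 e1] [d2 e2].
have h1 : differentiable g x by exact/derivable1_diffP.
have h2 : differentiable f (g x) by exact/derivable1_diffP.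
apply: DeriveDef; first exact/derivable1_diffP/differentiable_comp.
by rewrite -derive1E derive1_chain // diff1E // !derive1E e1 e2.
Qed.

Lemma is_derive_inv (x : R) : x != 0 -> is_derive x 1 (@GRing.inv R) (- x ^- 2).
Proof.
move=> x0; have d := @derivable_id R R x (1 : R).
apply: DeriveDef; first exact: (derivableV (f := id) x0 d).
by rewrite (deriveV (f := id) x0 d) derive_id /GRing.scale /= mulr1.
Qed.

End Calculus.

(** * Flat functions, bumps and ramps *)

Section Flat.
Context {R : realType}.

(** The functions [x^-n exp (- 1 / x)] form a family stable under
    differentiation, up to linear combinations; this is how [flat 0] is seen to
    be smooth at 0. *)
Definition flat n (x : R) : R := if 0 < x then x^-1 ^+ n * expR (- x^-1) else 0.

(** The quadratic bound yields a zero derivative at 0. It follows from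
    [y <= exp y] for [y = 1 / ((n + 2) x)], raised to the power [n + 2]. *)
Lemma flat_le n (x : R) : exists2 C, 0 <= C & forall x, `|flat n x| <= C * x ^+ 2.
Proof.
exists (n.+2%:R ^+ n.+2) => [|{}x]; first exact: exprn_ge0.
rewrite /flat; case: ltP => [x0|_]; last first.
  by rewrite normr0 mulr_ge0 ?sqr_ge0 // exprn_ge0.
have y0 : 0 < x^-1 by rewrite invr_gt0.
rewrite ger0_norm; last by rewrite mulr_ge0 ?expR_ge0 // exprn_ge0 // ltW.
rewrite expRN ler_pdivrMr ?expR_gt0 //.
have -> : expR x^-1 = expR (x^-1 / n.+2%:R) ^+ n.+2.
  by rewrite -expRM_natl mulrC divfK // pnatr_eq0.
have : (x^-1 / n.+2%:R) ^+ n.+2 <= expR (x^-1 / n.+2%:R) ^+ n.+2.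
  rewrite lerXn2r ?nnegrE ?expR_ge0 //.
    by rewrite mulr_ge0 // ltW.
  by apply: le_trans (expR_ge1Dx _); rewrite lerDr.
rewrite expr_div_n ler_pdivrMr ?exprn_gt0 // => H.
have -> : x^-1 ^+ n = x ^+ 2 * x^-1 ^+ n.+2.
  rewrite -(addn2 n) exprD exprVn mulrC -mulrA exprVn mulVf ?mulr1 //.
  by rewrite expf_neq0 // gt_eqF.
apply: le_trans (ler_wpM2l (sqr_ge0 x) H) _.
by rewrite mulrA mulrC mulrA lexx.
Qed.

Lemma flat_derive n (x : R) :
  is_derive x 1 (flat n) (flat n.+2 x - n%:R * flat n.+1 x).
Proof.
have [x0|x0|x0] := ltgtP 0 x.
- have nE : {near x, (fun y => y^-1 ^+ n * expR (- y^-1)) =1 flat n}.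
    have : \forall y \near x, 0 < y by exact: lt_nbhsr.
    by apply: filterS => y y0; rewrite /flat y0.
  apply: (near_eq_is_derive nE).
  have xn0 : x != 0 by rewrite gt_eqF.
  have d1 := is_derive_inv xn0.
  have d1N : is_derive x 1 (fun y : R => - y^-1) (x ^- 2).
    by rewrite -[x ^- 2]opprK; exact: is_deriveN.
  have d2 : is_derive x 1 (fun y : R => expR (- y^-1)) (x ^- 2 *: expR (- x^-1)).
    exact: (is_derive_comp1 d1N (is_derive_expR _)).
  have d3 := is_deriveX n d1.
  have := is_deriveM d3 d2.
  rewrite (_ : GRing.inv ^+ n * _ = fun y => y^-1 ^+ n * expR (- y^-1)); last first.
    by apply/funext => y; rewrite !fctE.
  move=> H; apply: is_derive_eq.
  rewrite /flat x0 /GRing.scale /= ?fctE.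
  case: n {nE d3 H} => [|n] /=.
    by rewrite !expr0 !mul0r subr0 mulr0 addr0 mul1r exprVn.
  by rewrite -!exprVn !exprS; ring.
- have nE : {near x, cst 0 =1 flat n}.
    have : \forall y \near x, y < 0 by exact: lt_nbhsl.
    by apply: filterS => y y0; rewrite /flat ltNge ltW.
  apply: (near_eq_is_derive nE).
  have -> : flat n.+2 x - n%:R * flat n.+1 x = 0.
    by rewrite /flat [0 < x]ltNge ltW //= mulr0 subr0.
  exact: (is_derive_cst (0 : R)).
- subst x.
  have -> : flat n.+2 0 - n%:R * flat n.+1 0 = 0 by rewrite /flat ltxx mulr0 subr0.
  have [C C0 HC] := flat_le n 0.
  have H : h^-1 *: (flat n (h *: (1 : R) + 0) - flat n 0) @[h --> (0 : R)^'] --> (0 : R).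
    apply/cvgr0Pnorm_le => e e0; near=> h.
    have h0 : h != 0 by near: h; exact: nbhs_dnbhs_neq.
    rewrite addr0 [h *: _]mulr1 {2}/flat ltxx subr0 normrM normfV.
    rewrite ler_pdivrMl ?normr_gt0 //; apply: le_trans (HC h) _.
    rewrite -(real_normK (num_real h)) expr2 mulrA mulrC ler_wpM2l //.
    rewrite (@le_trans _ _ ((C + 1) * `|h|)) // ?ler_wpM2r // ?lerDl //.
    rewrite mulrC -ler_pdivlMr ?ltr_wpDl //.
    near: h; apply: dnbhs0_le; rewrite divr_gt0 // ltr_wpDl //.
  apply: DeriveDef; first by apply/cvg_ex; exists 0.
  exact: cvg_lim H.
Unshelve. all: by end_near. Qed.

Lemma class_Ck_flat k n (v : R) : class_Ck k setT (fun x => v * flat n x).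
Proof.
elim: k n v => [|k IH] n v.
  move=> x _; apply: differentiable_continuous; apply/derivable1_diffP.
  by have [d _] := flat_derive n x; exact: derivableZ.
apply: (@class_Ck_derive1 R R k setT _
  (fun x => v * (flat n.+2 x - n%:R * flat n.+1 x))); first exact: openT.
  by move=> x _; exact: is_deriveZ (flat_derive n x).
move=> w; have := class_CkD openT (IH n.+2 (w * v)) (IH n.+1 (- (w * v * n%:R))).
by apply: class_Ck_congr => [|x _]; [exact: openT|rewrite /GRing.scale /=; ring].
Qed.

Lemma smooth_flat (x : R) : smooth_at (flat 0) x.
Proof.
exists setT; split => //; first exact: openT.
move=> k; have := class_Ck_flat k 0 1; apply: class_Ck_congr; first exact: openT.
by move=> y _; rewrite mul1r.
Qed.

Lemma flat_gt0 (x : R) : 0 < x -> 0 < flat 0 x.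
Proof. by move=> x0; rewrite /flat x0 expr0 mul1r expR_gt0. Qed.

Lemma flat_le0 (x : R) : x <= 0 -> flat 0 x = 0.
Proof. by move=> x0; rewrite /flat ltNge x0. Qed.

Lemma flat_ge0 (x : R) : 0 <= flat 0 x.
Proof. by case: (lerP x 0) => [/flat_le0 ->|/flat_gt0 /ltW]. Qed.

Lemma smooth_bump (c d : R) : 0 < d -> exists B : R -> R,
  [/\ forall x, smooth_at B x, forall x, 0 <= B x, B c = 1 &
      forall x, d <= `|x - c| -> B x = 0].
Proof.
move=> d0; pose N := flat 0 d * flat 0 d.
have N0 : 0 < N by rewrite mulr_gt0 // flat_gt0.
exists (fun x => (flat 0 (d - x + c) * flat 0 (d + x - c)) * N^-1).
split.
- have FR := @framed_R R.
  move=> x; apply: smooth_atM; last exact: smooth_at_cst.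
  apply: smooth_atM.
    apply: (smooth_at_compR (f := fun x => d - x + c) FR); last exact: smooth_flat.
    apply: smooth_atD; last exact: smooth_at_cst.
    by apply: smooth_atB; [exact: smooth_at_cst|exact: smooth_at_id].
  apply: (smooth_at_compR (f := fun x => d + x - c) FR); last exact: smooth_flat.
  apply: smooth_atB; last exact: smooth_at_cst.
  by apply: smooth_atD; [exact: smooth_at_cst|exact: smooth_at_id].
- by move=> x; rewrite !mulr_ge0 ?flat_ge0 // invr_ge0 ltW.
- by rewrite subrK addrK divff // gt_eqF.
- move=> x; rewrite ler_normr => /orP[H|H].
    by rewrite flat_le0 ?mul0r //; lra.
  by rewrite [X in _ * X / _]flat_le0 ?mulr0 ?mul0r //; lra.
Qed.

(** The symmetry [t x + t (- x) = 1] is what makes the primitive of [t] equal to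
    the identity beyond [e] in [smooth_ramp]. *)
Lemma smooth_step (e : R) : 0 < e -> exists t : R -> R,
  [/\ forall x, smooth_at t x, forall x, x <= - e -> t x = 0,
      forall x, - e < x -> 0 < t x & forall x, t x + t (- x) = 1].
Proof.
move=> e0; pose D x := flat 0 (x + e) + flat 0 (e - x).
have D0 x : 0 < D x.
  rewrite /D; case: (ltP (- e) x) => xe.
    by apply: ltr_wpDr; [exact: flat_ge0|apply: flat_gt0; lra].
  by apply: ltr_wpDl; [exact: flat_ge0|apply: flat_gt0; lra].
exists (fun x => flat 0 (x + e) * (D x)^-1); have FR := @framed_R R; split.
- move=> x.
  have S1 : smooth_at (fun x => flat 0 (x + e)) x.
    apply: (smooth_at_compR (f := fun x => x + e) FR); last exact: smooth_flat.
    by apply: smooth_atD; [exact: smooth_at_id|exact: smooth_at_cst].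
  have S2 : smooth_at (fun x => flat 0 (e - x)) x.
    apply: (smooth_at_compR (f := fun x => e - x) FR); last exact: smooth_flat.
    by apply: smooth_atB; [exact: smooth_at_cst|exact: smooth_at_id].
  by apply: smooth_atM => //; apply: smooth_atV; [rewrite gt_eqF|exact: smooth_atD].
- by move=> x xe; rewrite flat_le0 ?mul0r //; lra.
- by move=> x xe; rewrite divr_gt0 //; apply: flat_gt0; lra.
- move=> x; have -> : D (- x) = D x by rewrite /D opprK addrC [- x + e]addrC [e + x]addrC.
  rewrite -mulrDl [- x + e]addrC -/(D x) divff // gt_eqF //.
Qed.

(** A smooth version of [max 0], used to round corners: the primitive of a step
    function. The derivative of [A x - A (- x) - x] is [t x + t (- x) - 1 = 0],
    so [A x = x] as soon as [A (- x)] vanishes. *)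
Lemma smooth_ramp (e : R) : 0 < e -> exists A t : R -> R,
  [/\ forall x, smooth_at A x, forall x, is_derive x (1 : R) A (t x),
      forall x, x <= - e -> A x = 0, forall x, e <= x -> A x = x &
      (forall x, 0 <= t x) /\ (forall x, - e < x -> 0 < t x)].
Proof.
move=> e0; have [t [St t0 tp tsym]] := smooth_step e0.
pose A (x : R) : R := (\int[lebesgue_measure]_(s in `[(- (2 * e))%R, x]) t s)%R.
have A0 x : x <= - e -> A x = 0.
  move=> xe; rewrite /A /Rintegral integral0_eq // => s /=.
  by rewrite in_itv /= => /andP[_ sx]; rewrite t0 //; exact: le_trans xe.
have ct : continuous t by move=> x; exact: smooth_at_continuous.
have dA (x : R) : is_derive x (1 : R) A (t x).
  case: (ltP x (- e)) => xe.
    have nE : {near x, (fun=> 0 : R) =1 A}.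
      by apply: filterS (lt_nbhsl xe) => y ye; rewrite A0 // ltW.
    apply: (near_eq_is_derive nE); rewrite t0; last exact: ltW.
    exact: (is_derive_cst (0 : R)).
  have int : lebesgue_measure.-integrable [set` Interval (BLeft (- (2 * e))) (BRight (x + 1))] (EFin \o t).
    apply: continuous_compact_integrable; first exact: segment_compact.
    by apply: continuous_subspaceT => y; exact: ct.
  have xx : x < x + 1 by lra.
  have [|d1 d2] := continuous_FTC1 xx int _ (ct x).
    by rewrite lte_fin; lra.
  by apply: DeriveDef => //; rewrite -derive1E.
exists A, t; split => //.
- move=> x; exists setT; split => //; first exact: openT.
  have Sk k : class_Ck k.+1 setT A.
    apply: (class_Ck_derive1 (f' := t) openT (fun y _ => dA y)) => v.
    have St' : smooth_on setT t by apply: smooth_onP => y _; exact: St.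
    have [l El] := scalel_linear v.
    have := class_CkM openT (class_Ck_cst k setT v) (St' k).
    by [].
  by move=> k; exact: class_CkS (Sk k).
- move=> x ex.
  have H (y : R) : A y - A (- y) - y = 0.
    have -> : 0 = A 0 - A (- 0) - 0 by rewrite oppr0 subrr addr0.
    apply: (@is_derive_0_is_cst R (fun y => A y - A (- y) - y)) => z.
    have dN : is_derive z (1 : R) (fun y : R => - y) (-1) by exact: is_deriveNid.
    have d1 := is_derive_comp1 dN (dA (- z)).
    have d2 := is_deriveB (is_deriveB (dA z) d1) (is_derive_id z (1 : R)).
    apply: (is_derive_eq d2).
    rewrite /GRing.scale /= mulN1r opprK tsym subrr //.
  by have := H x; rewrite (A0 (- x)) ?lerN2 // subr0 => /subr0_eq.
- split=> // x; case: (lerP x (- e)) => [/t0 ->//|/tp/ltW//].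
Qed.

End Flat.

(** * Maps and curves on a smooth surface *)

Section Manifold.
Context {R : realType} {S : topologicalType}.
Local Notation plane := 'rV[R]_2.
Implicit Types (c d : chart R S) (p q : S).

Lemma chart_imgP c (x : plane) : (chart_fun c @` chart_dom c) x ->
  chart_fun c (chart_inv c x) = x /\ chart_dom c (chart_inv c x).
Proof. by move=> [p cp <-]; rewrite !chart_funK. Qed.

Lemma chart_img c p : chart_dom c p -> (chart_fun c @` chart_dom c) (chart_fun c p).
Proof. by move=> cp; exists p. Qed.

Lemma chart_dom_nbhs c p : chart_dom c p -> nbhs p (chart_dom c).
Proof. by move=> cp; apply: open_nbhs_nbhs; split => //; exact: chart_dom_open. Qed.

Lemma chart_img_nbhs c p : chart_dom c p ->
  nbhs (chart_fun c p) (chart_fun c @` chart_dom c).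
Proof.
move=> cp; apply: open_nbhs_nbhs; split; first exact: chart_cod_open.
exact: chart_img.
Qed.

Lemma near_chart_inv c p (N : set S) : chart_dom c p -> nbhs p N ->
  \forall y \near chart_fun c p, N (chart_inv c y).
Proof.
move=> cp Np; have := @chart_inv_continuous _ _ c _ (chart_img cp).
by rewrite /prop_for /continuous_at chart_funK //; apply.
Qed.

Lemma near_chart_fun c p (N : set plane) : chart_dom c p ->
  nbhs (chart_fun c p) N -> \forall q \near p, N (chart_fun c q).
Proof. by move=> cp; exact: chart_fun_continuous. Qed.

Lemma chart_open_img c (U : set S) : open U -> U `<=` chart_dom c ->
  open (chart_fun c @` U).
Proof.
move=> oU Uc; rewrite openE => _ [p Up <-].
have cp := Uc _ Up.
apply: filterS2 (chart_img_nbhs cp) (near_chart_inv cp (open_nbhs_nbhs (conj oU Up))).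
by move=> y /chart_imgP[y1 y2] Uy; exists (chart_inv c y).
Qed.

Context (A : set (chart R S)) (hA : smooth_surface A).

Let hS : smooth_structure A. Proof. by case: hA. Qed.

Lemma chart_at p : exists2 c, A c & chart_dom c p.
Proof. by case: hS => H _ _; exact: H. Qed.

Lemma smooth_transition_at c d p : smooth_transition c d ->
  chart_dom c p -> chart_dom d p ->
  smooth_at (chart_fun d \o chart_inv c) (chart_fun c p).
Proof.
move=> scd cp dp; exists (chart_fun c @` (chart_dom c `&` chart_dom d)); split => //.
  by apply: chart_open_img; [apply: openI; exact: chart_dom_open|move=> q []].
by exists p.
Qed.

Lemma transition_smooth c d p : A c -> A d -> chart_dom c p -> chart_dom d p ->
  smooth_at (chart_fun d \o chart_inv c) (chart_fun c p).
Proof. by move=> Ac Ad; apply: smooth_transition_at; case: hS => _ + _; exact. Qed.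

(** Pointwise form of [smooth_map]; by [smooth_ptI] a single pair of charts is
    enough to check it. *)
Definition smooth_pt (f : S -> S) p := {for p, continuous f} /\
  forall c d, A c -> A d -> chart_dom c p -> chart_dom d (f p) ->
  smooth_at (chart_fun d \o f \o chart_inv c) (chart_fun c p).

Lemma smooth_ptI (f : S -> S) p c d : {for p, continuous f} -> A c -> A d ->
  chart_dom c p -> chart_dom d (f p) ->
  smooth_at (chart_fun d \o f \o chart_inv c) (chart_fun c p) -> smooth_pt f p.
Proof.
move=> cf Ac Ad cp dfp sf; split => // c' d' Ac' Ad' cp' dfp'.
have F2 := @framed_rV R 1.
have s1 := transition_smooth Ac' Ac cp' cp.
have s3 := transition_smooth Ad Ad' dfp dfp'.
have s2 := smooth_at_comp (f := chart_fun c \o chart_inv c')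
  (g := chart_fun d \o f \o chart_inv c) F2 s1.
rewrite /= chart_funK // in s2; have {}s2 := s2 sf.
have := smooth_at_comp (f := (chart_fun d \o f \o chart_inv c) \o (chart_fun c \o chart_inv c'))
  (g := chart_fun d' \o chart_inv d) F2 s2.
rewrite /= !(chart_funK cp') (chart_funK cp) => /(_ s3).
apply: smooth_at_congr.
have N1 : nbhs p (chart_dom c) by exact: chart_dom_nbhs.
have N2 : nbhs p (f @^-1` chart_dom d) by apply: cf; exact: chart_dom_nbhs.
apply: filterS2 (near_chart_inv cp' N1) (near_chart_inv cp' N2) => y h1 h2 /=.
by rewrite (chart_funK h1) (chart_funK h2).
Qed.

Lemma smooth_map_pt (h : S -> S) : smooth_map A h <-> forall p, smooth_pt h p.
Proof.
split=> [[ch H] p|H].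
  split=> [|c d Ac Ad cp dp]; first exact: ch.
  have oh : open (h @^-1` chart_dom d).
    by apply: open_comp; [move=> *; exact: ch|exact: chart_dom_open].
  exists (chart_fun c @` (chart_dom c `&` h @^-1` chart_dom d)); split.
  - apply: chart_open_img; last by move=> q [].
    by apply: openI => //; exact: chart_dom_open.
  - by exists p.
  - exact: H.
split=> [p|c d Ac Ad]; first by case: (H p).
apply: smooth_onP => _ [p [cp dp] <-]; have [_] := H p; exact.
Qed.

Lemma smooth_pt_diff (h : S -> S) p : smooth_pt h p -> differentiable_at A h p.
Proof.
by move=> [_ H] c d Ac Ad cp dp; apply: smooth_at_differentiable; exact: H.
Qed.

(** Smoothness with a nonzero velocity in one chart; [regular_at_chart]
    transfers it to every other chart. *)
Definition regular_at (g : R -> S) (t : R) := {for t, continuous g} /\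
  exists c, [/\ A c, chart_dom c (g t), smooth_at (chart_fun c \o g) t
   & derive1 (chart_fun c \o g) t != 0].

Lemma near_eq_derive1 (W : normedModType R) (f g : R -> W) (t : R) :
  {near t, f =1 g} -> derive1 f t = derive1 g t.
Proof. by move=> fg; rewrite !derive1E; exact: near_eq_derive. Qed.

Lemma curve_through c d (f : S -> S) (g : R -> S) (t : R) :
  {for t, continuous g} -> chart_dom c (g t) ->
  smooth_at (chart_fun d \o f \o chart_inv c) (chart_fun c (g t)) ->
  smooth_at (chart_fun c \o g) t ->
  smooth_at (chart_fun d \o f \o g) t /\
  derive1 (chart_fun d \o f \o g) t =
    'd (chart_fun d \o f \o chart_inv c) (chart_fun c (g t))
       (derive1 (chart_fun c \o g) t).
Proof.
move=> cg cgt sf sg.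
have nE : {near t, (chart_fun d \o f \o chart_inv c) \o (chart_fun c \o g) =1
                   chart_fun d \o f \o g}.
  have N1 : nbhs t (g @^-1` chart_dom c) by apply: cg; exact: chart_dom_nbhs.
  by apply: filterS N1 => s gs /=; rewrite chart_funK.
split; first by apply: (smooth_at_congr nE); apply: smooth_at_comp => //; exact: framed_rV.
rewrite -(near_eq_derive1 nE) (derive1_chain (g := chart_fun c \o g)) //;
  exact: smooth_at_differentiable.
Qed.

Lemma regular_at_chart (g : R -> S) t c : regular_at g t -> A c ->
  chart_dom c (g t) ->
  smooth_at (chart_fun c \o g) t /\ derive1 (chart_fun c \o g) t != 0.
Proof.
move=> [cg [d [Ad dg sg dg0]]] Ac cgt.
have s1 := transition_smooth Ad Ac dg cgt.
have [S1 D1] := curve_through (d := c) (f := id) cg dg s1 sg.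
split; [exact: S1|apply: contra_neq dg0 => E].
have s2 := transition_smooth Ac Ad cgt dg.
have [_ ->] := curve_through (d := d) (f := id) cg cgt s2 S1.
by rewrite E; exact: linear0.
Qed.

Lemma smooth_paramP (g : R -> S) : smooth_param A g <->
  simple_closed_param g /\ forall t, regular_at g t.
Proof.
split=> [[H1 H2]|[H1 H2]]; split => //.
  move=> t; have cg : continuous g by case: H1.
  split; first exact: cg.
  have [c Ac cgt] := chart_at (g t); exists c; have [H3 H4] := H2 c Ac.
  split => //; last exact: H4.
  exists (g @^-1` chart_dom c); split => //.
  by apply: open_comp; [move=> *; exact: cg|exact: chart_dom_open].
move=> c Ac; split=> [|t ct]; last by have [] := regular_at_chart (H2 t) Ac ct.
by apply: smooth_onP => t ct; have [] := regular_at_chart (H2 t) Ac ct.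
Qed.

(** The velocity is not killed by [f] because the differential of [g] recovers
    it. *)
Lemma regular_at_comp (f g : S -> S) (u : R -> S) t : cancel f g ->
  smooth_pt f (u t) -> smooth_pt g (f (u t)) -> regular_at u t ->
  regular_at (f \o u) t.
Proof.
move=> fK [cf sf] [cg sg] ru; have [cu [c [Ac cut su du]]] := ru.
have cfu : {for t, continuous (f \o u)} by apply: continuous_comp.
split => //; have [d Ad dfu] := chart_at (f (u t)).
exists d; have [S1 D1] := curve_through cu cut (sf c d Ac Ad cut dfu) su.
split; [by []|by []|exact: S1|apply: contra_neq du => E].
have dgfu : chart_dom c (g (f (u t))) by rewrite fK.
have [_] := curve_through (g := f \o u) cfu dfu (sg d c Ad Ac dfu dgfu) S1.
rewrite E linear0.
have -> : chart_fun c \o g \o (f \o u) = chart_fun c \o u; last by [].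
by apply/funext => s /=; rewrite fK.
Qed.

(** Either [f] is a local diffeomorphism at [p], or [p] is fixed and every
    regular curve through [p] is fixed near [p]; the second case does not ask
    [f] to be differentiable. *)
Definition good_at (f g : S -> S) p :=
  (smooth_pt f p /\ smooth_pt g (f p)) \/
  (f p = p /\ forall (u : R -> S) t, u t = p -> regular_at u t ->
     {near t, f \o u =1 u}).

Definition good_pair (f g : S -> S) :=
  homeomorphism_pair f g /\ forall p, good_at f g p.

Lemma good_regular f g (u : R -> S) t : good_pair f g -> regular_at u t ->
  regular_at (f \o u) t.
Proof.
move=> [[cf cg fK gK] H] ru; have [cu [c [Ac cut su du]]] := ru.
case: (H (u t)) => [[sf sg]|[fE Hu]]; first exact: (regular_at_comp fK).
have nE := Hu u t erefl ru; split; first by apply: continuous_comp => //; exact: cf.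
have nE' : {near t, chart_fun c \o u =1 chart_fun c \o (f \o u)}.
  by apply: filterS nE => s /= ->.
exists c; split; [by []|by rewrite /= fE|exact: (smooth_at_congr nE')|].
by rewrite -(near_eq_derive1 nE'); exact: du.
Qed.

Lemma good_param f g (u : R -> S) : good_pair f g -> smooth_param A u ->
  smooth_param A (f \o u).
Proof.
move=> fg /smooth_paramP[[cu Hu] ru]; have [[cf cg fK gK] _] := fg.
apply/smooth_paramP; split; last by move=> t; exact: (good_regular fg).
split; first by move=> t; apply: continuous_comp; [exact: cu|exact: cf].
move=> s t /=; rewrite -Hu; split=> [/(can_inj fK)//|-> //].
Qed.

Lemma good_curve f g : good_pair f g -> preserves_smooth_curves A f.
Proof.
move=> fg a [u su <-]; exists (f \o u); first exact: (good_param fg).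
by rewrite image_comp.
Qed.

(** At a point where [f] is a local diffeomorphism, the tangent lines are
    transported by its invertible differential. At any other point the curves
    are locally unchanged, and so are their tangent lines. *)
Lemma good_transverse f g : good_pair f g -> preserves_transversality A f.
Proof.
move=> fg a b sa sb tab _ [[q aq <-] [q' bq' fq']] c Ac cfq u.
have [[cf cg fK gK] H] := fg.
have {fq'} E : q' = q by exact: (can_inj fK).
subst q'.
have [c0 Ac0 c0q] := chart_at q.
have tg c1 c2 (e : set S) v : A c1 -> A c2 -> chart_dom c1 q -> chart_dom c2 (f q) ->
   smooth_pt f q -> tangent_space A c1 e q v ->
   tangent_space A c2 (f @` e) (f q)
     ('d (chart_fun c2 \o f \o chart_inv c1) (chart_fun c1 q) v).
  move=> Ac1 Ac2 h1 h2 [_ sf] [w [t [l [sw rw wt ->]]]].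
  exists (f \o w), t, l; split; rewrite /= ?wt //.
  - exact: (good_param fg).
  - by rewrite -rw image_comp.
  have /smooth_paramP[[cw _] rgw] := sw.
  have h3 : chart_dom c1 (w t) by rewrite wt.
  have [S1 _] := regular_at_chart (rgw t) Ac1 h3.
  have s2 := sf c1 c2 Ac1 Ac2 h1 h2; rewrite -wt in s2.
  have [_ D] := curve_through (cw t) h3 s2 S1.
  by rewrite linearZ -wt; congr (_ *: _); exact: esym D.
case: (H q) => [[sf sg]|[fE Hu]].
  have gfq : chart_dom c0 (g (f q)) by rewrite fK.
  have s1 := sg.2 c c0 Ac Ac0 cfq gfq.
  have s2 := sf.2 c0 c Ac0 Ac c0q cfq.
  pose u0 := 'd (chart_fun c0 \o g \o chart_inv c) (chart_fun c (f q)) u.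
  have [v [w [hv hw E]]] := tab q (conj aq bq') c0 Ac0 c0q u0.
  exists ('d (chart_fun c \o f \o chart_inv c0) (chart_fun c0 q) v),
         ('d (chart_fun c \o f \o chart_inv c0) (chart_fun c0 q) w).
  split; [exact: tg|exact: tg|].
  rewrite -linearD -E /u0.
  set Fc := chart_fun c \o f \o chart_inv c0.
  set Gc := chart_fun c0 \o g \o chart_inv c.
  have E1 : chart_fun c0 q = Gc (chart_fun c (f q)).
    by rewrite /Gc /= chart_funK // fK.
  have d1 : differentiable Gc (chart_fun c (f q)).
    exact: smooth_at_differentiable s1.
  have d2 : differentiable Fc (Gc (chart_fun c (f q))).
    rewrite -E1; exact: smooth_at_differentiable s2.
  have nE : {near (chart_fun c (f q)), (@id plane) =1 Fc \o Gc}.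
    have N1 : nbhs (f q) (g @^-1` chart_dom c0).
      by apply: cg; rewrite fK; exact: chart_dom_nbhs.
    apply: filterS2 (chart_img_nbhs cfq) (near_chart_inv cfq N1) => y h1 h2.
    rewrite /Fc /Gc /= (chart_funK h2) gK.
    by have [-> _] := chart_imgP h1.
  have di := is_diff_id (chart_fun c (f q)).
  have [_ D2] := near_eq_diff nE (ex_diff (is_diff_def := di)).
  have D1 := congr1 (fun k : plane -> plane => k u) (diff_comp d1 d2).
  have e : 'd (Fc \o Gc) (chart_fun c (f q)) u = u.
    by rewrite D2 (@diff_val _ _ _ _ _ _ _ di).
  rewrite E1; exact: (etrans (esym e) D1).
have cq : chart_dom c q by rewrite fE in cfq.
have [v [w [hv hw E]]] := tab q (conj aq bq') c Ac cq u.
have tg' (e : set S) z : tangent_space A c e q z -> tangent_space A c (f @` e) (f q) z.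
  move=> [w' [t [l [sw rw wt ->]]]]; exists (f \o w'), t, l; split.
  - exact: (good_param fg).
  - by rewrite -rw image_comp.
  - by rewrite /= wt.
  have /smooth_paramP[_ rgw] := sw.
  congr (_ *: _); apply: near_eq_derive1.
  by apply: filterS (Hu w' t wt (rgw t)) => s /= ->.
by exists v, w; split; [exact: tg'|exact: tg'|].
Qed.

Lemma homeo_nonseparating f g (a : set S) : homeomorphism_pair f g ->
  nonseparating a -> nonseparating (f @` a).
Proof.
move=> [cf cg fK gK] na; rewrite /nonseparating.
have -> : ~` (f @` a) = f @` (~` a).
  apply/seteqP; split=> [x /= nx|_ [x nx <-] [y ay /(can_inj fK) E]].
    by exists (g x); rewrite ?gK // => ag; apply: nx; exists (g x); rewrite ?gK.
  by apply: nx; rewrite -E.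
by apply: connected_continuous_connected => //; exact: continuous_subspaceT.
Qed.

End Manifold.

(** * Planting a plane map in a chart, and the action on the graph of curves *)

Section Transplant.
Context {R : realType} {S : topologicalType}.
Local Notation plane := 'rV[R]_2.
Context (A : set (chart R S)) (hA : smooth_surface A).
Implicit Types (c d : chart R S) (p q : S).

Definition transplant c (F : plane -> plane) p :=
  if `[< chart_dom c p >] then chart_inv c (F (chart_fun c p)) else p.

(** The compact support makes the planted map continuous at the boundary of the
    chart domain: in a Hausdorff surface the points where the map is not the
    identity lie in a closed subset of the domain. *)
Record supported c (K : set plane) (F G : plane -> plane) : Prop := Supported {
  supp_compact : compact K;
  supp_sub : K `<=` chart_fun c @` chart_dom c;
  supp_FK : cancel F G;
  supp_GK : cancel G F;
  supp_F : continuous F;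
  supp_out : forall x, ~ K x -> F x = x }.

Lemma supported_sym c K F G : continuous G -> supported c K F G -> supported c K G F.
Proof.
move=> cG [h1 h2 FK GK cF out]; split => // x Kx.
by rewrite -{1}(out x Kx) FK.
Qed.

Section OneMap.
Variables (c : chart R S) (K : set plane) (F G : plane -> plane).
Hypothesis Ac : A c.
Hypothesis sFG : supported c K F G.

Let img x : (chart_fun c @` chart_dom c) x -> (chart_fun c @` chart_dom c) (F x).
Proof.
case: sFG => cK sK FK GK _ out ix; have [kx|nk] := pselect (K (F x)); first exact: sK.
have E : F (F x) = F x by exact: out.
by rewrite (can_inj FK E).
Qed.

Lemma transplant_in p : chart_dom c p ->
  chart_dom c (transplant c F p) /\ chart_fun c (transplant c F p) = F (chart_fun c p).
Proof.
move=> cp; rewrite /transplant; case: asboolP => // _.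
by have [] := chart_imgP (img (chart_img cp)).
Qed.

Lemma transplant_notin p : ~ chart_dom c p -> transplant c F p = p.
Proof. by move=> cp; rewrite /transplant; case: asboolP. Qed.

Lemma transplant_out p : (chart_dom c p -> ~ K (chart_fun c p)) -> transplant c F p = p.
Proof.
move=> H; rewrite /transplant; case: asboolP => // cp.
by case: sFG => _ _ _ _ _ out; rewrite out ?chart_funK //; exact: H.
Qed.

Lemma transplant_near_out p : ~ chart_dom c p -> {near p, (@id S) =1 transplant c F}.
Proof.
move=> ncp; case: sFG => cK sK _ _ _ out.
have cpt : compact (chart_inv c @` K).
  apply: continuous_compact => //; apply: continuous_in_subspaceT => x.
  by rewrite inE => /sK; exact: chart_inv_continuous.
have ccl : closed (chart_inv c @` K).
  by apply: compact_closed => //; case: hA.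
have np : (~` (chart_inv c @` K)) p.
  by move=> [x Kx E]; apply: ncp; rewrite -E; have [] := chart_imgP (sK _ Kx).
apply: filterS (open_nbhs_nbhs (conj (closed_openC ccl) np)) => q nq.
rewrite transplant_out // => cq Kq; apply: nq; exists (chart_fun c q) => //.
by rewrite chart_funK.
Qed.

Lemma transplant_continuous : continuous (transplant c F).
Proof.
move=> p; have [cp|ncp] := pselect (chart_dom c p); last first.
  have nE := transplant_near_out ncp.
  rewrite /continuous_at -(nbhs_singleton nE).
  by apply: cvg_trans (@cvg_id _ _); apply: near_eq_cvg.
have nE : {near p, (chart_inv c \o F \o chart_fun c) =1 transplant c F}.
  by apply: filterS (chart_dom_nbhs cp) => q cq; rewrite /transplant; case: asboolP.
rewrite /continuous_at -(nbhs_singleton nE).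
apply: cvg_trans; first exact: near_eq_cvg nE.
apply: continuous_comp; first exact: chart_fun_continuous.
apply: continuous_comp; last exact/chart_inv_continuous/img/chart_img.
by case: sFG => _ _ _ _ cF _; exact: cF.
Qed.

Lemma smooth_pt_near_id (f : S -> S) p : {near p, (@id S) =1 f} -> smooth_pt A f p.
Proof.
move=> nE; have [d Ad dp] := chart_at hA p.
have fp := nbhs_singleton nE.
have cf : {for p, continuous f}.
  rewrite /prop_for /continuous_at -fp.
  by apply: cvg_trans (@cvg_id _ _); apply: near_eq_cvg.
apply: (smooth_ptI hA cf Ad Ad dp); first by rewrite -fp.
have nE' : {near (chart_fun d p), (@id plane) =1 chart_fun d \o f \o chart_inv d}.
  apply: filterS2 (chart_img_nbhs dp) (near_chart_inv dp nE) => y h1 /= <-.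
  by have [] := chart_imgP h1.
apply: (smooth_at_congr nE'); exact: smooth_at_id.
Qed.

Lemma transplant_smooth p : (chart_dom c p -> smooth_at F (chart_fun c p)) ->
  smooth_pt A (transplant c F) p.
Proof.
have [cp|ncp _] := pselect (chart_dom c p); last first.
  exact/smooth_pt_near_id/transplant_near_out.
move=> /(_ cp) sF; have [cFp _] := transplant_in cp.
apply: (smooth_ptI hA _ Ac Ac cp cFp); first exact: transplant_continuous.
apply: smooth_at_congr sF.
apply: filterS (chart_img_nbhs cp) => y /chart_imgP[y1 y2] /=.
by have [_ ->] := transplant_in y2; rewrite y1.
Qed.

End OneMap.

Lemma transplantK c K F G : supported c K F G ->
  cancel (transplant c F) (transplant c G).
Proof.
move=> sFG p; have [cp|ncp] := pselect (chart_dom c p); last first.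
  by rewrite !transplant_notin.
have [h1 h2] := transplant_in sFG cp.
rewrite {1}/transplant; case: asboolP => // _.
by rewrite h2; case: sFG => _ _ -> *; rewrite chart_funK.
Qed.

Lemma transplant_homeo c K F G : supported c K F G -> continuous G ->
  homeomorphism_pair (transplant c F) (transplant c G).
Proof.
move=> sFG cG; have sGF := supported_sym cG sFG.
by split; [exact: transplant_continuous sFG|exact: transplant_continuous sGF
          |exact: transplantK sFG|exact: transplantK sGF].
Qed.

(** The condition on [F] that becomes [good_at] once [F] is planted in a chart. *)
Definition plane_good_at (F G : plane -> plane) (x : plane) :=
  (smooth_at F x /\ smooth_at G (F x)) \/
  (F x = x /\ forall (u : R -> plane) t, u t = x -> smooth_at u t ->
    derive1 u t != 0 -> {near t, F \o u =1 u}).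

Lemma transplant_good c K F G : A c -> supported c K F G -> continuous G ->
  (forall x, plane_good_at F G x) ->
  good_pair A (transplant c F) (transplant c G).
Proof.
move=> Ac sFG cG H; split; first exact: transplant_homeo sFG cG.
have sGF := supported_sym cG sFG.
move=> p; have [cp|ncp] := pselect (chart_dom c p); last first.
  left; have -> : transplant c F p = p by exact: transplant_notin.
  by split; [exact: (transplant_smooth Ac sFG)|exact: (transplant_smooth Ac sGF)].
have [cFp EFp] := transplant_in sFG cp.
have [[sF sG]|[Fx Hu]] := H (chart_fun c p).
  left; split; first exact: (transplant_smooth Ac sFG).
  by apply: (transplant_smooth Ac sGF) => _; rewrite EFp.
right; split; first by rewrite /transplant; case: asboolP => // _; rewrite Fx chart_funK.
move=> u t utp ru; have [cu _] := ru.
have cut : chart_dom c (u t) by rewrite utp.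
have [su du] := regular_at_chart hA ru Ac cut.
have E : (chart_fun c \o u) t = chart_fun c p by rewrite /= utp.
have N1 : nbhs t (u @^-1` chart_dom c) by apply: cu; exact: chart_dom_nbhs.
apply: filterS2 N1 (Hu _ _ E su du) => s cus /= Es.
by rewrite /transplant; case: asboolP => // _; rewrite Es chart_funK.
Qed.

Lemma sval_inj (T : Type) (P : T -> Prop) (x y : {a | P a}) :
  sval x = sval y -> x = y.
Proof.
by case: x y => a p [b q] /= e; subst b; congr exist; exact: Prop_irrelevance.
Qed.

Section GraphAction.
Variables (f g : S -> S).
Hypothesis fg : good_pair A f g.

Lemma vertex_image (x : NC_vertex A) :
  smooth_curve A (f @` sval x) /\ nonseparating (f @` sval x).
Proof.
case: x => a [sa na] /=; split; first exact: (good_curve hA fg).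
exact: (homeo_nonseparating fg.1 na).
Qed.

Definition vertex_map (x : NC_vertex A) : NC_vertex A := exist _ _ (vertex_image x).
End GraphAction.

Lemma vertex_mapK f g (fg : good_pair A f g) (gf : good_pair A g f) :
  cancel (vertex_map fg) (vertex_map gf).
Proof.
move=> [a ha]; apply: sval_inj; rewrite /= image_comp.
have [[_ _ fK _] _] := fg.
rewrite /=; apply/seteqP; split=> [_ [x ax <-]|x ax] /=; [by rewrite fK|by exists x].
Qed.

Lemma vertex_map_edge f g (fg : good_pair A f g) x y :
  NC_edge x y -> NC_edge (vertex_map fg x) (vertex_map fg y).
Proof.
have [[cf cg fK gK] _] := fg.
have fI (a b : set S) : (f @` a) `&` (f @` b) = f @` (a `&` b).
  apply/seteqP; split=> [_ [[q aq <-] [r br /(can_inj fK) E]]|_ [q [aq bq] <-]].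
    by exists q => //; split => //; rewrite -E.
  by split; exists q.
case: x y => a [sa na] [b [sb nb]] [/= ab H]; split => /=.
  move=> E; apply: ab; apply/seteqP; split=> q hq.
    have : (f @` b) (f q) by rewrite -E; exists q.
    by move=> [r br /(can_inj fK) <-].
  have : (f @` a) (f q) by rewrite E; exists q.
  by move=> [r br /(can_inj fK) <-].
case: H => [H|[[p Hp] tr]]; first by left; rewrite fI H image_set0.
right; split; last exact: (good_transverse hA fg).
by exists (f p); rewrite fI Hp image_set1.
Qed.

Lemma vertex_map_aut f g (fg : good_pair A f g) (gf : good_pair A g f) :
  bijective (vertex_map fg) /\ forall x y,
    NC_edge (vertex_map fg x) (vertex_map fg y) <-> NC_edge x y.
Proof.
split; first by exists (vertex_map gf); exact: vertex_mapK.
move=> x y; split; last exact: vertex_map_edge.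
by move=> /(vertex_map_edge gf); rewrite !vertex_mapK.
Qed.

Definition graph_aut f g (fg : good_pair A f g) (gf : good_pair A g f) : NC_Aut A :=
  exist _ _ (vertex_map_aut fg gf).

Lemma diff_good (h : Diff A) : exists k, good_pair A (sval h) k /\ good_pair A k (sval h).
Proof.
case: h => h [sh [k [sk hK kK]]] /=; exists k.
have sh' := (smooth_map_pt A h).1 sh; have sk' := (smooth_map_pt A k).1 sk.
by split; split; [split; [case: sh|case: sk| |]| |split; [case: sk|case: sh| |]|];
  move=> // p; left.
Qed.

Lemma natural_map_exists : exists N : Diff A -> NC_Aut A, natural_map N.
Proof.
pose N h := let: exist k hk := cid (diff_good h) in graph_aut hk.1 hk.2.
by exists N => h x; rewrite /N; case: cid => k [h1 h2].
Qed.

End Transplant.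

(** * Euclidean geometry of the plane *)

Section Plane.
Context {R : realType}.
Local Notation plane := 'rV[R]_2.

Definition vec (a b : R) : plane := \row_(i < 2) (if i == 0 then a else b).

Lemma vec0 a b : vec a b 0 0 = a. Proof. by rewrite mxE. Qed.
Lemma vec1 a b : vec a b 0 1 = b. Proof. by rewrite mxE. Qed.

Lemma plane_eq (x y : plane) : x 0 0 = y 0 0 -> x 0 1 = y 0 1 -> x = y.
Proof.
move=> e0 e1; apply/rowP => i; have [->//|->//] : i = 0 \/ i = 1.
by case: i => [[|[|//]] hi]; [left|right]; exact: val_inj.
Qed.

Lemma plane_vec (x : plane) : x = vec (x 0 0) (x 0 1).
Proof. by apply: plane_eq; rewrite ?vec0 ?vec1. Qed.

Lemma smooth_at_vec (V : normedModType R) (f g : V -> R) (x : V) :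
  smooth_at f x -> smooth_at g x -> smooth_at (fun y => vec (f y) (g y)) x.
Proof.
move=> sf sg; apply/smooth_at_coord => i.
have [->|->] : i = 0 \/ i = 1.
  by case: i => [[|[|//]] hi]; [left|right]; exact: val_inj.
- by under [X in smooth_at X]eq_fun do rewrite vec0.
- by under [X in smooth_at X]eq_fun do rewrite vec1.
Qed.

Implicit Types (x y z w : plane).

Lemma smooth_coord i x : smooth_at (fun y : plane => y 0 i) x.
Proof. exact: (smooth_at_coord id x).1 (smooth_at_id x) i. Qed.

Definition dot x y : R := x 0 0 * y 0 0 + x 0 1 * y 0 1.
Definition sq x : R := dot x x.
Definition perp x : plane := vec (- x 0 1) (x 0 0).

Lemma sqE x : sq x = x 0 0 ^+ 2 + x 0 1 ^+ 2. Proof. by rewrite /sq /dot !expr2. Qed.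

Lemma sq_ge0 x : 0 <= sq x. Proof. by rewrite sqE addr_ge0 ?sqr_ge0. Qed.

Lemma sq_eq0 x : (sq x == 0) = (x == 0).
Proof.
rewrite sqE paddr_eq0 ?sqr_ge0 // !sqrf_eq0; apply/andP/eqP.
  by move=> [/eqP e0 /eqP e1]; apply: plane_eq; rewrite mxE.
by move=> ->; rewrite !mxE.
Qed.

Lemma sq0 : sq 0 = 0. Proof. by apply/eqP; rewrite sq_eq0. Qed.

Lemma sq_gt0 x : x != 0 -> 0 < sq x.
Proof. by move=> x0; rewrite lt_neqAle sq_ge0 andbT eq_sym sq_eq0. Qed.

Lemma coordD x y i : (x + y) 0 i = x 0 i + y 0 i. Proof. by rewrite mxE. Qed.
Lemma coordN x i : (- x) 0 i = - x 0 i. Proof. by rewrite mxE. Qed.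
Lemma coordZ a x i : (a *: x) 0 i = a * x 0 i. Proof. by rewrite mxE. Qed.
Lemma coord0 i : (0 : plane) 0 i = 0. Proof. by rewrite mxE. Qed.
Lemma perp0 x : perp x 0 0 = - x 0 1. Proof. by rewrite vec0. Qed.
Lemma perp1 x : perp x 0 1 = x 0 0. Proof. by rewrite vec1. Qed.
Definition coordE := (coordD, coordN, coordZ, coord0, perp0, perp1, vec0, vec1).

(** The norm of the plane is the sup norm; together with [norm_sq] this compares
    it with the Euclidean length. *)
Lemma coord_norm x i : `|x 0 i| <= `|x|.
Proof.
rewrite [leRHS]/Num.Def.normr /= mx_normrE.
exact: (le_bigmax _ (fun i : 'I_1 * 'I_2 => `|x i.1 i.2|) (0, i)).
Qed.

Lemma norm_sq x : `|x| ^+ 2 <= sq x.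
Proof.
have [->|x0] := eqVneq x 0; first by rewrite normr0 expr0n /= sq0.
have := @mx_norm_neq0 R 1 2 x _.
have -> : mx_norm x = `|x| by [].
move=> /(_ _)[|[i j] ->]; first by rewrite normr_eq0.
rewrite /= real_normK ?num_real // sqE (ord1 i).
have [->|->] : j = 0 \/ j = 1.
  by case: j => [[|[|//]] hi]; [left|right]; exact: val_inj.
- by rewrite lerDl sqr_ge0.
- by rewrite lerDr sqr_ge0.
Qed.

Lemma smooth_sq w z : smooth_at (fun z => sq (z - w)) z.
Proof.
have s i : smooth_at (fun z : plane => (z - w) 0 i) z.
  under [X in smooth_at X]eq_fun do rewrite !coordE.
  by apply: smooth_atB; [exact: smooth_coord|exact: smooth_at_cst].
by apply: smooth_atD; apply: smooth_atM; exact: s.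
Qed.

Lemma continuous_sq w : continuous (fun z => sq (z - w)).
Proof. by move=> z; apply: smooth_at_continuous; exact: smooth_sq. Qed.

Lemma open_disc w r : open [set z | sq (z - w) < r].
Proof.
by apply: (@open_comp _ _ _ [set s | s < r]);
  [move=> z _; exact: continuous_sq|exact: open_lt].
Qed.

Lemma nbhs_disc w r : 0 < r -> nbhs w [set z | sq (z - w) < r].
Proof.
move=> r0; apply: open_nbhs_nbhs; split; first exact: open_disc.
by rewrite /= subrr sq0.
Qed.

Lemma disc_nbhs w (N : set plane) : nbhs w N ->
  exists2 r, 0 < r & forall z, sq (z - w) < r -> N z.
Proof.
move=> /nbhs_ballP[e /= e0 He]; exists (e ^+ 2); first by rewrite exprn_gt0.
move=> z Hz; apply: He; rewrite -ball_normE /ball_ /= distrC.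
rewrite -(@ltr_pXn2r _ 2) ?nnegrE //; last exact: ltW.
exact: le_lt_trans (norm_sq _) Hz.
Qed.

Lemma compact_disc w r : compact [set z | sq (z - w) <= r].
Proof.
apply: bounded_closed_compact.
  exists (`|w| + `|r| + 1); split; first exact: num_real.
  move=> M HM z /= Hz; rewrite -(subrK w z) addrC.
  apply: le_trans (ler_normD _ _) _; apply: le_trans (ltW HM).
  rewrite -addrA lerD2l -(@ler_pXn2r _ 2) ?nnegrE ?addr_ge0 //.
  apply: le_trans (norm_sq _) _; apply: le_trans Hz _.
  have r0 := normr_ge0 r; have := ler_norm r; nra.
apply: (@closed_comp _ _ _ [set s | s <= r]); last exact: closed_le.
by move=> z _; exact: continuous_sq.
Qed.

Lemma sqD x y : sq (x + y) = sq x + 2 * dot x y + sq y.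
Proof. by rewrite /sq /dot !coordE; ring. Qed.

Lemma sqZ a x : sq (a *: x) = a ^+ 2 * sq x.
Proof. by rewrite /sq /dot !coordE; ring. Qed.

Lemma sqN x : sq (- x) = sq x.
Proof. by rewrite /sq /dot !coordE; ring. Qed.

Lemma sq_perp x : sq (perp x) = sq x.
Proof. by rewrite /sq /dot !coordE; ring. Qed.

(** The circle of squared radius [n] about [w] is rotated by the angle whose
    half has tangent [t n]. The rational form of rotations avoids angles, and
    opposite half tangents give inverse maps. *)
Definition twist (t : R -> R) w z : plane :=
  let n := sq (z - w) in
  w + ((1 - t n ^+ 2) / (1 + t n ^+ 2)) *: (z - w)
    + (2 * t n / (1 + t n ^+ 2)) *: perp (z - w).

Lemma den_neq0 (a : R) : 1 + a ^+ 2 != 0.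
Proof. by rewrite gt_eqF // ltr_pwDl // sqr_ge0. Qed.

Lemma twist_sq t w z : sq (twist t w z - w) = sq (z - w).
Proof.
rewrite /twist; have := den_neq0 (t (sq (z - w))).
by move: (t _) => a a0; rewrite /sq /dot !coordE; field.
Qed.

Lemma twistK t w : cancel (twist t w) (twist (fun n => - t n) w).
Proof.
move=> z; rewrite {1}/twist twist_sq /=; set n := sq (z - w).
have -> : twist t w z - w = ((1 - t n ^+ 2) / (1 + t n ^+ 2)) *: (z - w)
    + (2 * t n / (1 + t n ^+ 2)) *: perp (z - w).
  by rewrite /twist -/n; apply: plane_eq; rewrite !coordE; ring.
have := den_neq0 (t n); set a := t n => a0; rewrite sqrrN.
by apply: plane_eq; rewrite !coordE; field.
Qed.

Lemma twist_fix t w z : t (sq (z - w)) = 0 -> twist t w z = z.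
Proof.
move=> t0; rewrite /twist t0; apply: plane_eq; rewrite !coordE.
  by field.
by field.
Qed.

Lemma smooth_twist t w z : (forall n, smooth_at t n) -> smooth_at (twist t w) z.
Proof.
move=> st; have FR := @framed_R R.
have sc i : smooth_at (fun z : plane => (z - w) 0 i) z.
  under [X in smooth_at X]eq_fun do rewrite !coordE.
  by apply: smooth_atB; [exact: smooth_coord|exact: smooth_at_cst].
have sn : smooth_at (fun z => t (sq (z - w))) z.
  exact: (smooth_at_compR (f := fun z => sq (z - w)) FR (smooth_sq w z) (st _)).
have sd : smooth_at (fun z => (1 + t (sq (z - w)) ^+ 2)^-1) z.
  apply: smooth_atV; first exact: den_neq0.
  by apply: smooth_atD; [exact: smooth_at_cst|exact: smooth_atM].
have sa : smooth_at (fun z => (1 - t (sq (z - w)) ^+ 2) / (1 + t (sq (z - w)) ^+ 2)) z.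
  apply: smooth_atM => //.
  by apply: smooth_atB; [exact: smooth_at_cst|exact: smooth_atM].
have sb : smooth_at (fun z => 2 * t (sq (z - w)) / (1 + t (sq (z - w)) ^+ 2)) z.
  by apply: smooth_atM => //; apply: smooth_atM => //; exact: smooth_at_cst.
pose F z := vec (w 0 0 + (1 - t (sq (z - w)) ^+ 2) / (1 + t (sq (z - w)) ^+ 2) * (z - w) 0 0
   - 2 * t (sq (z - w)) / (1 + t (sq (z - w)) ^+ 2) * (z - w) 0 1)
  (w 0 1 + (1 - t (sq (z - w)) ^+ 2) / (1 + t (sq (z - w)) ^+ 2) * (z - w) 0 1
   + 2 * t (sq (z - w)) / (1 + t (sq (z - w)) ^+ 2) * (z - w) 0 0).
have -> : twist t w = F.
  by apply/funext => u; apply: plane_eq; rewrite /twist /F !coordE ?mulrN.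
apply: smooth_at_vec.
  apply: smooth_atB; last exact: smooth_atM.
  by apply: smooth_atD; [exact: smooth_at_cst|exact: smooth_atM].
apply: smooth_atD; last exact: smooth_atM.
by apply: smooth_atD; [exact: smooth_at_cst|exact: smooth_atM].
Qed.

End Plane.

(** * Moving points by diffeomorphisms *)

(** The set where [P] holds is open and closed in [W]. *)
Lemma connected_ind (T : topologicalType) (W : set T) (P : T -> Prop) :
  connected W -> (exists2 x, W x & P x) ->
  (forall x, W x -> P x -> \forall y \near x, W y -> P y) ->
  (forall x, W x -> ~ P x -> \forall y \near x, W y -> ~ P y) ->
  forall x, W x -> P x.
Proof.
move=> cW [x0 Wx0 Px0] H1 H2.
suff E : W `&` P = W by move=> x Wx; have [] : (W `&` P) x by rewrite E.
apply: cW; first by exists x0.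
- exists ([set y | W y -> P y]^°); first exact: open_interior.
  apply/seteqP; split=> x [Wx Px]; split => //; first exact: H1.
  by move/interior_subset: Px; exact.
- exists (~` ([set y | W y -> ~ P y]^°)).
    exact/open_closedC/open_interior.
  apply/seteqP; split=> x [Wx Px]; split => //; first by move=> /interior_subset; exact.
  by apply: contrapT => nPx; apply: Px; exact: H2.
Qed.

Section Push.
Context {R : realType} {S : topologicalType}.
Local Notation plane := 'rV[R]_2.
Context (A : set (chart R S)) (hA : smooth_surface A).
Implicit Types (c d : chart R S) (p q : S).

Definition diffeo_pair (f g : S -> S) := [/\ homeomorphism_pair f g,
  forall p, smooth_pt A f p & forall p, smooth_pt A g p].

Lemma diffeo_pair_good f g : diffeo_pair f g -> good_pair A f g /\ good_pair A g f.
Proof.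
move=> [[cf cg fK gK] sf sg].
by split; split => // p; left.
Qed.

(** A quarter turn on the circle of squared radius [n0], damped by a bump
    function of the squared radius. *)
Lemma twist_diffeo c (w : plane) (n0 d s : R) : A c -> 0 < d -> s ^+ 2 = 1 ->
  (forall z, sq (z - w) <= n0 + d -> (chart_fun c @` chart_dom c) z) ->
  exists f g, [/\ diffeo_pair f g,
    forall p, (chart_dom c p -> d <= `|sq (chart_fun c p - w) - n0|) ->
      f p = p /\ g p = p &
    forall p, chart_dom c p -> sq (chart_fun c p - w) = n0 ->
      chart_dom c (f p) /\ chart_fun c (f p) = w + s *: perp (chart_fun c p - w)].
Proof.
move=> Ac d0 s1 Hd; have [B [SB B0 B1 Bd]] := smooth_bump n0 d0.
pose t n := s * B n.
have St n : smooth_at t n by apply: smooth_atM; [exact: smooth_at_cst|exact: SB].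
have StN n : smooth_at (fun n => - t n) n by exact: smooth_atN.
pose F := twist t w; pose G := twist (fun n => - t n) w.
have SF z : smooth_at F z by exact: smooth_twist.
have SG z : smooth_at G z by exact: smooth_twist.
have cF : continuous F by move=> z; exact: smooth_at_continuous.
have cG : continuous G by move=> z; exact: smooth_at_continuous.
have FK : cancel F G by exact: twistK.
have GK : cancel G F.
  have := twistK (fun n => - t n) w.
  by have -> : (fun n => - - t n) = t by apply/funext => n; rewrite opprK.
have t0 n : d <= `|n - n0| -> t n = 0 by move=> /Bd; rewrite /t => ->; rewrite mulr0.
have sFG : supported c [set z | sq (z - w) <= n0 + d] F G.
  split => //; first exact: compact_disc.
  move=> z /= /negP; rewrite -ltNge => Hz; apply: twist_fix; apply: t0.
  by rewrite ler_normr; apply/orP; left; rewrite lerBrDl ltW.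
have sGF := supported_sym cG sFG.
exists (transplant c F), (transplant c G); split.
- split; first exact: (transplant_homeo hA sFG cG).
    by move=> p; apply: (transplant_smooth hA Ac sFG).
  by move=> p; apply: (transplant_smooth hA Ac sGF).
- move=> p Hp; have [cp|ncp] := pselect (chart_dom c p); last first.
    by rewrite !transplant_notin.
  rewrite /transplant; case: asboolP => // _.
  have E : t (sq (chart_fun c p - w)) = 0 by apply: t0; exact: Hp.
  by rewrite /F /G !twist_fix ?E ?oppr0 ?chart_funK.
- move=> p cp Ep; have [h1 h2] := transplant_in sFG cp; split => //.
  rewrite h2 /F /twist Ep /t B1 mulr1 s1.
  by apply: plane_eq; rewrite !coordE; field.
Qed.

(** The centre [w] is a vertex of the square of diagonal [v], so a quarter turn
    about [w] takes one end of the diagonal to the other. *)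
Lemma push c p q (s : R) (d : R) : A c -> chart_dom c p -> chart_dom c q ->
  s ^+ 2 = 1 -> 0 < d ->
  let v := chart_fun c q - chart_fun c p in
  let w := chart_fun c p + 2^-1 *: v + (s / 2) *: perp v in
  (forall z, sq (z - w) <= sq v / 2 + d -> (chart_fun c @` chart_dom c) z) ->
  exists f g, [/\ diffeo_pair f g, f p = q &
   forall x, (chart_dom c x -> d <= `|sq (chart_fun c x - w) - sq v / 2|) ->
      f x = x /\ g x = x].
Proof.
move=> Ac cp cq s1 d0 v w Hd.
have [f [g [fg H1 H2]]] := twist_diffeo Ac d0 s1 Hd.
exists f, g; split => //; have E : sq (chart_fun c p - w) = sq v / 2.
  have -> : chart_fun c p - w = - (2^-1 *: v) - (s / 2) *: perp v.
    by apply: plane_eq; rewrite /w !coordE; ring.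
  rewrite /sq /dot !coordE.
  have -> : forall a b : R, (- (2^-1 * a) - s / 2 * - b) * (- (2^-1 * a) - s / 2 * - b)
    + (- (2^-1 * b) - s / 2 * a) * (- (2^-1 * b) - s / 2 * a) = (a * a + b * b) * (1 + s ^+ 2) / 4.
    by move=> a b; field.
  by rewrite s1; field.
have [h1 h2] := H2 p cp E.
rewrite -(chart_funK h1) -(chart_funK cq) h2; congr chart_inv.
have -> : chart_fun c p - w = - (2^-1 *: v) - (s / 2) *: perp v.
  by apply: plane_eq; rewrite /w !coordE; ring.
have s1' : s * s = 1 by rewrite -expr2.
apply: plane_eq; rewrite /w /v !coordE.
  set a := chart_fun c p 0 0; set b := chart_fun c q 0 0.
  set a' := chart_fun c p 0 1; set b' := chart_fun c q 0 1.
  transitivity (a + (b - a) * (1 + s * s) / 2); first by field.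
  by rewrite s1'; field.
set a := chart_fun c p 0 0; set b := chart_fun c q 0 0.
set a' := chart_fun c p 0 1; set b' := chart_fun c q 0 1.
transitivity (a' + (b' - a') * (1 + s * s) / 2); first by field.
by rewrite s1'; field.
Qed.

(** The disc moved by [push] shrinks to [p] as [q] tends to [p]. *)
Lemma push_small c p (N : set S) : A c -> chart_dom c p -> nbhs p N ->
  \forall q \near p, exists f g, [/\ diffeo_pair f g, f p = q &
     forall x, ~ N x -> f x = x /\ g x = x].
Proof.
move=> Ac cp Np.
have [r r0 Hr] := disc_nbhs (filterI (near_chart_inv cp Np) (chart_img_nbhs cp)).
have Nq : nbhs p [set q | sq (chart_fun c q - chart_fun c p) < r / 4].
  have r4 : 0 < r / 4 by rewrite divr_gt0.
  exact: (near_chart_fun cp (nbhs_disc _ r4)).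
apply: filterS2 (chart_dom_nbhs cp) Nq => q cq /= Hq.
have [E|npq] := eqVneq (chart_fun c q) (chart_fun c p).
  have -> : q = p by rewrite -(chart_funK cq) E chart_funK.
  exists id, id; split => //; split => //; first by split => // x; exact: cvg_id.
    by move=> x; apply: (smooth_pt_near_id hA); near=> y.
  by move=> x; apply: (smooth_pt_near_id hA); near=> y.
set v := chart_fun c q - chart_fun c p in Hq *.
have v0 : 0 < sq v by apply: sq_gt0; rewrite subr_eq0.
have Hw z : sq (z - (chart_fun c p + 2^-1 *: v + (1 / 2) *: perp v)) <= sq v ->
   sq (z - chart_fun c p) < r.
  move=> Hz; apply: (@le_lt_trans _ _ (4 * sq v)); last by lra.
  clearbody v; move: Hz; rewrite /sq /dot !coordE; set a := v 0 0; set b := v 0 1.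
  set z0 := z 0 0; set z1 := z 0 1; set p0 := chart_fun c p 0 0.
  set p1 := chart_fun c p 0 1 => Hz.
  have h1 := sqr_ge0 (z0 - p0 - 2 * (2^-1 * a - 1/2 * b)).
  have h2 := sqr_ge0 (z1 - p1 - 2 * (2^-1 * b + 1/2 * a)).
  have h3 := sqr_ge0 a; have h4 := sqr_ge0 b.
  nra.
have half : sq v / 2 + sq v / 2 = sq v by field.
have [||f [g [fg fp H]]] := @push c p q 1 (sq v / 2) Ac cp cq (expr1n _ _).
- by rewrite divr_gt0.
- by move=> z; rewrite half => /Hw /Hr [].
exists f, g; split => // x nNx; apply: H => cx.
rewrite ler_normr; apply/orP; left; rewrite -/v.
have [h|h] := lerP (sq v) (sq (chart_fun c x - (chart_fun c p + 2^-1 *: v + (1 / 2) *: perp v))).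
  by lra.
by exfalso; apply: nNx; have /Hw/Hr[] := ltW h; rewrite chart_funK.
Unshelve. all: by end_near. Qed.

(** By maximality, the atlas is stable under precomposition of its charts with
    diffeomorphisms. *)
Lemma chart_through d f g : A d -> diffeo_pair f g -> exists d', [/\ A d',
  chart_dom d' = f @^-1` chart_dom d, chart_fun d' = chart_fun d \o f &
  chart_inv d' = g \o chart_inv d].
Proof.
move=> Ad [[cf cg fK gK] sf sg].
have imgE : (chart_fun d \o f) @` (f @^-1` chart_dom d) = chart_fun d @` chart_dom d.
  apply/seteqP; split=> [_ [p dp <-]|_ [p dp <-]]; first by exists (f p).
  by exists (g p); rewrite /= gK.
have o1 : open (f @^-1` chart_dom d).
  by apply: open_comp; [move=> *; exact: cf|exact: chart_dom_open].
have o2 : open ((chart_fun d \o f) @` (f @^-1` chart_dom d)).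
  by rewrite imgE; exact: chart_cod_open.
have K p : (f @^-1` chart_dom d) p -> (g \o chart_inv d) ((chart_fun d \o f) p) = p.
  by move=> dp /=; rewrite chart_funK // fK.
have C1 p : (f @^-1` chart_dom d) p -> {for p, continuous (chart_fun d \o f)}.
  move=> dp; apply: continuous_comp; first exact: cf.
  exact: chart_fun_continuous.
have C2 x : ((chart_fun d \o f) @` (f @^-1` chart_dom d)) x ->
   {for x, continuous (g \o chart_inv d)}.
  rewrite imgE => dx; apply: continuous_comp; last exact: cg.
  exact: chart_inv_continuous.
pose d' := Chart o1 o2 K C1 C2.
exists d'; split => //; have [_ _ [_ _ Hmax]] := hA.
apply: Hmax => c Ac; split.
  apply: smooth_onP => _ [p [cp dp] <-].
  have [_ H] := sf p; exact: (H c d Ac Ad cp dp).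
apply: smooth_onP => _ [p [dp cp] <-].
have [_ H] := sg (f p).
have cgp : chart_dom c (g (f p)) by rewrite fK.
exact: (H d c Ad Ac dp cgp).
Qed.

Definition disc d (w : plane) r := [set p | chart_dom d p /\ sq (chart_fun d p - w) < r].

Lemma disc_open d w r : open (disc d w r).
Proof.
rewrite openE => p [dp Hp]; apply: filterI; first exact: chart_dom_nbhs.
apply: (near_chart_fun (N := [set z | sq (z - w) < r]) dp).
by apply: open_nbhs_nbhs; split => //; exact: open_disc.
Qed.

(** The room between the two radii is used to close up curves inside [W]. *)
Definition gathered (W F : set S) := exists d w r1 r2, [/\ A d, 0 < r1 < r2,
  forall z, sq (z - w) <= r2 -> (chart_fun d @` chart_dom d) z,
  forall p, chart_dom d p -> sq (chart_fun d p - w) <= r2 -> W p &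
  F `<=` disc d w r1].

Lemma gathered_through (W F : set S) f g : diffeo_pair f g ->
  (forall x, ~ W x -> f x = x) -> gathered W F -> gathered W (f @^-1` F).
Proof.
move=> fg fW [d [w [r1 [r2 [Ad r12 Hi HW HF]]]]].
have [d' [Ad' E1 E2 E3]] := chart_through Ad fg.
have [[cf cg fK gK] _ _] := fg.
exists d', w, r1, r2; split => //.
- move=> z /Hi [p dp <-]; exists (g p); first by rewrite E1 /= gK.
  by rewrite E2 /= gK.
- move=> p; rewrite E1 E2 /= => dfp Hp; apply: contrapT => nWp.
  by apply: (nWp); rewrite -(fW p nWp); exact: HW.
- by move=> p /HF [h1 h2]; split; rewrite ?E1 ?E2.
Qed.

(** By induction on [s]. A small move of the additional point inside [W] is
    realised by a diffeomorphism fixing the other points, so being gathered is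
    an open and closed condition on this point ([push_small],
    [gathered_through]); it holds near the centre of the disc given by
    induction. *)
Lemma gather (W : set S) (s : seq S) : open W -> connected W -> W !=set0 ->
  (forall x, x \in s -> W x) -> gathered W [set` s].
Proof.
move=> oW cW [x0 Wx0]; elim: s => [_|a s IH Hs].
  have [c Ac cx0] := chart_at hA x0.
  have Nx0 : nbhs x0 W by exact: open_nbhs_nbhs.
  have [r r0 Hr] := disc_nbhs (filterI (near_chart_inv cx0 Nx0) (chart_img_nbhs cx0)).
  have hr z : sq (z - chart_fun c x0) <= r / 2 -> sq (z - chart_fun c x0) < r.
    by move=> h; apply: le_lt_trans h _; lra.
  exists c, (chart_fun c x0), (r / 4), (r / 2); split => //.
  - by apply/andP; split; lra.
  - by move=> z /hr/Hr[].
  - by move=> p cp /hr/Hr[+ _]; rewrite chart_funK.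
have {}IH : gathered W [set` s].
  by apply: IH => x xs; apply: Hs; rewrite inE xs orbT.
suff : forall x, W x -> gathered W (x |` [set` s]).
  move=> /(_ a (Hs a (mem_head _ _))) [d [w [r1 [r2 [h1 h2 h3 h4 h5]]]]].
  exists d, w, r1, r2; split => // x /=; rewrite inE => /orP[/eqP ->|xs].
    by apply: h5; left.
  by apply: h5; right.
apply: (@connected_ind _ W) => //.
- have [d [w [r1 [r2 [Ad /andP[r10 r12] h3 h4 h5]]]]] := IH.
  have iw : (chart_fun d @` chart_dom d) w.
    by apply: h3; rewrite subrr sq0; exact/ltW/(lt_trans r10).
  have [e1 e2] := chart_imgP iw.
  exists (chart_inv d w).
    by apply: h4 => //; rewrite e1 subrr sq0; exact/ltW/(lt_trans r10).
  exists d, w, r1, r2; split => //; first by rewrite r10.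
  by move=> x [->|/h5//]; split => //; rewrite e1 subrr sq0.
- move=> x Wx [d [w [r1 [r2 [h1 h2 h3 h4 h5]]]]].
  have dx : disc d w r1 x by apply: h5; left.
  apply: filterS (open_nbhs_nbhs (conj (disc_open _ _ _) dx)) => y dy Wy.
  exists d, w, r1, r2; split => // z [->//|zs]; apply: h5; right.
  exact: zs.
- move=> x Wx nG.
  have xs : x \notin s.
    apply/negP => xs; apply: nG; have [d [w [r1 [r2 [h1 h2 h3 h4 h5]]]]] := IH.
    by exists d, w, r1, r2; split => // z [->|]; apply: h5.
  have Ns : nbhs x (~` [set` s]).
    apply: open_nbhs_nbhs; split; last by move=> /= h; move/negP: xs.
    apply: closed_openC; apply: compact_closed; first by case: hA.
    exact/finite_compact/finite_seq.
  have NW : nbhs x W by exact: open_nbhs_nbhs.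
  have [c Ac cx] := chart_at hA x.
  apply: filterS (push_small Ac cx (filterI NW Ns)) => y [f [g [fg fx Hf]]] Wy Gy.
  apply: nG; have fW z : ~ W z -> f z = z by move=> nW; have [] := Hf z; [case|].
  have [d [w [r1 [r2 [h1 h2 h3 h4 h5]]]]] := gathered_through fg fW Gy.
  exists d, w, r1, r2; split => // z [->|zs]; apply: h5 => /=.
    by left.
  right; have [-> _] : f z = z /\ g z = z by apply: Hf; case=> _; apply.
  exact: zs.
Qed.

End Push.

(** * The two sides of a smooth curve *)

Section Line.
Context {R : realType}.
Local Notation plane := 'rV[R]_2.

Lemma nbhs_line (t : R) (N : set R) : nbhs t N ->
  exists2 e, 0 < e & forall s, `|s - t| < e -> N s.
Proof.
move=> /nbhs_ballP[e /= e0 He]; exists e => // s Hs; apply: He.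
by rewrite /ball /= distrC.
Qed.

Lemma line_nbhs (t e : R) : 0 < e -> nbhs t [set s | `|s - t| < e].
Proof. by move=> e0; apply/nbhs_ballP; exists e => // y; rewrite /ball /= distrC. Qed.

Lemma increasing_near (f : R -> R) (t : R) : smooth_at f t -> 0 < derive1 f t ->
  exists2 e, 0 < e & (forall s, `|s - t| < e -> {for s, continuous f}) /\
   forall s1 s2, `|s1 - t| < e -> `|s2 - t| < e -> s1 < s2 -> f s1 < f s2.
Proof.
move=> sf f0; have cd := smooth_at_continuous (smooth_at_derive1 sf).
have [e e0 He] := nbhs_line (filterI (smooth_at_near sf) (cvgr_gt _ cd _ f0)).
exists e => //; split=> [s /He[+ _]|s1 s2 h1 h2 s12]; first exact: smooth_at_continuous.
have itv s : s \in `]t - e, t + e[ -> `|s - t| < e.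
  by rewrite in_itv /= ltr_distl.
apply: (@gtr0_derive1_lt_oo _ f (t - e) (t + e)).
- move=> x /itv/He[sx _]; apply/derivable1_diffP; exact: smooth_at_differentiable.
- by move=> x /itv/He[].
- by move=> x; rewrite inE /= => /itv/He[+ _]; exact: smooth_at_continuous.
- by rewrite in_itv /= -ltr_distl.
- by rewrite in_itv /= -ltr_distl.
- exact: s12.
Qed.

Lemma dot_linear (w : plane) : {l : {linear plane -> R} | l = dot w :> (plane -> R)}.
Proof.
have lin : linear (dot w).
  by move=> a u v; rewrite /dot !coordE /GRing.scale /=; ring.
pose lM := GRing.isLinear.Build _ _ _ _ _ lin.
by exists (HB.pack (dot w) lM : {linear _ -> _}).
Qed.

Lemma smooth_dot (w x : plane) : smooth_at (dot w) x.
Proof.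
by apply: smooth_atD; apply: smooth_atM; [exact: smooth_at_cst|exact: smooth_coord|
  exact: smooth_at_cst|exact: smooth_coord].
Qed.

Lemma smooth_dot_curve (w : plane) (k : R -> plane) t : smooth_at k t ->
  smooth_at (fun s => dot w (k s)) t /\
  derive1 (fun s => dot w (k s)) t = dot w (derive1 k t).
Proof.
move=> sk; split.
  apply: (smooth_at_compR (f := k) (g := dot w) (@framed_rV R 1) sk); exact: smooth_dot.
have [l El] := dot_linear w.
have cl : continuous l by rewrite El => x; apply: smooth_at_continuous; exact: smooth_dot.
have := derive1_chain (smooth_at_differentiable sk) (linear_differentiable (k t) cl).
by rewrite diff_lin // El.
Qed.

Lemma dotxx (x : plane) : dot x x = sq x. Proof. by []. Qed.

Lemma dotDr (w x y : plane) : dot w (x + y) = dot w x + dot w y.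
Proof. by rewrite /dot !coordE; ring. Qed.
Lemma dotNr (w x : plane) : dot w (- x) = - dot w x.
Proof. by rewrite /dot !coordE; ring. Qed.
Lemma dotZr (w x : plane) a : dot w (a *: x) = a * dot w x.
Proof. by rewrite /dot !coordE; ring. Qed.
Lemma dotDl (w x y : plane) : dot (x + y) w = dot x w + dot y w.
Proof. by rewrite /dot !coordE; ring. Qed.
Lemma dotZl (w x : plane) a : dot (a *: x) w = a * dot x w.
Proof. by rewrite /dot !coordE; ring. Qed.
Lemma dot_perp (x : plane) : dot x (perp x) = 0.
Proof. by rewrite /dot !coordE; ring. Qed.

Lemma perp_line (v x : plane) : v != 0 -> dot v x = 0 ->
  x = (dot (perp v) x / sq v) *: perp v.
Proof.
move=> v0; have := sq_gt0 v0; rewrite /sq /dot => vpos h.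
apply: plane_eq; rewrite !coordE; move: vpos h.
  set a := v 0 0; set b := v 0 1; set p := x 0 0; set q := x 0 1 => vpos h.
  have n0 : a * a + b * b != 0 by rewrite gt_eqF.
  have e : a * (a * p + b * q) = 0 by rewrite h mulr0.
  apply: (mulfI n0).
  transitivity (a * (a * p + b * q) + b * b * p - a * b * q); first by ring.
  by rewrite e; field.
set a := v 0 0; set b := v 0 1; set p := x 0 0; set q := x 0 1 => vpos h.
have n0 : a * a + b * b != 0 by rewrite gt_eqF.
have e : b * (a * p + b * q) = 0 by rewrite h mulr0.
apply: (mulfI n0).
transitivity (b * (a * p + b * q) + a * a * q - a * b * p); first by ring.
by rewrite e; field.
Qed.

Lemma sqD_le (x y : plane) : sq (x + y) <= 2 * sq x + 2 * sq y.
Proof.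
have h0 := sqr_ge0 (x 0 0 - y 0 0); have h1 := sqr_ge0 (x 0 1 - y 0 1).
rewrite /sq /dot !coordE; nra.
Qed.

Lemma connected_oo (a b : R) : connected [set s | a < s < b].
Proof.
apply/connected_intervalP => x y /= /andP[ax xb] /andP[ay yb] z /andP[xz zy].
by rewrite (lt_le_trans ax xz) (le_lt_trans zy yb).
Qed.

Lemma connected_cc (a b : R) : connected [set s | a <= s <= b].
Proof.
apply/connected_intervalP => x y /= /andP[ax xb] /andP[ay yb] z /andP[xz zy].
by rewrite (le_trans ax xz) (le_trans zy yb).
Qed.

Lemma connected_image (T : topologicalType) (D : set R) (f : R -> T) : connected D ->
  (forall x, D x -> {for x, continuous f}) -> connected (f @` D).
Proof.
move=> cD cf; apply: connected_continuous_connected => //.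
by apply: continuous_in_subspaceT => x; rewrite inE => /cf.
Qed.

(** The image is a comb: arcs in the second variable, all attached to one arc in
    the first. *)
Lemma connected_grid (T : topologicalType) (a b c d : R) (f : R -> R -> T) :
  a < b -> c < d -> (forall s w, a < s < b -> c < w < d ->
    {for s, continuous (fun s => f s w)} /\ {for w, continuous (f s)}) ->
  connected [set p | exists s w, [/\ a < s < b, c < w < d & p = f s w]].
Proof.
move=> ab cd H; pose w0 := (c + d) / 2; pose s0 := (a + b) / 2.
have hw0 : c < w0 < d by rewrite /w0; apply/andP; split; lra.
have hs0 : a < s0 < b by rewrite /s0; apply/andP; split; lra.
pose hor := (fun s => f s w0) @` [set s | a < s < b].
pose B i := hor `|` (f i @` [set w | c < w < d]).
have -> : [set p | exists s w, [/\ a < s < b, c < w < d & p = f s w]] =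
  \bigcup_(i in [set s | a < s < b]) B i.
  apply/seteqP; split=> [p [s [w [hs hw ->]]]|p [s hs [[s' hs' <-]|[w hw <-]]]].
  - by exists s => //; right; exists w.
  - by exists s', w0.
  - by exists s, w.
apply: bigcup_connected.
  by exists (f s0 w0) => s hs; left; exists s0.
move=> i hi; apply: connectedU.
- by exists (f i w0); split; [exists i|exists w0].
- by apply: connected_image; [exact: connected_oo|move=> s hs; have [] := H s w0 hs hw0].
- by apply: connected_image; [exact: connected_oo|move=> w hw; have [] := H i w hi hw].
Qed.

Lemma small_pos (a b : R) : 0 < a -> 0 < b -> exists w, [/\ 0 < w, w < a & w < b].
Proof.
move=> a0 b0; exists (Num.min a b / 2).
have h : 0 < Num.min a b by rewrite lt_min a0.
have ha : Num.min a b <= a by rewrite ge_min lexx.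
have hb : Num.min a b <= b by rewrite ge_min lexx orbT.
by split; lra.
Qed.

End Line.

Section Sides.
Context {R : realType} {S : topologicalType}.
Local Notation plane := 'rV[R]_2.
Context (A : set (chart R S)) (hA : smooth_surface A).
Implicit Types (c d : chart R S) (p q : S).

Lemma closed_curve_arc (b : R -> S) (x y : R) : continuous b ->
  closed (b @` [set s | x <= s <= y]).
Proof.
move=> cb; apply: compact_closed; first by case: hA.
apply: continuous_compact; first exact: continuous_subspaceT.
by rewrite (_ : [set s | _] = `[x, y]%classic) ?set_itvcc //; exact: segment_compact.
Qed.

Lemma param_shift (b : R -> S) (a s : R) : simple_closed_param b ->
  exists s', [/\ a <= s' < a + 1 & b s' = b s].
Proof.
move=> [cb ib]; pose n := Num.floor (s - a); exists (s - n%:~R).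
have /andP[h1 h2] := floor_itv (s - a).
split; first by rewrite -/n in h1 h2; rewrite rmorphD /= in h2; apply/andP; split; lra.
by apply/ib; exists (- n); rewrite rmorphN.
Qed.

Lemma curve_inj (b : R -> S) (s s' : R) : simple_closed_param b ->
  b s = b s' -> `|s - s'| < 1 -> s = s'.
Proof.
move=> [cb ib] /ib[n ->]; rewrite addrAC subrr add0r => h.
move: h; rewrite ltr_norml => /andP[h1 h2].
have n1 : (n < 1)%R by rewrite -(ltr_int R).
have n2 : (-1 < n)%R by rewrite -(ltr_int R) rmorphN.
have -> : n = 0 by clear -n1 n2; lia.
by rewrite addr0.
Qed.

(** A smooth curve is locally two-sided. In a chart, let [T] be the velocity at
    time [t]. The points [k s + w *: perp T] fill a neighbourhood of [k t],
    because [dot T (k s)] increases with [s]: the value of [dot T] at a point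
    determines [s], and then [w] is the offset. The rest of the curve stays away
    by compactness, so the connected sets [w > 0] and [w < 0] avoid the curve. *)
Lemma sides (b : R -> S) (t : R) (N0 : set S) : smooth_param A b -> nbhs (b t) N0 ->
  exists N P Q, [/\ nbhs (b t) N,
    connected P /\ connected Q,
    P `<=` N0 `\` range b /\ Q `<=` N0 `\` range b,
    N `\` range b `<=` P `|` Q &
    forall z, N z -> range b z -> closure P z /\ closure Q z].
Proof.
move=> /smooth_paramP => /(_ hA)[scb rb] N0t; have [cb ib] := scb.
have [_ [d [Ad dt sk dk]]] := rb t.
set k := chart_fun d \o b in sk dk.
set T := derive1 k t in dk.
have [sl dl] := smooth_dot_curve T sk.
have lpos : 0 < derive1 (fun s => dot T (k s)) t.
  by rewrite dl -/T dotxx; exact: sq_gt0.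
have [e1 e10 [cl incl]] := increasing_near sl lpos.
have [e2 e20 He2] := nbhs_line (filterI (smooth_at_near sk) (cb t _ (chart_dom_nbhs dt))).
pose e := Num.min (Num.min e1 e2) (1 / 2).
have e0 : 0 < e by rewrite /e !lt_min e10 e20 /=; lra.
have ee1 : e <= e1 by rewrite /e !ge_min lexx.
have ee2 : e <= e2 by rewrite /e !ge_min lexx orbT.
have eh : e <= 1 / 2 by rewrite /e ge_min lexx orbT.
(* A compact arc: all times except those close to [t] modulo 1. *)
pose far := b @` [set s | t + e <= s <= t + 1 - e].
have ofar : open (~` far) by exact/closed_openC/closed_curve_arc.
have ntf : (~` far) (b t).
  move=> [s /andP[h1 h2] /ib[n En]].
  have hn : s - t = n%:~R by rewrite En; ring.
  have n1 : (0 < n)%R by rewrite -(ltr_int R) -hn; clear -h1 h2 e0; lra.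
  have n2 : (n < 1)%R by rewrite -(ltr_int R) -hn; clear -h1 h2 e0; lra.
  by clear -n1 n2; lia.
have Nfar := open_nbhs_nbhs (conj ofar ntf).
have [r r0 Hr] := disc_nbhs (filterI (chart_img_nbhs dt) (near_chart_inv dt (filterI N0t Nfar))).
have v0 : 0 < sq T by exact: sq_gt0.
(* By [sqD_le], moving by at most [r / 32] along the curve and by [r / 8] across
   it (in squared length) stays within [r]. *)
pose h := Num.sqrt (r / 8 / sq T).
have h0 : 0 < h by rewrite sqrtr_gt0 !divr_gt0.
have hh : h ^+ 2 * sq T = r / 8.
  by rewrite sqr_sqrtr ?divfK ?gt_eqF // !divr_ge0 // ltW.
have r32 : 0 < r / 32 by rewrite divr_gt0.
have [e3 e30 He3] := nbhs_line (smooth_at_continuous sk (nbhs_disc (k t) r32)).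
pose e' := Num.min e e3.
have e'0 : 0 < e' by rewrite lt_min e0.
have e'e : e' <= e by rewrite ge_min lexx.
have e'3 : e' <= e3 by rewrite ge_min lexx orbT.
pose pt s w := k s + w *: perp T.
have ptB s w : `|s - t| < e' -> `|w| <= h -> sq (pt s w - k t) < r.
  move=> hs hw; have hk := He3 s (lt_le_trans hs e'3); rewrite /= in hk.
  have -> : pt s w - k t = (k s - k t) + w *: perp T by rewrite /pt addrAC.
  apply: le_lt_trans (sqD_le _ _) _; rewrite sqZ sq_perp.
  have hw2 : w ^+ 2 <= h ^+ 2 by rewrite -real_normK ?num_real // lerXn2r ?nnegrE // ltW.
  have : w ^+ 2 * sq T <= r / 8 by rewrite -hh ler_wpM2r // ltW.
  by clear -hk r0; lra.
have itv s : t - e' < s < t + e' = (`|s - t| < e') by rewrite ltr_distl.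
have ptoff s w : `|s - t| < e' -> `|w| <= h -> w != 0 ->
   (N0 `\` range b) (chart_inv d (pt s w)).
  move=> hs hw w0; have [hi [hN hf]] := Hr _ (ptB s w hs hw); split => //.
  move=> [s1 _ E1]; have [s2 [/andP[h1 h2] E2]] := param_shift (t - e) s1 scb.
  have [s2b|s2b] := ltrP s2 (t + e); last first.
    apply: hf; exists s2; last by rewrite E2.
    by apply/andP; clear -h1 h2 s2b; split; lra.
  have hs2e : s2 = t - e \/ `|s2 - t| < e.
    by rewrite ltr_distl; have [->|ne] := eqVneq s2 (t - e); [left|right];
       rewrite // s2b andbT lt_neqAle eq_sym ne.
  case: hs2e => [E3|hs2e].
    apply: hf; exists (t + 1 - e); first by apply/andP; clear -eh; split; lra.
    by rewrite -E1 -E2 E3; apply/ib; exists 1; clear; ring.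
  have Ek : k s2 = pt s w.
    by rewrite /k /= E2 E1; have [] := chart_imgP hi.
  have El : dot T (k s2) = dot T (k s).
    by rewrite Ek /pt dotDr dotZr dot_perp mulr0 addr0.
  have s12 : s2 = s.
    have a1 : `|s2 - t| < e1 by exact: lt_le_trans ee1.
    have a2 : `|s - t| < e1 by apply: lt_le_trans hs _; exact: le_trans ee1.
    have [lt1|lt1|//] := ltgtP s2 s.
      by have := incl _ _ a1 a2 lt1; rewrite El ltxx.
    by have := incl _ _ a2 a1 lt1; rewrite El ltxx.
  move: Ek; rewrite s12 /pt => /eqP; rewrite eq_sym -subr_eq0 addrAC subrr add0r.
  rewrite scaler_eq0 (negbTE w0) /= -sq_eq0 sq_perp sq_eq0.
  by move/negbTE: dk => ->.
pose f s w := chart_inv d (pt s w).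
have cf s w : `|s - t| < e' -> `|w| <= h ->
   {for s, continuous (fun s => f s w)} /\ {for w, continuous (f s)}.
  move=> hs hw; have [hi _] := Hr _ (ptB s w hs hw).
  have ci := @chart_inv_continuous _ _ d _ hi.
  have ck : {for s, continuous k}.
    have [sks _] := He2 s (lt_le_trans hs (le_trans e'e ee2)).
    exact: smooth_at_continuous sks.
  split.
    apply: (@continuous_comp _ _ _ (fun s => pt s w) (chart_inv d)); last exact: ci.
    by apply: continuousD; [exact: ck|exact: cst_continuous].
  apply: (@continuous_comp _ _ _ (pt s) (chart_inv d)); last exact: ci.
  apply: continuousD; first exact: cst_continuous.
  exact: scalel_continuous.
have hE0 (w : R) : 0 < w < h -> `|w| <= h /\ w != 0.
  by move=> /andP[w0 wh]; rewrite gtr0_norm // (ltW wh) gt_eqF.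
have hE1 (w : R) : - h < w < 0 -> `|w| <= h /\ w != 0.
  by move=> /andP[w0 wh]; rewrite ltr0_norm // lt_eqF //; split => //; rewrite lerNl ltW.
pose P := [set p | exists s w, [/\ t - e' < s < t + e', 0 < w < h & p = f s w]].
pose Q := [set p | exists s w, [/\ t - e' < s < t + e', - h < w < 0 & p = f s w]].
pose m := e' / 2.
have m0 : 0 < m by rewrite divr_gt0.
have mt s : t - m <= s <= t + m -> `|s - t| < e'.
  by rewrite ltr_distl /m => hs; clear -hs e'0; apply/andP; split; lra.
have tm1 : t - m < t by rewrite gtrBl.
have tm2 : t < t + m by rewrite ltrDl.
have e'1 : e' <= e1 by exact: le_trans ee1.
have l1 : dot T (k (t - m)) < dot T (k t).
  apply: incl => //; last by rewrite subrr normr0.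
  by apply: lt_le_trans e'1; apply: mt; rewrite lexx ltW // (lt_trans tm1).
have l2 : dot T (k t) < dot T (k (t + m)).
  apply: incl => //; first by rewrite subrr normr0.
  by apply: lt_le_trans e'1; apply: mt; rewrite lexx andbT ltW // (lt_trans tm1).
have cdot := smooth_at_continuous (smooth_dot T (k t)).
have ND : \forall y \near k t, [/\ sq (y - k t) < r / 32,
   dot T (k (t - m)) < dot T y & dot T y < dot T (k (t + m))].
  near=> y; split.
  - by near: y; exact: nbhs_disc.
  - by near: y; exact: cvgr_gt cdot _ l1.
  - by near: y; exact: cvgr_lt cdot _ l2.
pose N := [set p | chart_dom d p /\ [/\ sq (chart_fun d p - k t) < r / 32,
   dot T (k (t - m)) < dot T (chart_fun d p) & dot T (chart_fun d p) < dot T (k (t + m))]].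
have NN : nbhs (b t) N.
  by apply: filterI; [exact: chart_dom_nbhs|exact: (near_chart_fun dt ND)].
have NPt p : N p -> exists s w, [/\ `|s - t| < e', `|w| < h & p = f s w].
  move=> [dp [p1 p2 p3]].
  have [s] : exists2 s, s \in `[t - m, t + m] & dot T (k s) = dot T (chart_fun d p).
    apply: (@IVT _ (fun s => dot T (k s))); first by rewrite ltW // (lt_trans tm1).
      apply: continuous_in_subspaceT => s; rewrite inE /= in_itv /= => /mt hs.
      by apply: cl; exact: lt_le_trans hs e'1.
    by rewrite ge_min le_max (ltW p2) (ltW p3) orbT.
  rewrite in_itv /= => /mt hs El.
  have hd : dot T (chart_fun d p - k s) = 0 by rewrite dotDr dotNr El subrr.
  have := perp_line dk hd; set w := _ / _ => Ew.
  exists s, w; split => //; last first.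
    by rewrite /f /pt -Ew addrC subrK chart_funK.
  have hk := He3 s (lt_le_trans hs e'3); rewrite /= in hk.
  have : w ^+ 2 * sq T < h ^+ 2 * sq T.
    rewrite hh -(sq_perp T) -sqZ -Ew.
    have -> : chart_fun d p - k s = (chart_fun d p - k t) + - (k s - k t).
      by rewrite opprB addrA subrK.
    apply: le_lt_trans (sqD_le _ _) _; rewrite sqN; clear -p1 hk r0; lra.
  rewrite ltr_pM2r // -(real_normK (num_real w)) ltr_pXn2r // nnegrE //; exact: ltW.
exists N, P, Q; split => //.
- have tt : t - e' < t + e' by clear -e'0; lra.
  split; apply: connected_grid => //; rewrite ?oppr_lt0 //.
    by move=> s w hs /hE0[hw _]; apply: cf => //; rewrite -itv.
  by move=> s w hs /hE1[hw _]; apply: cf => //; rewrite -itv.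
- split=> p [s [w [hs hw ->]]].
    by have [h1 h2] := hE0 w hw; apply: ptoff => //; rewrite -itv.
  by have [h1 h2] := hE1 w hw; apply: ptoff => //; rewrite -itv.
- move=> p [/NPt[s [w [hs hw Ep]]] nb].
  have hdom : chart_dom d (b s).
    have [] := He2 s; last by [].
    by apply: lt_le_trans hs _; exact: le_trans ee2.
  have [w0|w0|w0] := ltgtP w 0.
  + right; exists s, w; split => //; first by rewrite itv.
    by rewrite w0 andbT; move: hw; rewrite ltr_norml => /andP[].
  + left; exists s, w; split => //; first by rewrite itv.
    by rewrite w0 /=; move: hw; rewrite ltr_norml => /andP[].
  + exfalso; apply: nb; exists s => //.
    by rewrite Ep /f /pt w0 scale0r addr0 /k /= chart_funK.
- move=> z Nz bz; have [s [w [hs hw Ez]]] := NPt z Nz.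
  have w0 : w = 0.
    apply: contrapT => /eqP w0; have [_] := ptoff s w hs (ltW hw) w0.
    by rewrite -/(f s w) -Ez.
  have [_ cfs] := cf s 0 hs ltac:(by rewrite normr0 ltW).
  rewrite w0 in Ez; split=> V; rewrite Ez => /cfs HV.
    have [a a0 Ha] := nbhs_line HV; have [w1 [w10 w1a w1h]] := small_pos a0 h0.
    exists (f s w1); split; first by exists s, w1; rewrite itv w10.
    by apply: Ha; rewrite subr0 gtr0_norm.
  have [a a0 Ha] := nbhs_line HV; have [w1 [w10 w1a w1h]] := small_pos a0 h0.
  exists (f s (- w1)); split.
    by exists s, (- w1); rewrite itv ltrN2 w1h oppr_lt0.
  by apply: Ha; rewrite subr0 normrN gtr0_norm.
Unshelve. all: by end_near. Qed.

End Sides.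

(** * Separating smooth curves *)

Lemma connected_split (T : topologicalType) (P U V : set T) : connected P ->
  P `<=` U `|` V -> open U -> open V -> U `&` V = set0 -> P `<=` U \/ P `<=` V.
Proof.
move=> cP PUV oU oV UV.
have [[x Px Ux]|nU] := pselect (exists2 x, P x & U x); last first.
  by right => x Px; have [Ux|//] := PUV x Px; exfalso; apply: nU; exists x.
left; apply: (connected_ind cP); first by exists x.
- move=> y _ Uy; apply: filterS (open_nbhs_nbhs (conj oU Uy)) => z //.
- move=> y Py nUy; have [//|Vy] := PUV y Py.
  apply: filterS (open_nbhs_nbhs (conj oV Vy)) => z Vz _ Uz.
  by have : (U `&` V) z by []; rewrite UV.
Qed.

Lemma not_connected (T : topologicalType) (W : set T) : open W -> ~ connected W ->
  exists U V, [/\ open U, open V, U `&` V = set0, U `|` V = W & U !=set0 /\ V !=set0].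
Proof.
move=> oW; rewrite /connected => /existsNP[B].
move=> /not_implyP[B0 /not_implyP[[C oC EC] /not_implyP[[D cD ED] BW]]].
exists B, (W `&` ~` D); split.
- by rewrite EC; exact: openI.
- by apply: openI => //; exact: closed_openC.
- by rewrite ED; apply/seteqP; split=> // x [[_ Dx] [_ nDx]].
- by rewrite ED -setIUr setUv setIT.
split => //; apply: contrapT => /nonemptyPn E0; apply: BW.
rewrite ED; apply/seteqP; split=> [x []//|x Wx]; split => //.
by apply: contrapT => nDx; have : (W `&` ~` D) x by []; rewrite E0.
Qed.

Section Separation.
Context {R : realType} {S : topologicalType}.
Local Notation plane := 'rV[R]_2.
Context (A : set (chart R S)) (hA : smooth_surface A) (hconn : connected [set: S]).

Lemma closed_curve (b : R -> S) : simple_closed_param b -> closed (range b).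
Proof.
move=> sb; have [cb _] := sb.
have -> : range b = b @` [set s | 0 <= s <= 1].
  apply/seteqP; split=> [_ [s _ <-]|_ [s _ <-]]; last by exists s.
  have [s' [/andP[h1 h2] E]] := param_shift 0 s sb.
  by exists s' => //=; rewrite h1 /= ltW //; rewrite add0r in h2.
exact: (closed_curve_arc hA).
Qed.

Lemma connected_curve (b : R -> S) : continuous b -> connected (range b).
Proof.
move=> cb; apply: connected_continuous_connected; last exact: continuous_subspaceT.
by apply/connected_intervalP => x y _ _ z _.
Qed.

(** Every point of the curve is a limit of points of the complement. *)
Lemma closure_split (b : R -> S) (U V : set S) : smooth_param A b ->
  U `|` V = ~` range b -> forall z, range b z -> closure U z \/ closure V z.
Proof.
move=> sb UV _ [t _ <-].
have [N [P [Q [Nt [cP _] [PN _] _ cl]]]] := sides hA sb (filterT : nbhs (b t) setT).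
have [clP _] := cl (b t) (nbhs_singleton Nt) (ex_intro2 _ _ t I erefl).
rewrite -[_ \/ _]/((closure U `|` closure V) (b t)) -closureU UV.
by apply: closureS clP => x /PN[].
Qed.

(** Both parts of the complement are adjacent to the whole curve. The set of
    points of the curve adjacent to both is closed, and it is open because each
    local side, being connected, lies in one part. If it were empty, [U]
    together with the points of the curve not adjacent to [V] would be open and
    closed in the surface. *)
Lemma separating_sides (b : R -> S) : smooth_param A b -> ~ nonseparating (range b) ->
  exists U V, [/\ open U, open V, U `&` V = set0, U `|` V = ~` range b &
    forall z, range b z -> closure U z /\ closure V z].
Proof.
move=> sb nb; have [scb _] := sb.
have oW : open (~` range b) by exact/closed_openC/closed_curve.
have [U [V [oU oV UV UVE [U0 V0]]]] := not_connected oW nb.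
exists U, V; split => //.
have dUV x : U x -> ~ V x by move=> Ux Vx; have : (U `&` V) x by []; rewrite UV.
have dU x : U x -> ~ range b x.
  by move=> Ux; rewrite -[~ _]/((~` range b) x) -UVE; left.
have dV x : V x -> ~ range b x.
  by move=> Vx; rewrite -[~ _]/((~` range b) x) -UVE; right.
have cov x : [\/ U x, V x | range b x].
  have [bx|nbx] := pselect (range b x); first by constructor 3.
  have : (U `|` V) x by rewrite UVE.
  by case; [constructor 1|constructor 2].
have clb := closure_split sb UVE.
apply: (connected_ind (P := fun z => closure U z /\ closure V z)).
- by apply: connected_curve; have [] := scb.
- apply: contrapT => none.
  have none' z : range b z -> closure U z -> ~ closure V z.
    by move=> bz cU cV; apply: none; exists z.
  have [v Vv] := V0; have [u Uu] := U0.
  have : U v \/ (range b v /\ ~ closure V v).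
    apply: (connected_ind (P := fun x => U x \/ (range b x /\ ~ closure V x)) hconn) => //.
    + by exists u => //; left.
    + move=> x _ [Ux|[bx ncV]].
        by apply: filterS (open_nbhs_nbhs (conj oU Ux)) => y Uy _; left.
      have oC : open (~` closure V) by exact/closed_openC/closed_closure.
      apply: filterS (open_nbhs_nbhs (conj oC ncV)) => y ny _.
      have [Uy|Vy|Ry] := cov y; [by left| |by right].
      by exfalso; apply: ny; exact: subset_closure.
    + move=> x _ /not_orP[nU /not_andP nR].
      have [//|Vx|bx] := cov x.
        apply: filterS (open_nbhs_nbhs (conj oV Vx)) => y Vy _ [Uy|[Ry _]].
          exact: (dUV y).
        exact: (dV y).
      have cVx : closure V x by case: nR => [//|/contrapT].
      have ncU : (~` closure U) x by move=> cU; exact: (none' x).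
      have oC : open (~` closure U) by exact/closed_openC/closed_closure.
      apply: filterS (open_nbhs_nbhs (conj oC ncU)) => y ny _ [Uy|[Ry ncVy]].
        by apply: ny; exact: subset_closure.
      by have [|] := clb y Ry.
  by case=> [/dUV|[/(dV v)]].
- move=> _ [t _ <-] [cU cV].
  have [N [P [Q [Nt [cP cQ] [PN QN] NPQ cl]]]] := sides hA sb (filterT : nbhs (b t) setT).
  have sP : P `<=` U `|` V by rewrite UVE => x /PN[].
  have sQ : Q `<=` U `|` V by rewrite UVE => x /QN[].
  have [u [Uu Nu]] := cU N Nt; have [v [Vv Nv]] := cV N Nt.
  have PQu : (P `|` Q) u by apply: NPQ; split => //; exact: dU.
  have PQv : (P `|` Q) v by apply: NPQ; split => //; exact: dV.
  have Nint := nbhs_interior Nt.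
  have H : (P `<=` U /\ Q `<=` V) \/ (P `<=` V /\ Q `<=` U).
    have [PU|PV] := connected_split cP sP oU oV UV.
      left; split => //; case: PQv => [/PU Uv|Qv]; first by case: (dUV v).
      have [QU|//] := connected_split cQ sQ oU oV UV.
      by have /dUV := QU v Qv.
    right; split => //; case: PQu => [/PV Vu|Qu]; first by case: (dUV u).
    have [//|QV] := connected_split cQ sQ oU oV UV.
    by case: (dUV u) => //; exact: QV.
  apply: filterS Nt => y Ny Ry; have [clP clQ] := cl y Ny Ry.
  by case: H => -[h1 h2]; split; [exact: closureS clP|exact: closureS clQ
     |exact: closureS clQ|exact: closureS clP].
- move=> x bx nP; have : ~ closure U x \/ ~ closure V x by apply/not_andP.
  have oC (Z : set S) : open (~` closure Z) by exact/closed_openC/closed_closure.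
  by case=> nx; apply: filterS (open_nbhs_nbhs (conj (oC _) nx)) => y ny _ [].
Qed.

End Separation.

(** * Rounding a corner *)

Section Rounding.
Context {R : realType} {S : topologicalType}.
Local Notation plane := 'rV[R]_2.
Context (A : set (chart R S)) (hA : smooth_surface A).
Implicit Types (c d : chart R S) (p q : S).

(** The representative of [t - t0] modulo 1 of least absolute value: a local
    coordinate on the circle of parameters around [t0]. *)
Definition red (t0 t : R) : R := t - t0 - (Num.floor (t - t0 + 1 / 2))%:~R.

Lemma red_itv (t0 t : R) : - (1 / 2) <= red t0 t < 1 / 2.
Proof.
have /andP[] := floor_itv (t - t0 + 1 / 2); rewrite /red intrD.
by set f := _%:~R => h1 h2; apply/andP; split; lra.
Qed.

Lemma red_int (t0 t : R) : exists n : int, t = t0 + red t0 t + n%:~R.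
Proof. by exists (Num.floor (t - t0 + 1 / 2)); rewrite /red; ring. Qed.

Lemma red_def (t0 t : R) : exists n : int, red t0 t = t - t0 - n%:~R.
Proof. by exists (Num.floor (t - t0 + 1 / 2)). Qed.

Lemma red_uniq (t0 t s : R) (n : int) : t = t0 + s + n%:~R ->
  - (1 / 2) <= s < 1 / 2 -> red t0 t = s.
Proof.
move=> E hs; rewrite /red; have -> : Num.floor (t - t0 + 1 / 2) = n.
  by apply: floor_def; rewrite intrD E; apply/andP; move: hs => /andP[h1 h2]; clear -h1 h2; split; lra.
by rewrite E; ring.
Qed.

Lemma red_min (t0 t : R) (n : int) : `|red t0 t| <= `|t - t0 - n%:~R|.
Proof.
have [m Em] := red_int t0 t; have := red_itv t0 t; set r := red t0 t in Em * => hr.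
rewrite Em; have -> : t0 + r + m%:~R - t0 - n%:~R = r + (m - n)%:~R.
  by rewrite rmorphB /=; ring.
have [->|hk] := eqVneq (m - n) 0; first by rewrite addr0.
have h1 : 1 <= `|(m - n)%:~R : R|.
  by rewrite -intr_norm -[1]/(1%:~R) ler_int; clear -hk; lia.
have h2 := ler_normB ((m - n)%:~R : R) (r + (m - n)%:~R).
have h3 : `|r| <= 1 / 2 by rewrite ler_norml; move: hr => /andP[a b]; clear -a b; apply/andP; split; lra.
move: h2; have -> : (m - n)%:~R - (r + (m - n)%:~R) = - r by ring.
have h4 := ler_normD (r + (m - n)%:~R) (- r); rewrite addrAC subrr add0r normrN in h4.
move: h1 h3 h4; clear; lra.
Qed.

Lemma red_near (t0 t : R) : `|red t0 t| < 1 / 2 ->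
  \forall s \near t, red t0 s = red t0 t + (s - t).
Proof.
move=> hr; have [n En] := red_def t0 t.
have e0 : 0 < 1 / 2 - `|red t0 t| by rewrite subr_gt0.
have : nbhs t [set s | `|s - t| < 1 / 2 - `|red t0 t|].
  by apply: line_nbhs.
apply: filterS => s /= hs; apply: (@red_uniq _ _ _ n); first by rewrite En; ring.
have := ler_normD (red t0 t) (s - t) => h.
have : `|red t0 t + (s - t)| < 1 / 2 by move: hs h; clear; lra.
by rewrite ltr_norml => /andP[h1 h2]; rewrite (ltW h1) h2.
Qed.

Lemma red_far (t0 t e : R) : e < `|red t0 t| -> \forall s \near t, e < `|red t0 s|.
Proof.
move=> he; have e0 : 0 < `|red t0 t| - e by rewrite subr_gt0.
have : nbhs t [set s | `|s - t| < `|red t0 t| - e].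
  by apply: line_nbhs.
apply: filterS => s /= hs; have [n En] := red_def t0 s.
have h1 := red_min t0 t n.
have h2 : t - t0 - n%:~R = red t0 s + (t - s).
  by rewrite En; ring.
have h3 := ler_normD (red t0 s) (t - s); rewrite h2 in h1.
by move: h1 h3 hs; rewrite (distrC t s); clear; lra.
Qed.

Lemma param_red (J : R -> S) (t0 t : R) : simple_closed_param J ->
  J t = J (t0 + red t0 t).
Proof. by move=> [_ iJ]; apply/iJ; exact: red_int. Qed.

Lemma red_eq (J : R -> S) (t0 x y : R) : simple_closed_param J ->
  J (t0 + red t0 x) = J (t0 + red t0 y) -> red t0 x = red t0 y.
Proof.
move=> scJ /(curve_inj scJ) H; apply: (addrI t0); apply: H.
have /andP[h1 h2] := red_itv t0 x; have /andP[h3 h4] := red_itv t0 y.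
by rewrite ltr_norml; apply/andP; move: h1 h2 h3 h4; clear; split; lra.
Qed.

Lemma ramp_bounds (e : R) (a t : R -> R) : 0 < e ->
  (forall x, is_derive x (1 : R) a (t x)) -> (forall x, x <= - e -> a x = 0) ->
  (forall x, e <= x -> a x = x) -> (forall x, 0 <= t x) ->
  forall x, 0 <= a x /\ (a x <= e \/ a x = x).
Proof.
move=> e0 da a0 a1 t0.
have mono x y : x <= y -> a x <= a y.
  move=> xy; apply: (@ger0_derive1_le_cc _ a x y).
  - by move=> z _; have [h _] := da z; exact: h.
  - by move=> z _; rewrite derive1E; have [_ ->] := da z; exact: t0.
  - apply: continuous_subspaceT => z; apply: differentiable_continuous.
    by apply/derivable1_diffP; have [h _] := da z; exact: h.
  - by rewrite in_itv /= lexx.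
  - by rewrite in_itv /= lexx xy.
  - exact: xy.
move=> x; split.
  have [h|h] := leP x (- e); first by rewrite a0.
  by rewrite -(a0 (- e)) //; apply: mono; exact: ltW.
have [h|h] := leP e x; first by right; exact: a1.
by left; apply: le_trans (mono _ _ (ltW h)) _; rewrite a1.
Qed.

Lemma regular_congr (u v : R -> S) t : {near t, u =1 v} -> regular_at A u t -> regular_at A v t.
Proof.
move=> nE [cu [c [Ac ct su du]]]; have E := nbhs_singleton nE.
have nE' : {near t, chart_fun c \o u =1 chart_fun c \o v}.
  by apply: filterS nE => s /= ->.
split; first by rewrite /prop_for /continuous_at -E; apply: cvg_trans cu; exact: near_eq_cvg.
exists c; split; [by []|by rewrite -E|exact: (smooth_at_congr nE')|].
by rewrite -(near_eq_derive1 nE'); exact: du.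
Qed.

Lemma regular_plane d (k : R -> plane) (s : R) : A d -> smooth_at k s ->
  derive1 k s != 0 -> (chart_fun d @` chart_dom d) (k s) ->
  regular_at A (fun s => chart_inv d (k s)) s.
Proof.
move=> Ad sk dk hi; split.
  apply: (continuous_comp (f := k)); first exact: (smooth_at_continuous sk).
  exact: chart_inv_continuous.
have nE : {near s, k =1 chart_fun d \o (fun s => chart_inv d (k s))}.
  have : nbhs s (k @^-1` (chart_fun d @` chart_dom d)).
    apply: (smooth_at_continuous sk).
    by apply: open_nbhs_nbhs; split => //; exact: chart_cod_open.
  by apply: filterS => y /chart_imgP[ee _] /=; rewrite ee.
exists d; split; [by []|by have [] := chart_imgP hi|exact: (smooth_at_congr nE)|].
by rewrite -(near_eq_derive1 nE).
Qed.

Lemma regular_affine (u : R -> S) (x a m s0 : R) : m != 0 ->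
  regular_at A u (a + m * s0) -> regular_at A (fun y => u (a + m * (s0 + (y - x)))) x.
Proof.
move=> m0 [cu [c [Ac cut su du]]].
pose g y := a + m * (s0 + (y - x)).
have Eg : g x = a + m * s0 by rewrite /g subrr addr0.
have sg : smooth_at g x.
  apply: smooth_atD; first exact: smooth_at_cst.
  apply: smooth_atM; first exact: smooth_at_cst.
  apply: smooth_atD; first exact: smooth_at_cst.
  by apply: smooth_atB; [exact: smooth_at_id|exact: smooth_at_cst].
have dg : derive1 g x = m.
  have d := is_deriveD (is_derive_cst a x (1 : R)) (is_deriveZ m
     (is_deriveD (is_derive_cst s0 x (1 : R)) (is_deriveB (is_derive_id x (1 : R)) (is_derive_cst x x (1 : R))))).
  rewrite derive1E; have [_] := d.
  by rewrite subr0 !add0r /GRing.scale /= mulr1.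
rewrite -Eg in cu cut su du.
split; first by apply: (continuous_comp (f := g)); [exact: smooth_at_continuous sg|exact: cu].
exists c; split; [by []|exact: cut|exact: (smooth_at_comp (f := g) (@framed_R R) sg su)|].
have D := derive1_chain (smooth_at_differentiable sg) (smooth_at_differentiable su).
rewrite [X in X != 0]D dg diff1E; last exact: smooth_at_differentiable.
by rewrite scaler_eq0 negb_or m0; exact: du.
Qed.

(** Near the corner the new curve is [P (a s) + Q (a (- s))] minus the corner,
    where [a] is a smooth ramp; away from [s = 0] this is [P s] or [Q (- s)].
    The linear form [L] strictly increases along it, as both summands contribute
    nonnegative derivatives, one of them positive. This gives regularity and
    injectivity at once. *)
Lemma round_corner (J : R -> S) (t0 e0 : R) d (P Q : R -> plane) (L : plane) (N : set S) :
  simple_closed_param J -> A d -> chart_dom d (J t0) ->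
  P 0 = chart_fun d (J t0) -> Q 0 = chart_fun d (J t0) ->
  smooth_at P 0 -> smooth_at Q 0 ->
  0 < dot L (derive1 P 0) -> dot L (derive1 Q 0) < 0 ->
  0 < e0 -> (forall s, 0 <= s < e0 ->
     J (t0 + s) = chart_inv d (P s) /\ J (t0 - s) = chart_inv d (Q s)) ->
  nbhs (J t0) N ->
  exists J' : R -> S, [/\ simple_closed_param J',
    forall t, regular_at A J t \/ red t0 t = 0 -> regular_at A J' t &
    forall t, J' t = J t \/ (N (J' t) /\ N (J t))].
Proof.
move=> scJ Ad dt P0 Q0 sP sQ lP lQ e00 HJ NN; have [cJ iJ] := scJ.
set u := chart_fun d (J t0) in P0 Q0.
have [sLP dLP] := smooth_dot_curve L sP.
have [sLQ dLQ] := smooth_dot_curve L sQ.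
have gP : nbhs (0 : R) [set s | 0 < derive1 (fun s => dot L (P s)) s].
  apply: (cvgr_gt _ (smooth_at_continuous (smooth_at_derive1 sLP))).
  by rewrite dLP.
have gQ : nbhs (0 : R) [set s | derive1 (fun s => dot L (Q s)) s < 0].
  apply: (cvgr_lt _ (smooth_at_continuous (smooth_at_derive1 sLQ))).
  by rewrite dLQ.
have iP : nbhs (P 0) (chart_fun d @` chart_dom d) by rewrite P0; exact: chart_img_nbhs.
have iQ : nbhs (Q 0) (chart_fun d @` chart_dom d) by rewrite Q0; exact: chart_img_nbhs.
have iP' : nbhs (0 : R) (P @^-1` (chart_fun d @` chart_dom d)) by exact: (smooth_at_continuous sP iP).
have iQ' : nbhs (0 : R) (Q @^-1` (chart_fun d @` chart_dom d)) by exact: (smooth_at_continuous sQ iQ).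
have [e1 e10 He1] := nbhs_line (filterI (filterI (filterI (smooth_at_near sP) (smooth_at_near sQ))
   (filterI gP gQ)) (filterI iP' iQ')).
have [e2 [e20 e2e1 e2e0]] := small_pos e10 e00.
have half0 : 0 < (1 / 2 : R) by rewrite divr_gt0.
have [e [e0' ee2 eh]] := small_pos e20 half0.
have ee1 : e < e1 by exact: lt_trans ee2 _.
have ee0 : e < e0 by exact: lt_trans ee2 _.
pose far := J @` [set s | t0 + e <= s <= t0 + 1 - e].
have ofar : open (~` far) by exact/closed_openC/(closed_curve_arc hA).
have ntf : (~` far) (J t0).
  move=> [s /andP[h1 h2] /iJ[n En]].
  have hn : s - t0 = n%:~R by rewrite En; ring.
  have n1 : (0 < n)%R by rewrite -(ltr_int R) -hn; clear -h1 h2 e0'; lra.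
  have n2 : (n < 1)%R by rewrite -(ltr_int R) -hn; clear -h1 h2 e0'; lra.
  by clear -n1 n2; lia.
have Nfar := open_nbhs_nbhs (conj ofar ntf).
have [r r0 Hr] := disc_nbhs (filterI (chart_img_nbhs dt) (near_chart_inv dt (filterI NN Nfar))).
rewrite -/u in Hr.
have r4 : 0 < r / 4 by rewrite divr_gt0.
have nP : nbhs (P 0) [set y | sq (y - u) < r / 4] by rewrite P0; exact: nbhs_disc.
have nQ : nbhs (Q 0) [set y | sq (y - u) < r / 4] by rewrite Q0; exact: nbhs_disc.
have nP' : nbhs (0 : R) (P @^-1` [set y | sq (y - u) < r / 4]) by exact: (smooth_at_continuous sP nP).
have nQ' : nbhs (0 : R) (Q @^-1` [set y | sq (y - u) < r / 4]) by exact: (smooth_at_continuous sQ nQ).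
have [e3 e30 He3] := nbhs_line (filterI nP' nQ').
(* The curve changes for [|red t0 x| < ep] only, but [K] describes it on the
   larger interval [|red t0 x| < e]. *)
have [ep [ep0 epe ep3]] := small_pos e0' e30.
have [a [t [sa da a0 a1 [t_ge t_gt]]]] := smooth_ramp ep0.
have ab := ramp_bounds ep0 da a0 a1 t_ge.
have a_lt s m : ep < m -> s < m -> `|a s| < m.
  move=> hm hs; have [h1 h2] := ab s; rewrite ger0_norm //.
  by case: h2 => [h|->//]; exact: le_lt_trans h _.
pose K s := P (a s) + Q (a (- s)) - u.
have K_r s : ep <= s -> K s = P s.
  by move=> h; rewrite /K a1 // a0 ?lerN2 // Q0 addrK.
have K_l s : s <= - ep -> K s = Q (- s).
  move=> h; have h' : ep <= - s by rewrite lerNr.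
  rewrite /K (a0 _ h) (a1 _ h') P0.
  by rewrite addrAC subrr add0r.
have K_m s : `|s| < ep -> sq (K s - u) < r.
  move=> hs; have hs' : `|- s| < ep by rewrite normrN.
  have h1 : `|a s - 0| < e3.
    by rewrite subr0; apply: a_lt => //; exact: lt_trans (le_lt_trans (ler_norm _) hs) ep3.
  have h2 : `|a (- s) - 0| < e3.
    by rewrite subr0; apply: a_lt => //; exact: lt_trans (le_lt_trans (ler_norm _) hs') ep3.
  have [k1 _] := He3 _ h1; have [_ k2] := He3 _ h2; rewrite /= in k1 k2.
  have -> : K s - u = (P (a s) - u) + (Q (a (- s)) - u).
    by apply: plane_eq; rewrite /K !coordE; ring.
  by apply: le_lt_trans (sqD_le _ _) _; move: k1 k2; clear; lra.
have J_P s : 0 <= s < e -> J (t0 + s) = chart_inv d (P s).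
  by move=> /andP[h1 h2]; have [] := HJ s; rewrite ?h1 //= (lt_trans h2).
have J_Q s : 0 <= s < e -> J (t0 - s) = chart_inv d (Q s).
  by move=> /andP[h1 h2]; have [] := HJ s; rewrite ?h1 //= (lt_trans h2).
have J_K s : `|s| < e -> ep <= `|s| -> J (t0 + s) = chart_inv d (K s).
  move=> hs; case: (lerP 0 s) hs => s0; rewrite ?(ger0_norm s0) ?(ltr0_norm s0) => h1 h2.
    by rewrite K_r // J_P // s0.
  rewrite K_l; last by rewrite lerNr.
  by rewrite -J_Q ?opprK // h1 andbT oppr_ge0 ltW.
pose J' x := if `|red t0 x| < ep then chart_inv d (K (red t0 x)) else J x.
have J'out x : ep <= `|red t0 x| -> J' x = J x by rewrite /J' leNgt => /negbTE ->.
have J'in x : `|red t0 x| < e -> J' x = chart_inv d (K (red t0 x)).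
  move=> h; have [h'|h'] := ltrP `|red t0 x| ep; first by rewrite /J' h'.
  by rewrite J'out // (param_red t0 _ scJ) J_K.
have dK s : `|s| < e -> smooth_at K s /\ 0 < dot L (derive1 K s).
  move=> hs; have hs' : `|- s| < e by rewrite normrN.
  have h1 : `|a s - 0| < e1.
    by rewrite subr0; apply: a_lt; [exact: lt_trans epe _|exact: lt_trans (le_lt_trans (ler_norm _) hs) _].
  have h2 : `|a (- s) - 0| < e1.
    by rewrite subr0; apply: a_lt; [exact: lt_trans epe _|exact: lt_trans (le_lt_trans (ler_norm _) hs') _].
  have [[[k1 _] [k2 _]] _] := He1 _ h1; have [[[_ k3] [_ k4]] _] := He1 _ h2.
  have FR := @framed_R R.
  have dN : is_derive s (1 : R) (fun y : R => - y) (-1) by exact: is_deriveNid.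
  have san : smooth_at (fun s => a (- s)) s.
    apply: (smooth_at_compR (f := fun s => - s) FR); last exact: sa.
    by apply: smooth_atN; exact: smooth_at_id.
  have sK : smooth_at K s.
    apply: smooth_atD; last exact: smooth_at_cst.
    apply: smooth_atD; first exact: (smooth_at_comp (f := a) FR (sa s) k1).
    exact: (smooth_at_comp (f := fun s => a (- s)) FR san k3).
  split => //; have [_ <-] := smooth_dot_curve L sK.
  have [sLP' _] := smooth_dot_curve L k1; have [sLQ' _] := smooth_dot_curve L k3.
  have drP := derivableP ((derivable1_diffP _ _).2 (smooth_at_differentiable sLP')).
  have drQ := derivableP ((derivable1_diffP _ _).2 (smooth_at_differentiable sLQ')).
  rewrite -!derive1E in drP drQ.
  have D1 := is_derive_comp1 (da s) drP.
  have D2 := is_derive_comp1 (is_derive_comp1 dN (da (- s))) drQ.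
  have D3 := is_deriveB (is_deriveD D1 D2) (is_derive_cst (dot L u) s (1 : R)).
  have -> : (fun s => dot L (K s)) = ((fun s => dot L (P s)) \o a) +
     ((fun s => dot L (Q s)) \o (a \o -%R)) - cst (dot L u).
    by apply/funext => x; rewrite !fctE /K !dotDr dotNr.
  rewrite derive1E; have [_ ->] := D3.
  rewrite subr0 /GRing.scale /= mulN1r mulNr.
  have [p1|p1] := ltrP (- ep) s.
    apply: ltr_wpDr; last by rewrite mulr_gt0 // t_gt.
    by rewrite oppr_ge0 mulr_ge0_le0 // ltW.
  apply: ltr_wpDl; first by rewrite mulr_ge0 // ltW.
  rewrite oppr_gt0 pmulr_rlt0 //; apply: t_gt.
  by apply: lt_le_trans (_ : ep <= _); [rewrite gtrN|rewrite lerNr].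
have K_inj s s' : `|s| < e -> `|s'| < e -> K s = K s' -> s = s'.
  move=> hs hs' E.
  have mono x y : `|x| < e -> `|y| < e -> x < y -> dot L (K x) < dot L (K y).
    move=> hx hy xy; apply: (@gtr0_derive1_lt_oo _ (fun s => dot L (K s)) (- e) e).
    - move=> z; rewrite in_itv /= -ltr_norml => /dK[sK _]; apply/derivable1_diffP.
      by apply: smooth_at_differentiable; have [] := smooth_dot_curve L sK.
    - by move=> z; rewrite in_itv /= -ltr_norml => /dK[sK dpos]; have [_ ->] := smooth_dot_curve L sK.
    - move=> z; rewrite inE /= in_itv /= -ltr_norml => /dK[sK _].
      by apply: smooth_at_continuous; have [] := smooth_dot_curve L sK.
    - by rewrite in_itv /= -ltr_norml.
    - by rewrite in_itv /= -ltr_norml.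
    - exact: xy.
  have [lt1|lt1|//] := ltgtP s s'.
    by have := mono _ _ hs hs' lt1; rewrite E ltxx.
  by have := mono _ _ hs' hs lt1; rewrite E ltxx.
have K_img s : `|s| < e -> (chart_fun d @` chart_dom d) (K s).
  move=> hs; have [h|h] := ltrP `|s| ep; first by have [] := Hr _ (K_m s h).
  have [s0|s0] := lerP 0 s.
    rewrite K_r; last by move: h; rewrite ger0_norm.
    by have [_ []] := He1 s ltac:(by rewrite subr0; exact: lt_trans hs ee1).
  rewrite K_l; last by move: h; rewrite ltr0_norm // lerNr.
  by have [_ []] := He1 (- s) ltac:(by rewrite subr0 normrN; exact: lt_trans hs ee1).
have near_in x : `|red t0 x| < e ->
    {near x, (fun y => chart_inv d (K (red t0 x + (y - x)))) =1 J'}.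
  move=> hx; have e2' : `|red t0 x| < 1 / 2 by exact: lt_trans eh.
  have hn : nbhs x [set y | `|red t0 x + (y - x)| < e].
    apply/nbhs_ballP; exists (e - `|red t0 x|); first by rewrite /= subr_gt0.
    move=> y; rewrite /ball /= distrC => hy.
    apply: le_lt_trans (ler_normD _ _) _; move: hy; clear; lra.
  by apply: filterS2 (red_near e2') hn => y E hy; rewrite J'in E.
have J'reg_in x : `|red t0 x| < e -> regular_at A J' x.
  move=> hx; have [sK dKp] := dK _ hx.
  have dK0 : derive1 K (red t0 x) != 0.
    by apply: contraTneq dKp => ->; rewrite /dot !coordE !mulr0 addr0 ltxx.
  have := regular_plane Ad sK dK0 (K_img _ hx).
  rewrite -[red t0 x]mul1r -[1 * _]add0r => /(regular_affine x (oner_neq0 R)).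
  by apply: regular_congr; apply: filterS (near_in x hx) => y <-; rewrite add0r mul1r.
have J'near_out x : ep < `|red t0 x| -> {near x, J =1 J'}.
  by move=> h; apply: filterS (red_far h) => y hy; rewrite J'out // ltW.
have J'cont : continuous J'.
  move=> x; have [h|h] := ltrP `|red t0 x| e; first by have [] := J'reg_in x h.
  have nE := J'near_out x (lt_le_trans epe h).
  rewrite /continuous_at -(nbhs_singleton nE).
  by apply: cvg_trans (cJ x); exact: near_eq_cvg.
have J'far x y : `|red t0 x| < ep -> e <= `|red t0 y| -> J' x <> J' y.
  move=> hx hy E; have hxe : `|red t0 x| < e by exact: lt_trans hx epe.
  have [_ [_ nfar]] := Hr _ (K_m _ hx).
  rewrite J'in // in E; rewrite (J'out y) in E; last exact: le_trans (ltW epe) hy.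
  apply: nfar; rewrite E (param_red t0 y scJ); have := red_itv t0 y.
  set z := red t0 y in hy * => hz; have [z0|z0] := lerP 0 z.
    rewrite ger0_norm // in hy; exists (t0 + z) => //=.
    by move: hz hy eh; clear => /andP[h1 h2] hy eh; apply/andP; split; lra.
  rewrite ltr0_norm // in hy; exists (t0 + z + 1); last by apply/iJ; exists 1.
  by move: hz hy eh; clear => /= /andP[h1 h2] hy eh; apply/andP; split; lra.
have J'inj x y : J' x = J' y -> red t0 x = red t0 y.
  move=> E; have [hx|hx] := ltrP `|red t0 x| e; have [hy|hy] := ltrP `|red t0 y| e.
  - apply: K_inj => //.
    rewrite !J'in // in E.
    have [k1 _] := chart_imgP (K_img _ hx); have [k2 _] := chart_imgP (K_img _ hy).
    by rewrite -k1 -k2 E.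
  - have [hx'|hx'] := ltrP `|red t0 x| ep; first by case: (J'far x y).
    move: E; rewrite !J'out // ?(le_trans (ltW epe)) // (param_red t0 x scJ) (param_red t0 y scJ).
    by move=> /(red_eq scJ).
  - have [hy'|hy'] := ltrP `|red t0 y| ep; first by case: (J'far y x).
    move: E; rewrite !J'out // ?(le_trans (ltW epe)) // (param_red t0 x scJ) (param_red t0 y scJ).
    by move=> /(red_eq scJ).
  - move: E; rewrite !J'out // ?(le_trans (ltW epe)) // (param_red t0 x scJ) (param_red t0 y scJ).
    by move=> /(red_eq scJ).
exists J'; split.
- split=> // x y; split=> [/J'inj E|[n En]].
    have [n En] := red_def t0 x; have [m Em] := red_def t0 y.
    exists (n - m); rewrite rmorphB /=; move: E; rewrite En Em => E.
    by clear -E; lra.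
  have Er : red t0 x = red t0 y.
    have [m Em] := red_def t0 y.
    by apply: (@red_uniq _ _ _ (m + n)); [rewrite En Em intrD; ring|exact: red_itv].
  rewrite /J' Er; case: ifP => // _; by apply/iJ; exists n.
- move=> x H; have [h|h] := ltrP `|red t0 x| e; first exact: J'reg_in.
  apply: (regular_congr (J'near_out x (lt_le_trans epe h))).
  by case: H => // E; move: h; rewrite E normr0 leNgt e0'.
- move=> x; have [h|h] := ltrP `|red t0 x| ep; last by left; exact: J'out.
  right; have he := lt_trans h epe; have [_ [n1 _]] := Hr _ (K_m _ h).
  rewrite J'in //; split; first exact: n1.
  rewrite (param_red t0 x scJ).
  set s := red t0 x in h he *; have rr : r / 4 < r by clear -r0; lra.
  have [s0|s0] := lerP 0 s.
    have hs : `|s - 0| < e3 by rewrite subr0; exact: lt_trans ep3.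
    rewrite J_P; last by rewrite s0; move: he; rewrite ger0_norm.
    by have [k1 _] := He3 s hs; have [_ []] := Hr _ (lt_trans k1 rr).
  have hs : `|- s - 0| < e3 by rewrite subr0 normrN; exact: lt_trans ep3.
  have -> : t0 + s = t0 - - s by rewrite opprK.
  rewrite J_Q; last by rewrite oppr_ge0 ltW //; move: he; rewrite ltr0_norm.
  by have [_ k2] := He3 _ hs; have [_ []] := Hr _ (lt_trans k2 rr).
Qed.

End Rounding.

(** * Discs, chords and lines *)

Section Excursion.
Context {R : realType} {S : topologicalType}.
Local Notation plane := 'rV[R]_2.
Context (A : set (chart R S)) (hA : smooth_surface A).
Implicit Types (c d : chart R S) (p q : S).

Lemma derive1_coord (k : R -> plane) t i : smooth_at k t ->
  derive1 (fun s => k s 0 i) t = (derive1 k t) 0 i.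
Proof.
move=> sk; have [l El] := @coord_linear R 2 i.
have cl : continuous l by rewrite El => x; apply: smooth_at_continuous; exact: smooth_coord.
have := derive1_chain (smooth_at_differentiable sk) (linear_differentiable (k t) cl).
by rewrite diff_lin // El.
Qed.

Lemma derive1_sq (k : R -> plane) t w : smooth_at k t ->
  smooth_at (fun s => sq (k s - w)) t /\
  derive1 (fun s => sq (k s - w)) t = 2 * dot (k t - w) (derive1 k t).
Proof.
move=> sk; split.
  exact: (smooth_at_compR (f := k) (g := fun z => sq (z - w)) (@framed_rV R 1) sk (smooth_sq w (k t))).
have d i : is_derive t (1 : R) (fun s => k s 0 i) ((derive1 k t) 0 i).
  have si := (smooth_at_coord k t).1 sk i.
  rewrite -derive1_coord // derive1E; apply: derivableP.
  exact/derivable1_diffP/(smooth_at_differentiable si).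
have dw i := is_deriveB (d i) (is_derive_cst (w 0 i) t (1 : R)).
have D := is_deriveD (is_deriveM (dw 0) (dw 0)) (is_deriveM (dw 1) (dw 1)).
have -> : (fun s => sq (k s - w)) =
   ((fun s => k s 0 0) - cst (w 0 0)) * ((fun s => k s 0 0) - cst (w 0 0)) +
   ((fun s => k s 0 1) - cst (w 0 1)) * ((fun s => k s 0 1) - cst (w 0 1)).
  by apply/funext => s; rewrite !fctE /sq /dot !coordE.
rewrite derive1E; have [_ ->] := D.
by rewrite /GRing.scale /= !fctE /dot !coordE !subr0; ring.
Qed.

(** A velocity pointing inwards would first decrease the distance to the centre. *)
Lemma leaves_disc (k : R -> plane) w e : smooth_at k 0 -> 0 < e ->
  (forall s, 0 < s < e -> sq (k 0 - w) <= sq (k s - w)) ->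
  0 <= dot (k 0 - w) (derive1 k 0).
Proof.
move=> sk e0 H; rewrite leNgt; apply/negP => neg.
have [sf df] := derive1_sq w sk.
have sN := smooth_atN sf.
have dN : 0 < derive1 (fun s => - sq (k s - w)) 0.
  have d := derivableP ((derivable1_diffP _ _).2 (smooth_at_differentiable sf)).
  rewrite derive1E; have [_ ->] := is_deriveN d.
  by rewrite -derive1E df oppr_gt0; clear -neg; nra.
have [e1 e10 [_ inc]] := increasing_near sN dN.
have [s [s0 se se1]] := small_pos e0 e10.
have := inc 0 s; rewrite !subr0 normr0 gtr0_norm // => /(_ e10 se1 s0).
by rewrite ltrN2 ltNge H // s0.
Qed.

(** For [m] an outward normal of a disc, [p] may be tangent to the boundary
    while [q] enters the disc; tilting [m] slightly towards [p] separates [p]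
    from [q] strictly. *)
Lemma corner_form (m p q : plane) : p != 0 -> 0 <= dot m p -> dot m q < 0 ->
  exists L, 0 < dot L p /\ dot L q < 0.
Proof.
move=> p0 mp mq; have sp := sq_gt0 p0.
have [e [e0 He]] : exists e, 0 < e /\ e * dot p q < - dot m q.
  have q0 : 0 < - dot m q by rewrite oppr_gt0.
  have a0 : 0 < `|dot p q| + 1 by rewrite ltr_wpDl.
  exists (- dot m q / 2 / (`|dot p q| + 1)); split; first by rewrite !divr_gt0.
  rewrite mulrAC ltr_pdivrMr //.
  have := ler_norm (dot p q); move: q0 (normr_ge0 (dot p q)).
  set a := dot m q; set b := dot p q; set c := `|b|; move=> h1 h2 h3.
  clear -h1 h2 h3; nra.
exists (m + e *: p); rewrite !dotDl !dotZl; split.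
  by apply: ltr_wpDl => //; rewrite mulr_gt0.
by rewrite -ltrBrDl sub0r.
Qed.

Lemma chord_dot (u v w : plane) : sq (u - w) = sq (v - w) -> u != v ->
  dot (u - w) (v - u) < 0.
Proof.
move=> E uv; have h : 0 < sq (v - u) by apply: sq_gt0; rewrite subr_eq0 eq_sym.
have : sq (v - w) = sq (u - w) + 2 * dot (u - w) (v - u) + sq (v - u).
  by rewrite -sqD; congr sq; apply: plane_eq; rewrite !coordE; ring.
by rewrite E; clear -h; lra.
Qed.

Lemma chord_inside (u v w : plane) r (l : R) : sq (u - w) = r -> sq (v - w) = r ->
  u != v -> 0 < l < 1 -> sq (u + l *: (v - u) - w) < r.
Proof.
move=> Eu Ev uv /andP[l0 l1]; have h : 0 < sq (v - u) by apply: sq_gt0; rewrite subr_eq0 eq_sym.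
have -> : sq (u + l *: (v - u) - w) = (1 - l) * sq (u - w) + l * sq (v - w) - l * (1 - l) * sq (v - u).
  by rewrite /sq /dot !coordE; ring.
rewrite Eu Ev; have : 0 < l * (1 - l) * sq (v - u) by rewrite !mulr_gt0 // subr_gt0.
by lra.
Qed.

Lemma smooth_line (u v : plane) (x : R) : smooth_at (fun s : R => u + s *: v) x /\
  derive1 (fun s : R => u + s *: v) x = v.
Proof.
have s i : smooth_at (fun s : R => (u + s *: v) 0 i) x.
  under [X in smooth_at X]eq_fun do rewrite !coordE.
  apply: smooth_atD; first exact: smooth_at_cst.
  by apply: smooth_atM; [exact: smooth_at_id|exact: smooth_at_cst].
have sm : smooth_at (fun s : R => u + s *: v) x by apply/smooth_at_coord.
split => //; apply/rowP => i; rewrite -derive1_coord // derive1E.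
have d := is_deriveD (is_derive_cst (u 0 i) x (1 : R))
  (is_deriveM (is_derive_id x (1 : R)) (is_derive_cst (v 0 i) x (1 : R))).
have -> : (fun s : R => (u + s *: v) 0 i) = cst (u 0 i) + id * cst (v 0 i).
  by apply/funext => s0; rewrite !coordE.
by have [_ ->] := d; rewrite /GRing.scale /= mulr0 !add0r mulr1.
Qed.

Lemma regular_line d (u v : plane) (s : R) : A d -> v != 0 ->
  (chart_fun d @` chart_dom d) (u + s *: v) ->
  regular_at A (fun s => chart_inv d (u + s *: v)) s.
Proof.
move=> Ad v0 hi; have [sm dm] := smooth_line u v s.
apply: (regular_plane Ad sm _ hi).
by rewrite [X in X != 0]dm.
Qed.

End Excursion.

(** * Closing an excursion out of a disc *)

Section ExcursionCurve.
Context {R : realType} {S : topologicalType}.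
Local Notation plane := 'rV[R]_2.
Context (A : set (chart R S)) (hA : smooth_surface A).

Lemma red_half (x : R) :
  (0 <= red 0 x -> red (1 / 2) x = red 0 x - 1 / 2) /\
  (red 0 x < 0 -> red (1 / 2) x = red 0 x + 1 / 2).
Proof.
have /andP[h1 h2] := red_itv 0 x; have [n En] := red_def 0 x.
split=> h.
  apply: (@red_uniq _ _ _ _ n); first by rewrite En; lra.
  by apply/andP; split; lra.
apply: (@red_uniq _ _ _ _ (n - 1)); first by rewrite En rmorphB /=; lra.
by apply/andP; split; lra.
Qed.

Variables (tau : R -> S) (d : chart R S) (w : plane) (r1 r2 t0 t1 : R).
Hypotheses (ctau : continuous tau) (itau : injective tau)
  (rtau : forall t, regular_at A tau t) (Ad : A d)
  (r12 : 0 < r1 < r2)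
  (Hball : forall z, sq (z - w) <= r2 -> (chart_fun d @` chart_dom d) z)
  (t01 : t0 < t1)
  (d0 : chart_dom d (tau t0)) (q0 : sq (chart_fun d (tau t0) - w) = r1)
  (d1 : chart_dom d (tau t1)) (q1 : sq (chart_fun d (tau t1) - w) = r1)
  (out : forall t, t0 < t < t1 -> ~ (chart_dom d (tau t) /\ sq (chart_fun d (tau t) - w) <= r1)).

Let u := chart_fun d (tau t0).
Let v := chart_fun d (tau t1).
Let T := t1 - t0.
Let T0 : 0 < T. Proof. by rewrite subr_gt0. Qed.
Let r1r2 : r1 <= r2. Proof. by case/andP: r12 => _ /ltW. Qed.

Let uv : u != v.
Proof.
apply/eqP => E; have := congr1 (chart_inv d) E; rewrite /u /v !chart_funK // => /itau E1.
by move: t01; rewrite E1 ltxx.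
Qed.

(** One period of the curve: the excursion for [0 <= s < 1 / 2], then the chord
    back. [G'] is the same curve read around the second corner, so that both
    corners are at parameter 0. *)
Let G (s : R) := if 0 <= s then tau (t0 + (2 * T) * s) else chart_inv d (u + s *: (- 2 *: (v - u))).
Let G' (s : R) := if 0 <= s then chart_inv d (v + s *: (2 *: (u - v))) else tau (t1 + (2 * T) * s).
Let J (x : R) := G (red 0 x).

Let J' (x : R) : J x = G' (red (1 / 2) x).
Proof.
have /andP[h1 h2] := red_itv 0 x; have [H1 H2] := red_half x.
rewrite /J /G /G'; case: (lerP 0 (red 0 x)) => h.
  rewrite H1 // ifF; last by apply/negbTE; rewrite -ltNge subr_lt0.
  by congr tau; rewrite /T; field.
rewrite H2 // ifT; last by rewrite -subr_ge0 in h1; lra.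
by congr chart_inv; apply: plane_eq; rewrite !coordE; field.
Qed.

Let line_in s : - (1 / 2) <= s <= 0 -> sq (u + s *: (- 2 *: (v - u)) - w) <= r1.
Proof.
move=> /andP[h1 h2].
have -> : u + s *: (- 2 *: (v - u)) = u + (- 2 * s) *: (v - u).
  by apply: plane_eq; rewrite !coordE; ring.
have [->|s0] := eqVneq s 0; first by rewrite mulr0 scale0r addr0 q0.
have [->|s1] := eqVneq s (- (1 / 2)).
  have -> : u + - 2 * - (1 / 2) *: (v - u) = v by apply: plane_eq; rewrite !coordE; field.
  by rewrite q1.
apply/ltW/(chord_inside q0 q1 uv).
have s0' : s < 0 by rewrite lt_neqAle s0.
have s1' : - (1 / 2) < s by rewrite lt_neqAle eq_sym s1.
by apply/andP; split; lra.
Qed.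

Let line_lt s : - (1 / 2) < s < 0 -> sq (u + s *: (- 2 *: (v - u)) - w) < r1.
Proof.
move=> /andP[h1 h2].
have -> : u + s *: (- 2 *: (v - u)) = u + (- 2 * s) *: (v - u).
  by apply: plane_eq; rewrite !coordE; ring.
by apply: (chord_inside q0 q1 uv); apply/andP; split; lra.
Qed.

Let img_line s : - (1 / 2) <= s <= 0 -> (chart_fun d @` chart_dom d) (u + s *: (- 2 *: (v - u))).
Proof. by move=> /line_in h; apply: Hball; exact: le_trans r1r2. Qed.

Let Jreg x : red 0 x != 0 -> red (1 / 2) x != 0 -> regular_at A J x.
Proof.
have /andP[h1 h2] := red_itv 0 x; move=> n0 n1.
have hs : - (1 / 2) < red 0 x.
  rewrite lt_neqAle h1 andbT eq_sym; apply: contra_neq n1 => E.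
  have [_ H] := red_half x; have lt0 : red 0 x < 0 by rewrite E oppr_lt0 divr_gt0.
  by rewrite (H lt0) E addNr.
have nr : `|red 0 x| < 1 / 2 by rewrite ltr_norml hs.
have Hn := red_near nr.
have [h|h|h] := ltgtP (red 0 x) 0; last by rewrite h eqxx in n0.
  have v0 : - 2 *: (v - u) != 0.
    by rewrite scaler_eq0 oppr_eq0 pnatr_eq0 /= subr_eq0 eq_sym.
  have hi : (chart_fun d @` chart_dom d) (u + red 0 x *: (- 2 *: (v - u))).
    by apply: img_line; rewrite h1 ltW.
  have rl := regular_line Ad v0 hi.
  have e1 : 0 + 1 * red 0 x = red 0 x by rewrite add0r mul1r.
  rewrite -e1 in rl; have := regular_affine x (oner_neq0 R) rl.
  apply: regular_congr.
  have nneg : \forall y \near x, red 0 x + (y - x) < 0.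
    have e0 : 0 < - red 0 x by rewrite oppr_gt0.
    have : nbhs x [set y | `|y - x| < - red 0 x].
      by apply: line_nbhs.
    by apply: filterS => y /= hy; have := ler_norm (y - x); lra.
  apply: filterS2 Hn nneg => y E ny.
  by rewrite /J E /G leNgt ny /= add0r mul1r.
have m0 : 2 * T != 0 by rewrite mulf_neq0 ?pnatr_eq0 // gt_eqF.
have := regular_affine x m0 (rtau (t0 + 2 * T * red 0 x)).
apply: regular_congr.
have npos : \forall y \near x, 0 < red 0 x + (y - x).
  have : nbhs x [set y | `|y - x| < red 0 x].
    by apply: line_nbhs.
  by apply: filterS => y /= hy; have := ler_norm (- (y - x)); rewrite normrN; lra.
by apply: filterS2 Hn npos => y E ny; rewrite /J E /G ltW.
Qed.

Let Jcorner0 s : 0 <= s < 1 / 2 -> J (0 + s) = tau (t0 + (2 * T) * s) /\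
  J (0 - s) = chart_inv d (u + s *: (2 *: (v - u))).
Proof.
move=> /andP[s0 s1]; split.
  have E : red 0 (0 + s) = s.
    apply: (@red_uniq _ _ _ _ 0); first by rewrite addr0.
    by apply/andP; split; lra.
  by rewrite /J E /G s0.
have E : red 0 (0 - s) = - s.
  apply: (@red_uniq _ _ _ _ 0); first by rewrite addr0.
  by apply/andP; split; lra.
rewrite /J E /G; have [->|sn] := eqVneq s 0.
  by rewrite oppr0 lexx mulr0 addr0 scale0r addr0 /u chart_funK.
rewrite leNgt oppr_lt0 lt_neqAle eq_sym sn s0 /=.
by congr chart_inv; apply: plane_eq; rewrite !coordE; field.
Qed.

Let Jcorner1 s : 0 <= s < 1 / 2 ->
  J (1 / 2 + s) = chart_inv d (v + s *: (2 *: (u - v))) /\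
  J (1 / 2 - s) = tau (t1 - (2 * T) * s).
Proof.
move=> /andP[s0 s1]; split.
  have E : red (1 / 2) (1 / 2 + s) = s.
    apply: (@red_uniq _ _ _ _ 0); first by rewrite addr0.
    by apply/andP; split; lra.
  by rewrite J' E /G' s0.
have E : red (1 / 2) (1 / 2 - s) = - s.
  apply: (@red_uniq _ _ _ _ 0); first by rewrite addr0.
  by apply/andP; split; lra.
rewrite J' E /G'; have [->|sn] := eqVneq s 0.
  by rewrite oppr0 lexx mulr0 subr0 scale0r addr0 /v chart_funK.
by rewrite leNgt oppr_lt0 lt_neqAle eq_sym sn s0 /= mulrN.
Qed.

Let J0 : J 0 = tau t0.
Proof.
have [h _] := @Jcorner0 0 ltac:(by rewrite lexx divr_gt0).
by move: h; rewrite !addr0 mulr0 addr0.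
Qed.

Let J1 : J (1 / 2) = tau t1.
Proof.
have [_ h] := @Jcorner1 0 ltac:(by rewrite lexx divr_gt0).
by move: h; rewrite !subr0 mulr0 subr0.
Qed.

Let corner_cont (f g : R -> S) (x : R) : {for (0 : R), continuous f} -> {for (0 : R), continuous g} ->
  (forall s, 0 <= s < 1 / 2 -> J (x + s) = f s /\ J (x - s) = g s) -> {for x, continuous J}.
Proof.
move=> cf cg H N.
have h0 : 0 <= (0 : R) < 1 / 2 by rewrite lexx divr_gt0.
have [Hf Hg] := H 0 h0; rewrite addr0 in Hf; rewrite subr0 in Hg.
move=> HN; have Nf : nbhs (0 : R) (f @^-1` N) by apply: cf; rewrite -Hf.
have Ng : nbhs (0 : R) (g @^-1` N) by apply: cg; rewrite -Hg.
have [e e0 He] := nbhs_line (filterI Nf Ng).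
have half0 : 0 < (1 / 2 : R) by rewrite divr_gt0.
have [e' [e'0 e'e e'h]] := small_pos e0 half0.
apply/nbhs_ballP; exists e' => // y; rewrite /ball /= distrC => hy.
have [xy|xy] := lerP x y.
  have hs : 0 <= y - x < 1 / 2.
    rewrite subr_ge0 xy /=; move: hy; rewrite ger0_norm ?subr_ge0 // => hy.
    exact: lt_trans e'h.
  have [Ef _] := H _ hs; rewrite addrC subrK in Ef; rewrite /= Ef.
  have hy' : `|y - x - 0| < e by rewrite subr0; exact: lt_trans e'e.
  by have [k _] := He _ hy'; exact: k.
have hs : 0 <= x - y < 1 / 2.
  rewrite subr_ge0 ltW //=; move: hy; rewrite distrC ger0_norm ?subr_ge0 ?ltW // => hy.
  exact: lt_trans e'h.
have [_ Eg] := H _ hs; rewrite opprB addrC subrK in Eg; rewrite /= Eg.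
have hy' : `|x - y - 0| < e by rewrite subr0 distrC; exact: lt_trans e'e.
by have [_ k] := He _ hy'; exact: k.
Qed.

Let cont_tau (a m : R) : {for (0 : R), continuous (fun s : R => tau (a + m * s))}.
Proof.
apply: (continuous_comp (f := fun s : R => a + m * s)); last exact: ctau.
apply: smooth_at_continuous; apply: smooth_atD; first exact: smooth_at_cst.
by apply: smooth_atM; [exact: smooth_at_cst|exact: smooth_at_id].
Qed.

Let cont_line (a b : plane) : (chart_fun d @` chart_dom d) a ->
  {for (0 : R), continuous (fun s : R => chart_inv d (a + s *: b))}.
Proof.
move=> ha; apply: (continuous_comp (f := fun s : R => a + s *: b)).
  by have [sl _] := smooth_line a b (0 : R); exact: (smooth_at_continuous sl).
by rewrite scale0r addr0; exact: chart_inv_continuous.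
Qed.

Let per (t x y : R) (n : int) : x = y + n%:~R -> red t x = red t y.
Proof.
move=> E; have [m Em] := red_def t y.
apply: (@red_uniq _ _ _ _ (m + n)); last exact: red_itv.
by rewrite Em E rmorphD /=; ring.
Qed.

Let red0_int (t x : R) : red t x = 0 -> exists n : int, x = t + n%:~R.
Proof. by have [n En] := red_int t x => E; exists n; rewrite {1}En E addr0. Qed.

Let near_per (x y : R) (n : int) : x = y + n%:~R -> {for y, continuous J} -> {for x, continuous J}.
Proof.
move=> E cy N HN; have Jxy s : J (s - n%:~R) = J s.
  by rewrite /J; congr G; apply: (@per _ _ _ (- n)); rewrite rmorphN.
have E' : y = x - n%:~R by rewrite E addrK.
have Ny : nbhs y (J @^-1` N) by apply: cy; rewrite E' Jxy.
have cs : {for x, continuous (fun s : R => s - n%:~R)}.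
  by apply: continuousB; [exact: cvg_id|exact: cst_continuous].
have : nbhs x ((fun s : R => s - n%:~R) @^-1` (J @^-1` N)) by apply: cs; rewrite -E'.
by apply: filterS => s /=; rewrite Jxy.
Qed.

Let Jcont : continuous J.
Proof.
move=> x; have [E|n0] := eqVneq (red 0 x) 0.
  have [n En] := red0_int E; apply: (near_per En).
  apply: (corner_cont (f := fun s => tau (t0 + (2 * T) * s))
     (g := fun s => chart_inv d (u + s *: (2 *: (v - u))))).
  - exact: cont_tau.
  - by apply: cont_line; exact: chart_img.
  - exact: Jcorner0.
have [E|n1] := eqVneq (red (1 / 2) x) 0; last by have [] := Jreg n0 n1.
have [n En] := red0_int E; apply: (near_per En).
apply: (corner_cont (f := fun s => chart_inv d (v + s *: (2 *: (u - v))))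
   (g := fun s => tau (t1 + (- (2 * T)) * s))).
- by apply: cont_line; exact: chart_img.
- exact: cont_tau.
- by move=> s hs; have [-> ->] := Jcorner1 hs; rewrite mulNr.
Qed.

Let time (s : R) : 0 <= s < 1 / 2 -> t0 <= t0 + 2 * T * s < t1.
Proof.
move=> /andP[h1 h2]; rewrite lerDl mulr_ge0 ?mulr_ge0 ?(ltW T0) //=.
have : 2 * T * s < 2 * T * (1 / 2) by rewrite ltr_pM2l // mulr_gt0.
have -> : 2 * T * (1 / 2) = t1 - t0 by rewrite /T; field.
by rewrite ltrBrDl.
Qed.

Let mixed (s s' : R) : 0 <= s < 1 / 2 -> - (1 / 2) <= s' < 0 -> G s <> G s'.
Proof.
move=> hs hs'; have /andP[s0 s1] := hs; have /andP[s'0 s'1] := hs'.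
rewrite /G s0 leNgt s'1 /= => E.
have hs'' : - (1 / 2) <= s' <= 0 by rewrite s'0 ltW.
have [k1 k2] := chart_imgP (img_line hs''); rewrite -E in k1 k2.
have /andP[ht0 ht1] := time hs.
have [Es'|ns'] := eqVneq s' (- (1 / 2)).
  have := congr1 (chart_inv d) k1; rewrite chart_funK // Es'.
  have -> : u + - (1 / 2) *: (- 2 *: (v - u)) = v by apply: plane_eq; rewrite !coordE; field.
  by rewrite /v chart_funK // => /itau E1; move: ht1; rewrite E1 ltxx.
have s'2 : - (1 / 2) < s' by rewrite lt_neqAle eq_sym ns'.
have lt1 : sq (chart_fun d (tau (t0 + 2 * T * s)) - w) < r1.
  by rewrite k1; apply: line_lt; rewrite s'2.
have [Et|nt] := eqVneq (t0 + 2 * T * s) t0.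
  by move: lt1; rewrite Et q0 ltxx.
apply: (out (t := t0 + 2 * T * s)); first by rewrite ht1 andbT lt_neqAle eq_sym nt.
by split => //; exact: ltW.
Qed.

Let Ginj (s s' : R) : - (1 / 2) <= s < 1 / 2 -> - (1 / 2) <= s' < 1 / 2 -> G s = G s' -> s = s'.
Proof.
move=> /andP[h1 h2] /andP[h3 h4]; have [s0|s0] := lerP 0 s; have [s'0|s'0] := lerP 0 s'.
- rewrite /G s0 s'0 => /itau /addrI /mulfI; apply.
  by rewrite mulf_neq0 ?pnatr_eq0 // gt_eqF.
- by move=> E; case: (mixed (s := s) (s' := s')); rewrite ?s0 ?h3.
- by move=> E; case: (mixed (s := s') (s' := s)); rewrite ?s'0 ?h1.
- have i1 : - (1 / 2) <= s <= 0 by rewrite h1 ltW.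
  have i2 : - (1 / 2) <= s' <= 0 by rewrite h3 ltW.
  have [k1 _] := chart_imgP (img_line i1); have [k2 _] := chart_imgP (img_line i2).
  rewrite /G !leNgt s0 s'0 /= => E; have := k1; rewrite E k2 => /addrI/eqP.
  rewrite -subr_eq0 -scalerBl scaler_eq0 scaler_eq0 oppr_eq0 pnatr_eq0 /= subr_eq0.
  by rewrite [v - u == 0]subr_eq0 [v == u]eq_sym (negbTE uv) orbF => /eqP.
Qed.

Let Jscp : simple_closed_param J.
Proof.
split; first exact: Jcont.
move=> x y; split=> [E|[n En]]; last by rewrite /J (per _ En).
have {}E : red 0 x = red 0 y by apply: Ginj E; exact: red_itv.
have [n En] := red_def 0 x; have [m Em] := red_def 0 y.
exists (n - m); rewrite rmorphB /=; move: E; rewrite En Em => E.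
by lra.
Qed.

(** The chord lies inside the small disc and the excursion outside, so they meet
    only at their ends and form a simple closed curve with two corners. The
    excursion does not enter the disc ([leaves_disc]) and the chord does
    ([chord_dot]), hence [corner_form] provides the linear forms needed to round
    the corners. This is done in disjoint neighbourhoods inside the large disc. *)
Lemma excursion_curve : exists b, [/\ smooth_param A b,
  (forall p, range b p -> (exists2 t, t0 <= t <= t1 & p = tau t) \/ disc d w r2 p) &
  (forall t, t0 <= t <= t1 -> ~ disc d w r2 (tau t) -> range b (tau t))].
Proof.
have Du : disc d w r2 (tau t0) by split => //; rewrite q0; case/andP: r12.
have Dv : disc d w r2 (tau t1) by split => //; rewrite q1; case/andP: r12.
have hau : hausdorff_space S by case: hA.
have n01 : tau t0 != tau t1 by apply/eqP => /itau E; move: t01; rewrite E ltxx.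
move: hau; rewrite open_hausdorff => /(_ _ _ n01)[[N M] /= [Nu Mv] [oN oM NM0]].
have NNu : nbhs (J 0) (N `&` disc d w r2).
  rewrite J0; apply: open_nbhs_nbhs; split; first by apply: openI => //; exact: disc_open.
  by split => //; rewrite inE in Nu.
have NMv : nbhs (J (1 / 2)) (M `&` disc d w r2).
  rewrite J1; apply: open_nbhs_nbhs; split; first by apply: openI => //; exact: disc_open.
  by split => //; rewrite inE in Mv.
have half0 : 0 < (1 / 2 : R) by rewrite divr_gt0.
have T2 : 0 < 2 * T by rewrite mulr_gt0.
have arc (a m : R) : chart_dom d (tau a) -> m != 0 ->
   smooth_at (fun s : R => chart_fun d (tau (a + m * s))) 0 /\
   derive1 (fun s : R => chart_fun d (tau (a + m * s))) 0 != 0 /\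
   exists2 e, 0 < e & forall s : R, `|s| < e -> chart_dom d (tau (a + m * s)).
  move=> da m0; have ra : regular_at A (fun y => tau (a + m * (0 + (y - 0)))) 0.
    by apply: regular_affine => //; rewrite mulr0 addr0; exact: rtau.
  have {}ra : regular_at A (fun y => tau (a + m * y)) 0.
    apply: (regular_congr _ ra); apply: filterE => y /=.
    by rewrite add0r subr0.
  have d00 : chart_dom d ((fun y : R => tau (a + m * y)) 0) by rewrite mulr0 addr0.
  have [s1 s2] := regular_at_chart hA ra Ad d00; split; first exact: s1.
  split; first exact: s2.
  have [cr _] := ra; have [e e0 He] := nbhs_line (cr _ (chart_dom_nbhs d00)).
  by exists e => // s hs; have := He s; rewrite subr0; apply.
have [sP [dP [eP eP0 HP]]] := arc t0 (2 * T) d0 (lt0r_neq0 T2).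
have T2N : - (2 * T) != 0 by rewrite oppr_eq0 lt0r_neq0.
have [sQ [dQ [eQ eQ0 HQ]]] := arc t1 (- (2 * T)) d1 T2N.
pose P := (fun s : R => chart_fun d (tau (t0 + 2 * T * s))).
pose Q := (fun s : R => chart_fun d (tau (t1 + - (2 * T) * s))).
have P0 : P 0 = u by rewrite /P mulr0 addr0.
have Q0 : Q 0 = v by rewrite /Q mulr0 addr0.
have leave a (k : R -> R) e : 0 < e -> (forall s, 0 < s < 1 / 2 -> t0 < k s < t1) ->
   (forall s, `|s| < e -> chart_dom d (tau (k s))) ->
   smooth_at (fun s => chart_fun d (tau (k s))) 0 -> chart_fun d (tau (k 0)) = a -> sq (a - w) = r1 ->
   0 <= dot (a - w) (derive1 (fun s => chart_fun d (tau (k s))) 0).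
  move=> e0 Hk Hd sk <- Ea; have [e' [e'0 e'e e'h]] := small_pos e0 half0.
  apply: (leaves_disc sk e'0) => s /andP[s0 se].
  rewrite Ea leNgt; apply/negP => hlt; apply: (out (t := k s)).
    by apply: Hk; rewrite s0 (lt_trans se).
  split; last exact: ltW.
  by apply: Hd; rewrite gtr0_norm // (lt_trans se).
have tin (s : R) : 0 < s < 1 / 2 -> 0 < 2 * T * s < T.
  move=> /andP[s0 s1]; rewrite mulr_gt0 //=.
  have {2}-> : T = 2 * T * (1 / 2) by field.
  by rewrite ltr_pM2l.
have mP : 0 <= dot (u - w) (derive1 P 0).
  apply: (leave _ (fun s => t0 + 2 * T * s) eP) => //.
  by move=> s /tin/andP[h1 h2]; rewrite ltrDl h1 /= -ltrBrDl.
have mQ : 0 <= dot (v - w) (derive1 Q 0).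
  apply: (leave _ (fun s => t1 + - (2 * T) * s) eQ) => //.
  move=> s /tin/andP[h1 h2]; rewrite mulNr gtrBl h1 andbT.
  by rewrite ltrBrDl -ltrBrDr.
have Quv : sq (u - w) = sq (v - w) by rewrite q0 q1.
have vu : v != u by rewrite eq_sym.
have cu : dot (u - w) (2 *: (v - u)) < 0.
  by rewrite dotZr pmulr_rlt0 //; exact: chord_dot.
have cv : dot (v - w) (2 *: (u - v)) < 0.
  by rewrite dotZr pmulr_rlt0 //; exact: chord_dot.
have [L0 [L0P L0Q]] := corner_form dP mP cu.
have [L1 [L1Q L1P]] := corner_form dQ mQ cv.
have [e [e0 eeP eh]] := small_pos eP0 half0.
have dJ0 : chart_dom d (J 0) by rewrite J0.
have [sl0 dl0] := smooth_line u (2 *: (v - u)) (0 : R).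
have [J2 [scp2 reg2 eq2]] : exists J' : R -> S, [/\ simple_closed_param J',
    forall t, regular_at A J t \/ red 0 t = 0 -> regular_at A J' t &
    forall t, J' t = J t \/ ((N `&` disc d w r2) (J' t) /\ (N `&` disc d w r2) (J t))].
  apply: (round_corner hA (P := P) (Q := fun s : R => u + s *: (2 *: (v - u))) (L := L0) (e0 := e) Jscp Ad dJ0) => //.
  - by rewrite P0 J0.
  - by rewrite scale0r addr0 J0.
  - by rewrite dl0.
  - move=> s /andP[s0 se]; have [-> ->] := Jcorner0 (s := s) ltac:(by rewrite s0 (lt_trans se)).
    split => //; rewrite /P chart_funK //; apply: HP.
    by rewrite ger0_norm // (lt_trans se).
have [eM eM0 HM] := nbhs_line (Jcont (filterS (@subIsetl _ _ _) NMv)).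
have same y : `|y - 1 / 2| < eM -> J2 y = J y.
  move=> /HM My; case: (eq2 y) => [//|[_ [Ny _]]].
  by have : (N `&` M) (J y) by []; rewrite (eqP NM0).
have [e' [e'0 e'eQ e'h]] := small_pos eQ0 half0.
have [e2 [e20 e2e' e2M]] := small_pos e'0 eM0.
have J2h : J2 (1 / 2) = tau t1 by rewrite same ?J1 // subrr normr0.
have dJ1 : chart_dom d (J2 (1 / 2)) by rewrite J2h.
have NMv2 : nbhs (J2 (1 / 2)) (M `&` disc d w r2) by rewrite J2h -J1.
have [sl1 dl1] := smooth_line v (2 *: (u - v)) (0 : R).
have [J3 [scp3 reg3 eq3]] : exists J' : R -> S, [/\ simple_closed_param J',
    forall t, regular_at A J2 t \/ red (1 / 2) t = 0 -> regular_at A J' t &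
    forall t, J' t = J2 t \/ ((M `&` disc d w r2) (J' t) /\ (M `&` disc d w r2) (J2 t))].
  apply: (round_corner hA (P := fun s : R => v + s *: (2 *: (u - v))) (Q := Q) (L := - L1) (e0 := e2) scp2 Ad dJ1) => //.
  - by rewrite scale0r addr0 J2h.
  - by rewrite Q0 J2h.
  - by rewrite dl1 -scaleN1r dotZl mulN1r oppr_gt0.
  - by rewrite -scaleN1r dotZl mulN1r oppr_lt0.
  - move=> s /andP[s0 se]; have hs : `|s| < eM by rewrite ger0_norm // (lt_trans se).
    rewrite !same; last 2 first.
    + by rewrite addrAC subrr add0r normrN.
    + by rewrite addrAC subrr add0r.
    have [-> ->] := Jcorner1 (s := s) ltac:(by rewrite s0 (lt_trans se) // (lt_trans e2e')).
    split => //; rewrite -mulNr /Q chart_funK //; apply: HQ.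
    by rewrite ger0_norm // (lt_trans se) // (lt_trans e2e').
exists J3; split.
- apply/(smooth_paramP hA); split => // t; apply: reg3.
  have [E|n1] := eqVneq (red (1 / 2) t) 0; first by right.
  left; apply: reg2; have [E|n0] := eqVneq (red 0 t) 0; first by right.
  by left; exact: Jreg.
- move=> _ [x _ <-]; case: (eq3 x) => [->|[[_ h] _]]; last by right.
  case: (eq2 x) => [->|[[_ h] _]]; last by right.
  have /andP[h1 h2] := red_itv 0 x; rewrite /J /G; case: (lerP 0 (red 0 x)) => h.
    left; exists (t0 + 2 * T * red 0 x) => //.
    by have /andP[-> /ltW ->] := time (s := red 0 x) ltac:(by rewrite h).
  have hs : - (1 / 2) <= red 0 x <= 0 by rewrite h1 ltW.
  right; have [k1 k2] := chart_imgP (img_line hs); split => //.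
  by rewrite k1; apply: le_lt_trans (line_in hs) _; case/andP: r12.
- move=> t /andP[h1 h2] nd.
  have ht : t < t1 by rewrite lt_neqAle h2 andbT; apply/eqP => E; apply: nd; rewrite E.
  pose s := (t - t0) / (2 * T).
  have hs : 0 <= s < 1 / 2.
    apply/andP; split; first by rewrite divr_ge0 ?subr_ge0 //; exact: ltW.
    rewrite ltr_pdivrMr //.
    have -> : 1 / 2 * (2 * T) = t1 - t0 by rewrite /T; field.
    by rewrite ltrD2r.
  have [Es _] := Jcorner0 hs.
  have Et : t0 + 2 * T * s = t by rewrite /s mulrC divfK ?lt0r_neq0 // addrC subrK.
  rewrite Et in Es; exists (0 + s) => //.
  have E2 : J2 (0 + s) = J (0 + s).
    by case: (eq2 (0 + s)) => // -[_ [_ h]]; exfalso; apply: nd; rewrite -Es.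
  case: (eq3 (0 + s)) => [->|[_ [_ h]]]; first by rewrite E2.
  by exfalso; apply: nd; rewrite -Es -E2.
Qed.

End ExcursionCurve.

(** * Stereographic parametrisation of a circle *)

Section Circle.
Context {R : realType}.
Local Notation plane := 'rV[R]_2.
Variable v : plane.
Hypothesis v0 : v != 0.

(** Stereographic parametrisation of the circle through [v] centred at the
    origin, missing the point [v]. *)
Definition stereo (t : R) : plane :=
  ((t ^+ 2 - 1) / (1 + t ^+ 2)) *: v + (2 * t / (1 + t ^+ 2)) *: perp v.

Definition unstereo (z : plane) : R := dot (perp v) z / (sq v - dot v z).

Lemma sq_stereo t : sq (stereo t) = sq v.
Proof.
have := den_neq0 t; rewrite /sq /dot /stereo !coordE => h.
by field.
Qed.

Lemma stereo_den t : sq v - dot v (stereo t) = 2 * sq v / (1 + t ^+ 2).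
Proof.
have := den_neq0 t; rewrite /sq /dot /stereo !coordE => h.
by field.
Qed.

Lemma stereo_den_neq0 t : sq v - dot v (stereo t) != 0.
Proof.
rewrite stereo_den mulf_neq0 ?invr_eq0 ?den_neq0 // mulf_neq0 ?pnatr_eq0 //.
by rewrite sq_eq0.
Qed.

Lemma stereoK : cancel stereo unstereo.
Proof.
move=> t; rewrite /unstereo stereo_den.
have -> : dot (perp v) (stereo t) = 2 * t * sq v / (1 + t ^+ 2).
  have := den_neq0 t; rewrite /sq /dot /stereo !coordE => h.
  by field.
have := den_neq0 t; have : sq v != 0 by rewrite sq_eq0.
by move=> h1 h2; field; rewrite ?h1 ?h2.
Qed.

Lemma unstereoK z : sq z = sq v -> z != v -> stereo (unstereo z) = z.
Proof.
move=> E zv.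
have d0 : sq v - dot v z != 0.
  apply: contra_neq zv => d0; apply/eqP; rewrite -subr_eq0 -sq_eq0.
  have -> : sq (z - v) = sq z + sq v - 2 * dot v z by rewrite /sq /dot !coordE; ring.
  have -> : dot v z = sq v by move: d0 => /subr0_eq.
  by rewrite E; apply/eqP; ring.
have s0 : sq v != 0 by rewrite sq_eq0.
pose p := dot (perp v) z; pose q := dot v z.
have pq : p ^+ 2 = (sq v - q) * (sq v + q).
  have : p ^+ 2 + q ^+ 2 = sq v * sq z by rewrite /p /q /sq /dot !coordE; ring.
  by rewrite E => h; rewrite -[p ^+ 2](addrK (q ^+ 2)) h; ring.
have den : 1 + (p / (sq v - q)) ^+ 2 = 2 * sq v / (sq v - q).
  by rewrite exprMn exprVn pq; field.
have c1 : ((p / (sq v - q)) ^+ 2 - 1) / (1 + (p / (sq v - q)) ^+ 2) = q / sq v.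
  rewrite den exprMn exprVn pq; field.
  by rewrite s0.
have c2 : 2 * (p / (sq v - q)) / (1 + (p / (sq v - q)) ^+ 2) = p / sq v.
  by rewrite den; field; rewrite s0.
rewrite /stereo /unstereo -/p -/q c1 c2.
have cancel_sq (a b : R) : sq v * b = a -> a / sq v = b.
  by move=> <-; rewrite mulrAC divff // mul1r.
apply: plane_eq; rewrite !coordE /p /q.
  transitivity ((dot v z * v 0 0 - dot (perp v) z * v 0 1) / sq v); first by field.
  by apply: cancel_sq; rewrite /sq /dot !coordE; ring.
transitivity ((dot v z * v 0 1 + dot (perp v) z * v 0 0) / sq v); first by field.
by apply: cancel_sq; rewrite /sq /dot !coordE; ring.
Qed.

Lemma smooth_stereo t : smooth_at stereo t.
Proof.
have st : smooth_at (fun t : R => t ^+ 2) t by apply: smooth_atM; exact: smooth_at_id.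
have sd : smooth_at (fun t : R => (1 + t ^+ 2)^-1) t.
  apply: smooth_atV; first exact: den_neq0.
  by apply: smooth_atD => //; exact: smooth_at_cst.
have -> : stereo = fun t => vec
   ((t ^+ 2 - 1) / (1 + t ^+ 2) * v 0 0 - 2 * t / (1 + t ^+ 2) * v 0 1)
   ((t ^+ 2 - 1) / (1 + t ^+ 2) * v 0 1 + 2 * t / (1 + t ^+ 2) * v 0 0).
  by apply/funext => s; apply: plane_eq; rewrite /stereo !coordE ?mulrN.
have s1 : smooth_at (fun t : R => (t ^+ 2 - 1) / (1 + t ^+ 2)) t.
  by apply: smooth_atM => //; apply: smooth_atB => //; exact: smooth_at_cst.
have s2 : smooth_at (fun t : R => 2 * t / (1 + t ^+ 2)) t.
  apply: smooth_atM => //; apply: smooth_atM; first exact: smooth_at_cst.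
  exact: smooth_at_id.
apply: smooth_at_vec.
  by apply: smooth_atB; apply: smooth_atM => //; exact: smooth_at_cst.
by apply: smooth_atD; apply: smooth_atM => //; exact: smooth_at_cst.
Qed.

Lemma smooth_unstereo z : sq v - dot v z != 0 -> smooth_at unstereo z.
Proof.
move=> h; apply: smooth_atM; first exact: smooth_dot.
apply: smooth_atV => //; apply: smooth_atB; first exact: smooth_at_cst.
exact: smooth_dot.
Qed.

(** [unstereo] is a smooth left inverse. *)
Lemma derive1_stereo t : derive1 stereo t != 0.
Proof.
apply/eqP => E.
have su := smooth_unstereo (stereo_den_neq0 t).
have D := derive1_chain (smooth_at_differentiable (smooth_stereo t)) (smooth_at_differentiable su).
have EI : unstereo \o stereo = id by apply/funext => s; exact: stereoK.
move: D; rewrite EI E linear0 derive1_id => /eqP.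
by rewrite oner_eq0.
Qed.

Lemma sq_stereo_sub t : sq (stereo t - v) = 4 * sq v / (1 + t ^+ 2).
Proof.
have := den_neq0 t; rewrite /sq /dot /stereo !coordE => h.
by field.
Qed.

Lemma stereo_neq t : stereo t != v.
Proof.
rewrite -subr_eq0 -sq_eq0 sq_stereo_sub mulf_neq0 ?invr_eq0 ?den_neq0 //.
by rewrite mulf_neq0 ?pnatr_eq0 // sq_eq0.
Qed.

Lemma stereo_far e : 0 < e -> exists2 M, 0 < M & forall t, M <= `|t| -> sq (stereo t - v) < e.
Proof.
move=> e0; have s0 := sq_gt0 v0.
exists (4 * sq v / e + 1); first by rewrite ltr_wpDl // divr_ge0 ?mulr_ge0 ?ltW.
move=> t ht; rewrite sq_stereo_sub ltr_pdivrMr; last by rewrite ltr_pwDl // sqr_ge0.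
have a0 : 0 <= 4 * sq v / e by rewrite divr_ge0 ?mulr_ge0 ?ltW.
have Ea : e * (4 * sq v / e) = 4 * sq v by field; rewrite gt_eqF.
rewrite -[X in X < _]Ea ltr_pM2l // -(real_normK (num_real t)).
move: ht a0; set a := _ / e; set b := `|t|; move=> ht a0.
by nra.
Qed.

End Circle.

(** * Subdivisions of a segment, and circles in a chart *)

Section LineTopology.
Context {R : realType}.

(** Compactness of the segment, in the form of a subdivision argument. *)
Lemma segment_glue (Pi : R -> R -> Prop) :
  (forall t, exists2 e, 0 < e & forall a b, t - e < a -> a <= b -> b < t + e -> Pi a b) ->
  (forall a b c, a <= b -> b <= c -> Pi a b -> Pi b c -> Pi a c) ->
  forall a b, a <= b -> Pi a b.
Proof.
move=> loc glue a b ab.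
suff H : forall t, a <= t <= b -> forall s, a <= s <= t -> Pi a s.
  by apply: (H b); rewrite ?ab ?lexx.
apply: (connected_ind (@connected_cc R a b)).
- exists a; first by rewrite /= lexx.
  move=> s /andP[h1 h2]; have -> : s = a by apply/eqP; rewrite eq_le h2.
  have [e e0 He] := loc a.
  by apply: He => //; [rewrite gtrBl|rewrite ltrDl].
- move=> t /andP[at_ tb] Pt; have [e e0 He] := loc t.
  apply: filterS (line_nbhs t e0) => y hy /andP[ay yb] s /andP[h1 h2].
  have [st|ts] := lerP s t; first by apply: Pt; rewrite h1.
  apply: (glue _ t) => //; [exact: ltW|by apply: Pt; rewrite at_ lexx|].
  apply: He; [by rewrite gtrBl|exact: ltW|].
  by move: hy; rewrite /= ltr_distl => /andP[_]; exact: le_lt_trans.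
- move=> t /andP[at_ tb] nPt; have [e e0 He] := loc t.
  apply: filterS (line_nbhs t e0) => y hy /andP[ay yb] Py; apply: nPt => s /andP[h1 h2].
  have [sy|ys] := lerP s y; first by apply: Py; rewrite h1.
  apply: (glue _ y) => //; [exact: ltW|by apply: Py; rewrite ay lexx|].
  apply: He; [by move: hy; rewrite /= ltr_distl => /andP[]|exact: ltW|].
  by apply: le_lt_trans h2 _; rewrite ltrDl.
Qed.

(** The bounded component of the complement of [E] around [y]. *)
Lemma gap_ends (E : set R) (y a b : R) : closed E -> ~ E y -> a <= y -> y <= b ->
  E a -> E b -> exists y0 y1, [/\ y0 < y < y1, E y0, E y1, a <= y0 /\ y1 <= b &
    forall t, y0 < t < y1 -> ~ E t].
Proof.
move=> cE nEy ay yb Ea Eb.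
have max x0 x1 : x0 <= x1 -> E x0 -> exists2 m, (E m /\ x0 <= m <= x1) &
    forall t, E t -> x0 <= t <= x1 -> t <= m.
  move=> x01 Ex; have K : compact (E `&` `[x0, x1]%classic).
    by rewrite setIC; apply: compact_closedI => //; exact: segment_compact.
  have [||m [/set_mem[Em Hm] Hmax]] := @compact_EVT_max R R id (E `&` `[x0, x1]%classic) _ K.
  - by exists x0; split => //=; rewrite in_itv /= lexx.
  - by apply: continuous_subspaceT => x; exact: cvg_id.
  exists m; first by split => //; move: Hm; rewrite /= in_itv.
  by move=> t Et ht; apply: Hmax; rewrite inE; split => //=; rewrite in_itv.
have min x0 x1 : x0 <= x1 -> E x1 -> exists2 m, (E m /\ x0 <= m <= x1) &
    forall t, E t -> x0 <= t <= x1 -> m <= t.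
  move=> x01 Ex; have K : compact (E `&` `[x0, x1]%classic).
    by rewrite setIC; apply: compact_closedI => //; exact: segment_compact.
  have [||m [/set_mem[Em Hm] Hmin]] := @compact_EVT_min R R id (E `&` `[x0, x1]%classic) _ K.
  - by exists x1; split => //=; rewrite in_itv /= lexx andbT.
  - by apply: continuous_subspaceT => x; exact: cvg_id.
  exists m; first by split => //; move: Hm; rewrite /= in_itv.
  by move=> t Et ht; apply: Hmin; rewrite inE; split => //=; rewrite in_itv.
have [y0 [Ey0 /andP[h1 h2]] H0] := max a y ay Ea.
have [y1 [Ey1 /andP[h3 h4]] H1] := min y b yb Eb.
have n0 : y0 < y by rewrite lt_neqAle h2 andbT; apply/eqP => e; apply: nEy; rewrite -e.
have n1 : y < y1 by rewrite lt_neqAle h3 andbT; apply/eqP => e; apply: nEy; rewrite e.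
exists y0, y1; split => //; first by rewrite n0.
move=> t /andP[t0 t1] Et; have [ty|yt] := lerP t y.
  have := H0 t Et; rewrite ty (le_trans h1 (ltW t0)) => /(_ isT).
  by rewrite leNgt t0.
have := H1 t Et; rewrite (ltW yt) (le_trans (ltW t1) h4) => /(_ isT).
by rewrite leNgt t1.
Qed.

(** Disjoint closed sets alternate only finitely often on a segment, each point
    having a neighbourhood that misses one of them. Breaks are the subdivision
    points lying in neither set. *)
Lemma breaks (X Y : set R) (a b : R) : closed X -> closed Y -> X `&` Y = set0 -> a <= b ->
  exists F : seq R, (forall f, f \in F -> ~ X f /\ ~ Y f) /\
   forall x y, a <= x -> x < y -> y <= b -> (X x /\ Y y) \/ (Y x /\ X y) ->
     exists2 f, f \in F & x < f < y.
Proof.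
move=> cX cY XY; have dis x : X x -> Y x -> False.
  by move=> Xx Yx; have : (X `&` Y) x by []; rewrite XY.
pose Pi a b := exists F : seq R, (forall f, f \in F -> ~ X f /\ ~ Y f) /\
   forall x y, a <= x -> x < y -> y <= b -> (X x /\ Y y) \/ (Y x /\ X y) ->
     exists2 f, f \in F & x < f < y.
apply: (segment_glue (Pi := Pi)) => [t|{}a {}b c ab bc [F1 [N1 H1]] [F2 [N2 H2]]].
  have [nX|nY] : ~ X t \/ ~ Y t.
  - by have [Xt|] := pselect (X t); [right=> Yt; exact: (dis t)|left].
  - have [e e0 He] := nbhs_line (open_nbhs_nbhs (conj (closed_openC cX) nX)).
    exists e => // a' b' h1 h2 h3; exists [::]; split => // x y ax xy yb H.
    have hx : ~ X x by apply: He; rewrite ltr_distl; apply/andP; split; lra.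
    have hy : ~ X y by apply: He; rewrite ltr_distl; apply/andP; split; lra.
    by case: H => [[]|[]].
  have [e e0 He] := nbhs_line (open_nbhs_nbhs (conj (closed_openC cY) nY)).
  exists e => // a' b' h1 h2 h3; exists [::]; split => // x y ax xy yb H.
  have hx : ~ Y x by apply: He; rewrite ltr_distl; apply/andP; split; lra.
  have hy : ~ Y y by apply: He; rewrite ltr_distl; apply/andP; split; lra.
  by case: H => [[]|[]].
pose F0 := if `[< X b \/ Y b >] then [::] else [:: b].
exists (F0 ++ F1 ++ F2); split.
  move=> f; rewrite !mem_cat /F0 => /or3P[|/N1//|/N2//].
  case: asboolP => // /not_orP nb; rewrite inE => /eqP ->; exact: nb.
move=> x y ax xy yc H.
have sub1 f : f \in F1 -> f \in F0 ++ F1 ++ F2 by rewrite !mem_cat => ->; rewrite orbT.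
have sub2 f : f \in F2 -> f \in F0 ++ F1 ++ F2 by rewrite !mem_cat => ->; rewrite !orbT.
have [yb|by_] := lerP y b.
  by have [f /sub1 hf h] := H1 x y ax xy yb H; exists f.
have [bx|xb] := lerP b x.
  by have [f /sub2 hf h] := H2 x y bx xy yc H; exists f.
have [hb|nb] := pselect (X b \/ Y b); last first.
  exists b; last by rewrite xb.
  by rewrite mem_cat /F0; case: asboolP => // _; rewrite inE eqxx.
have left_ : (X x /\ Y b) \/ (Y x /\ X b) -> exists2 f, f \in F0 ++ F1 ++ F2 & x < f < y.
  move=> H'; have [f /sub1 hf /andP[f1 f2]] := H1 x b ax xb (lexx b) H'.
  by exists f; rewrite ?f1 ?(lt_trans f2).
have right_ : (X b /\ Y y) \/ (Y b /\ X y) -> exists2 f, f \in F0 ++ F1 ++ F2 & x < f < y.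
  move=> H'; have [f /sub2 hf /andP[f1 f2]] := H2 b y (lexx b) by_ yc H'.
  by exists f; rewrite ?f2 ?andbT ?(lt_trans xb).
case: H => [[Xx Yy]|[Yx Xy]]; case: hb => [Xb|Yb].
- by apply: right_; left.
- by apply: left_; left.
- by apply: left_; right.
- by apply: right_; right.
Qed.

End LineTopology.

Section CircleInChart.
Context {R : realType} {S : topologicalType}.
Local Notation plane := 'rV[R]_2.
Context (A : set (chart R S)) (hA : smooth_surface A).

Definition cdisc (c : chart R S) (z0 : plane) (r : R) :=
  [set x | chart_dom c x /\ sq (chart_fun c x - z0) <= r].
Definition circle (c : chart R S) (z0 : plane) (r : R) :=
  [set x | chart_dom c x /\ sq (chart_fun c x - z0) = r].

Variables (c : chart R S) (z0 : plane) (r : R).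
Hypotheses (Ac : A c) (r0 : 0 < r)
  (Hball : forall z, sq (z - z0) <= r -> (chart_fun c @` chart_dom c) z).

Lemma closed_cdisc : closed (cdisc c z0 r).
Proof.
have -> : cdisc c z0 r = chart_inv c @` [set z | sq (z - z0) <= r].
  apply/seteqP; split=> [x [cx hx]|_ [z hz <-]].
    by exists (chart_fun c x) => //; rewrite chart_funK.
  by have [e1 e2] := chart_imgP (Hball hz); split; rewrite ?e1.
apply: compact_closed; first by case: hA.
apply: continuous_compact; last exact: compact_disc.
apply: continuous_in_subspaceT => z; rewrite inE => /Hball; exact: chart_inv_continuous.
Qed.

Lemma disc_ext : disc c z0 r `&` ~` cdisc c z0 r = set0.
Proof.
by apply/seteqP; split=> // x [[cx /ltW hx] nx]; apply: nx.
Qed.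

Lemma circle_compl x : ~ circle c z0 r x -> (disc c z0 r `|` ~` cdisc c z0 r) x.
Proof.
move=> nC; have [[cx hx]|nx] := pselect (cdisc c z0 r x); last by right.
left; split => //; rewrite lt_neqAle hx andbT; apply/eqP => E.
by apply: nC.
Qed.

Lemma disc_not_circle x : disc c z0 r x -> ~ circle c z0 r x.
Proof. by move=> [_ h] [_ E]; move: h; rewrite E ltxx. Qed.

Lemma ext_not_circle x : (~` cdisc c z0 r) x -> ~ circle c z0 r x.
Proof. by move=> nx [cx E]; apply: nx; split; rewrite ?E. Qed.

(** The radial line through the point enters the disc on one side and leaves it
    on the other. *)
Lemma circle_closure z : circle c z0 r z ->
  closure (disc c z0 r) z /\ closure (~` cdisc c z0 r) z.
Proof.
move=> [cz Ez]; pose k := (fun s : R => z0 + s *: (chart_fun c z - z0)).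
have k1 : k 1 = chart_fun c z by rewrite /k scale1r addrC subrK.
have [sk _] := smooth_line z0 (chart_fun c z - z0) (1 : R).
have Ek s : sq (k s - z0) = s ^+ 2 * r.
  by rewrite /k addrAC subrr add0r sqZ Ez.
have ck : {for (1 : R), continuous (fun s => chart_inv c (k s))}.
  apply: (continuous_comp (f := k)); first exact: (smooth_at_continuous sk).
  by rewrite k1; apply: chart_inv_continuous; exact: chart_img.
have ik : nbhs (1 : R) (k @^-1` (chart_fun c @` chart_dom c)).
  by apply: (smooth_at_continuous sk); rewrite -/(k 1) k1; exact: chart_img_nbhs.
have ck1 : chart_inv c (k 1) = z by rewrite k1 chart_funK.
split=> V HV.
  have NV : nbhs (1 : R) ((fun s => chart_inv c (k s)) @^-1` V) by apply: ck; rewrite ck1.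
  have [e e0 He] := nbhs_line (filterI NV ik).
  have [h [h0 he h1]] := small_pos e0 (ltr01 : 0 < (1 : R)).
  have [Vk /chart_imgP[i1 i2]] := He (1 - h) ltac:(by rewrite addrAC subrr add0r normrN gtr0_norm).
  exists (chart_inv c (k (1 - h))); split => //; split => //.
  rewrite i1 Ek gtr_pMl // expr_lt1 ?subr_ge0 ?(ltW h1) //.
  by rewrite gtrBl.
have NV : nbhs (1 : R) ((fun s => chart_inv c (k s)) @^-1` V) by apply: ck; rewrite ck1.
have [e e0 He] := nbhs_line (filterI NV ik).
have [h [h0 he h1]] := small_pos e0 (ltr01 : 0 < (1 : R)).
have [Vk /chart_imgP[i1 i2]] := He (1 + h) ltac:(by rewrite addrAC subrr add0r gtr0_norm).
exists (chart_inv c (k (1 + h))); split => // -[_].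
have h2 : 1 < (1 + h) ^+ 2 by rewrite exprn_egt1 // ltrDl.
by rewrite i1 Ek leNgt ltr_pMl // h2.
Qed.

Section Param.
Variable v : plane.
Hypothesis Ev : sq v = r.

Definition cparam (t : R) : S := chart_inv c (z0 + stereo v t).

Lemma v_neq0 : v != 0.
Proof. by rewrite -sq_eq0 Ev gt_eqF. Qed.

Lemma cparam_img t : (chart_fun c @` chart_dom c) (z0 + stereo v t).
Proof. by apply: Hball; rewrite addrAC subrr add0r sq_stereo ?v_neq0 // Ev. Qed.

Lemma cparam_chart t : chart_dom c (cparam t) /\ chart_fun c (cparam t) = z0 + stereo v t.
Proof. by have [] := chart_imgP (cparam_img t). Qed.

Lemma cparam_circle t : circle c z0 r (cparam t).
Proof.
have [h1 h2] := cparam_chart t; split => //.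
by rewrite h2 addrAC subrr add0r sq_stereo ?v_neq0.
Qed.

Lemma cparam_inj : injective cparam.
Proof.
move=> s t E; have [_ h1] := cparam_chart s; have [_ h2] := cparam_chart t.
move: h1; rewrite E h2 => /addrI /(congr1 (unstereo v)).
by rewrite !stereoK ?v_neq0.
Qed.

Lemma cparam_regular t : regular_at A cparam t.
Proof.
have st := smooth_stereo v t.
have sk : smooth_at (fun t => z0 + stereo v t) t.
  by apply: smooth_atD => //; exact: smooth_at_cst.
apply: (regular_plane Ac sk); last exact: cparam_img.
have dst := derivableP ((derivable1_diffP _ _).2 (smooth_at_differentiable st)).
have [_ E] := is_deriveD (is_derive_cst z0 t (1 : R)) dst.
have -> : derive1 (fun t => z0 + stereo v t) t = derive1 (stereo v) t.
  by rewrite !derive1E; move: E; rewrite add0r.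
exact: derive1_stereo v_neq0 t.
Qed.

Lemma cparam_continuous : continuous cparam.
Proof. by move=> t; have [] := cparam_regular t. Qed.

Lemma cparam_onto x : circle c z0 r x -> x != chart_inv c (z0 + v) ->
  x = cparam (unstereo v (chart_fun c x - z0)).
Proof.
move=> [cx Ex] nx; rewrite /cparam unstereoK ?v_neq0 //.
- by rewrite addrC subrK chart_funK.
- by rewrite Ex Ev.
- apply: contra_neq nx => E; rewrite -(chart_funK cx); congr chart_inv.
  by rewrite -E addrC subrK.
Qed.

Lemma cparam_far (N : set S) : nbhs (chart_inv c (z0 + v)) N ->
  exists2 M, 0 < M & forall t, M <= `|t| -> N (cparam t).
Proof.
move=> HN; have hi : (chart_fun c @` chart_dom c) (z0 + v).
  by apply: Hball; rewrite addrAC subrr add0r Ev.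
have [i1 i2] := chart_imgP hi.
have := near_chart_inv i2 HN; rewrite i1 => /disc_nbhs[e e0 He].
have [M M0 HM] := stereo_far v_neq0 e0.
exists M => // t /HM h; apply: He.
by rewrite opprD addrACA subrr add0r.
Qed.

(** [unstereo] is continuous off the missing point, so the parameter depends
    continuously on the point of the circle. *)
Lemma cparam_near t (N : set R) : nbhs t N ->
  \forall x \near cparam t, circle c z0 r x -> exists2 s, N s & x = cparam s.
Proof.
move=> HN; have [ct Et] := cparam_chart t.
have den : sq v - dot v (chart_fun c (cparam t) - z0) != 0.
  by rewrite Et (_ : z0 + _ - z0 = stereo v t); [exact: (stereo_den_neq0 v_neq0)|rewrite addrAC subrr add0r].
have cu : {for cparam t, continuous (fun x => unstereo v (chart_fun c x - z0))}.
  apply: (continuous_comp (f := fun x => chart_fun c x - z0) (g := unstereo v)).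
    by apply: cvgB; [exact: chart_fun_continuous|exact: cvg_cst].
  exact: (smooth_at_continuous (smooth_unstereo den)).
have N1 : nbhs (cparam t) ((fun x => unstereo v (chart_fun c x - z0)) @^-1` N).
  apply: cu; rewrite Et (_ : z0 + _ - z0 = stereo v t); last by rewrite addrAC subrr add0r.
  by rewrite stereoK ?v_neq0.
have N2 : nbhs (cparam t) (~` [set chart_inv c (z0 + v)]).
  apply: open_nbhs_nbhs; split.
    apply/closed_openC/accessible_closed_set1/hausdorff_accessible; by case: hA.
  move=> /= E; have := stereo_neq v_neq0 t; apply/negP/negPn/eqP/(addrI z0).
  have hi : (chart_fun c @` chart_dom c) (z0 + v).
    by apply: Hball; rewrite addrAC subrr add0r Ev.
  by rewrite -Et E; have [] := chart_imgP hi.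
apply: filterS2 N1 N2 => x h1 h2 Cx.
exists (unstereo v (chart_fun c x - z0)) => //.
by apply: cparam_onto => //; apply/eqP.
Qed.

End Param.

(** Two stereographic parametrisations with opposite missing points cover the
    circle. *)
Lemma connected_circle (v : plane) : sq v = r -> connected (circle c z0 r).
Proof.
move=> Ev; have EvN : sq (- v) = r by rewrite sqN.
have v0 := v_neq0 Ev.
have cr u (Eu : sq u = r) : connected (range (cparam u)).
  by apply: connected_curve; exact: cparam_continuous.
have -> : circle c z0 r = range (cparam v) `|` range (cparam (- v)).
  apply/seteqP; split=> [x Cx|x [[t _ <-]|[t _ <-]]]; last 2 first.
  - exact: cparam_circle.
  - exact: cparam_circle.
  have [E|n] := eqVneq x (chart_inv c (z0 + v)); last first.
    by left; rewrite (cparam_onto Ev Cx n); exists (unstereo v (chart_fun c x - z0)).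
  right; have n : x != chart_inv c (z0 - v).
    rewrite E; apply/eqP => /(congr1 (chart_fun c)).
    have i1 : (chart_fun c @` chart_dom c) (z0 + v).
      by apply: Hball; rewrite addrAC subrr add0r Ev.
    have i2 : (chart_fun c @` chart_dom c) (z0 - v).
      by apply: Hball; rewrite addrAC subrr add0r EvN.
    have [-> _] := chart_imgP i1; have [-> _] := chart_imgP i2.
    move=> /addrI/eqP; rewrite -subr_eq0 opprK -mulr2n -scaler_nat scaler_eq0 pnatr_eq0 /=.
    by rewrite (negbTE v0).
  by rewrite (cparam_onto EvN Cx n); exists (unstereo (- v) (chart_fun c x - z0)).
apply: connectedU; [|exact: cr|exact: cr].
have E1 : stereo v 1 = perp v.
  by rewrite /stereo; apply: plane_eq; rewrite !coordE; field.
have E2 : stereo (- v) (-1) = perp v.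
  by rewrite /stereo; apply: plane_eq; rewrite !coordE; field.
exists (chart_inv c (z0 + perp v)); split.
  by exists 1 => //; rewrite /cparam E1.
by exists (-1) => //; rewrite /cparam E2.
Qed.

End CircleInChart.

(** * Colourings across an arc of a circle *)

Lemma int_half (R : realType) (s s' : R) (n : int) : 0 <= s -> s <= 1 / 2 ->
  1 / 2 <= s' -> s' <= 1 -> s' = s + n%:~R -> n = 0 \/ n = 1.
Proof.
move=> h1 h2 h3 h4 E.
have b1 : (-1 < n)%R by rewrite -(ltr_int R) rmorphN /=; lra.
have b2 : (n < 2)%R by rewrite -(ltr_int R); lra.
by clear -b1 b2; lia.
Qed.

Section Coloring.
Context {R : realType} {S : topologicalType}.
Local Notation plane := 'rV[R]_2.
Context (A : set (chart R S)) (hA : smooth_surface A) (hconn : connected [set: S]).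
Variables (g : R -> S).
Hypotheses (scg : simple_closed_param g)
  (Hsep : forall b, smooth_param A b -> ~ nonseparating (range b)).

Let W : set S := ~` range g.
Let p := g 0.
Let q := g (1 / 2).
Let arc1 := g @` [set s | 0 <= s <= 1 / 2].
Let arc2 := g @` [set s | 1 / 2 <= s <= 1].

Let oW : open W. Proof. exact/closed_openC/(closed_curve hA). Qed.

Lemma arc1_conn : connected arc1.
Proof. by apply: connected_image; [exact: connected_cc|move=> x _; have [cg _] := scg; exact: cg]. Qed.

Lemma arc2_conn : connected arc2.
Proof. by apply: connected_image; [exact: connected_cc|move=> x _; have [cg _] := scg; exact: cg]. Qed.

Lemma arc1_ends : arc1 p /\ arc1 q.
Proof.
split; first by exists 0; rewrite //= lexx divr_ge0.
by exists (1 / 2); rewrite //= lexx divr_ge0.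
Qed.

Lemma arc2_ends : arc2 p /\ arc2 q.
Proof.
have h : (1 / 2 : R) <= 1 by lra.
split; last by exists (1 / 2); rewrite //= lexx.
exists 1; first by rewrite /= h lexx.
by have [_ ->] := scg; exists 1; rewrite add0r.
Qed.

Lemma arcs_cover x : range g x -> arc1 x \/ arc2 x.
Proof.
move=> [s _ <-]; have [s' [/andP[h1 h2] <-]] := param_shift 0 s scg.
have [h|h] := lerP s' (1 / 2); [left|right]; exists s' => //=.
  by rewrite h1.
by rewrite ltW //= ltW //; rewrite add0r in h2.
Qed.

Lemma arcs_sub : arc1 `<=` range g /\ arc2 `<=` range g.
Proof. by split=> _ [s _ <-]; exists s. Qed.

Lemma arcs_meet x : arc1 x -> arc2 x -> x = p \/ x = q.
Proof.
move=> [s /andP[h1 h2] <-] [s' /andP[h3 h4] E]; have [_ ig] := scg.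
have [n En] := (ig s' s).1 E.
have [n0|n1] : n = 0 \/ n = 1.
- exact: (int_half h1 h2 h3 h4 En).
- right; congr g; rewrite n0 addr0 in En.
  by apply/eqP; rewrite eq_le h2 -En.
left; congr g; rewrite n1 in En; apply/eqP; rewrite eq_le h1 andbT.
by rewrite -(lerD2r 1) add0r -[X in _ + X]/(1%:~R) -En.
Qed.

Variables (c : chart R S) (z0 : plane) (r : R) (v : plane).
Hypotheses (Ac : A c) (r0 : 0 < r) (Ev : sq v = r)
  (Hball : forall z, sq (z - z0) <= r -> (chart_fun c @` chart_dom c) z)
  (pD : disc c z0 r p) (qD : ~ cdisc c z0 r q).

Let C := circle c z0 r.
Let D := disc c z0 r.
Let Ext := ~` cdisc c z0 r.
Let tau := cparam c z0 v.
Let oD : open D. Proof. exact: disc_open. Qed.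
Let oE : open Ext. Proof. exact/closed_openC/(closed_cdisc hA). Qed.
Let DE : D `&` Ext = set0. Proof. exact: disc_ext. Qed.
Let ctau : continuous tau. Proof. exact: (cparam_continuous Ac r0 Hball Ev). Qed.
Let itau : injective tau. Proof. exact: (cparam_inj r0 Hball Ev). Qed.
Let tauC t : C (tau t). Proof. exact: (cparam_circle Hball Ev). Qed.

(** Otherwise [Z] would be split between the disc and its exterior. *)
Lemma arc_crosses (Z : set S) : connected Z -> Z p -> Z q -> exists2 x, Z x & C x.
Proof.
move=> cZ Zp Zq; apply: contrapT => nx.
have sub : Z `<=` D `|` Ext.
  by move=> x Zx; apply: circle_compl => Cx; apply: nx; exists x.
have [ZD|ZE] := connected_split cZ sub oD oE DE.
  by have [cq hq] := ZD q Zq; apply: qD; split => //; exact: ltW.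
by apply: (ZE p Zp); have [cp hp] := pD; split => //; exact: ltW.
Qed.

Definition tauab (a b : R) : set S := tau @` [set t | a <= t <= b].

(** Colourings of the points off the circle which, along [g], change exactly
    across the arc [tauab a b] of the circle. The points [p] and [q] are the
    common ends of the two arcs of [g]; asking for equal colours there is what a
    colouring for the whole circle contradicts ([no_full_coloring]). *)
Definition col (a b : R) := exists s : S -> bool, s p = s q /\
  forall z, range g z -> exists k : bool, \forall x \near z, ~ C x ->
    s x = k (+) (`[< tauab a b z >] && `[< D x >]).

Lemma col_local a b : (forall t, a <= t <= b -> W (tau t)) -> col a b.
Proof.
move=> HW; exists (fun=> false); split => // z gz; exists false.
apply: filterE => x _; case: asboolP => // -[t ht Et].
by exfalso; apply: (HW t ht); rewrite Et.
Qed.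

(** Colourings are added modulo 2. The common end of the two arcs being off [g],
    no point of [g] is counted twice. *)
Lemma col_glue a b e : a <= b -> b <= e -> W (tau b) -> col a b -> col b e -> col a e.
Proof.
move=> ab be Wb [s1 [E1 H1]] [s2 [E2 H2]].
exists (fun x => s1 x (+) s2 x); split; first by rewrite E1 E2.
move=> z gz; have [k1 N1] := H1 z gz; have [k2 N2] := H2 z gz.
exists (k1 (+) k2); apply: filterS2 N1 N2 => x h1 h2 nC; rewrite h1 // h2 //.
have -> : `[< tauab a e z >] = `[< tauab a b z >] (+) `[< tauab b e z >].
  case: (asboolP (tauab a b z)) => [[t ht Et]|n1]; case: (asboolP (tauab b e z)) => [[t' ht' Et']|n2] /=.
  - exfalso; have tt' : t = t' by apply: itau; rewrite Et Et'.
    have tb : t = b.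
      by apply/eqP; rewrite eq_le; case/andP: ht => _ ->; rewrite tt'; case/andP: ht'.
    by apply: Wb; rewrite -tb Et.
  - apply/asboolP; exists t => //; case/andP: ht => h3 h4; apply/andP; split => //; exact: le_trans be.
  - apply/asboolP; exists t' => //; case/andP: ht' => h3 h4; apply/andP; split => //; exact: le_trans h3.
  - apply/asboolP => -[t /andP[h3 h4] Et].
    have [tb|bt] := lerP t b; [apply: n1|apply: n2]; exists t => //=.
      by rewrite h3.
    by rewrite (ltW bt).
by clear; case: k1; case: k2; case: `[< tauab a b z >]; case: `[< tauab b e z >]; case: `[< D x >].
Qed.

Variables (d : chart R S) (w : plane) (r1 r2 : R).
Hypotheses (Ad : A d) (r12 : 0 < r1 < r2)
  (Hd : forall z, sq (z - w) <= r2 -> (chart_fun d @` chart_dom d) z)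
  (HW : cdisc d w r2 `<=` W).

Let discW : disc d w r2 `<=` W.
Proof. by move=> x [dx hx]; apply: HW; split => //; exact: ltW. Qed.

(** The curve made of the excursion and of a path in the disc separates, and the
    colour of a point tells on which side of it the point lies. The disc being
    off [g], the curve seen from [g] is just the excursion, and near an interior
    point of the excursion its two sides are those of the circle. The arc of [g]
    missed by the excursion joins [p] to [q] on one side. *)
Lemma col_excursion (t0 t1 : R) : t0 < t1 ->
  chart_dom d (tau t0) -> sq (chart_fun d (tau t0) - w) = r1 ->
  chart_dom d (tau t1) -> sq (chart_fun d (tau t1) - w) = r1 ->
  (forall t, t0 < t < t1 -> ~ cdisc d w r1 (tau t)) ->
  (forall t, t0 <= t <= t1 -> ~ arc1 (tau t)) \/ (forall t, t0 <= t <= t1 -> ~ arc2 (tau t)) ->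
  col t0 t1.
Proof.
move=> t01 d0 q0 d1 q1 out miss.
have rtau t : regular_at A tau t by exact: (cparam_regular Ac r0 Hball Ev).
have [b [sb rb br]] := excursion_curve hA ctau itau rtau Ad r12 Hd t01 d0 q0 d1 q1 out.
have [U [V [oU oV UV UVE cl]]] := separating_sides hA hconn sb (Hsep sb).
have bg z : range g z -> range b z -> tauab t0 t1 z.
  move=> gz /rb[[t ht ->]|/discW//]; by exists t.
have gb z : range g z -> tauab t0 t1 z -> range b z.
  move=> gz [t ht Et]; rewrite -Et; apply: br => // /discW; rewrite Et; exact.
have dUV x : U x -> ~ V x by move=> Ux Vx; have : (U `&` V) x by []; rewrite UV.
exists (fun x => `[< U x >]); split.
  have side (Z : set S) : Z `<=` range g -> connected Z -> Z p -> Z q ->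
     (forall t, t0 <= t <= t1 -> ~ Z (tau t)) -> `[< U p >] = `[< U q >].
    move=> Zg cZ Zp Zq nZ.
    have sub : Z `<=` U `|` V.
      rewrite UVE => x Zx bx; have [t ht Et] := bg x (Zg x Zx) bx.
      by apply: (nZ t ht); rewrite Et.
    have [ZU|ZV] := connected_split cZ sub oU oV UV.
      by rewrite !asboolT //; exact: ZU.
    by rewrite !asboolF // => Ux; [apply: (dUV q Ux)|apply: (dUV p Ux)]; exact: ZV.
  have [s1 s2] := arcs_sub; have [p1 q1'] := arc1_ends; have [p2 q2'] := arc2_ends.
  case: miss => nZ; first exact: (side arc1 s1 arc1_conn).
  exact: (side arc2 s2 arc2_conn).
move=> z gz; have [tz|ntz] := pselect (tauab t0 t1 z); last first.
  have nbz : (U `|` V) z by rewrite UVE => bz; apply: ntz; exact: bg.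
  rewrite asboolF //=; case: nbz => [Uz|Vz].
    exists true; apply: filterS (open_nbhs_nbhs (conj oU Uz)) => x Ux _.
    by rewrite asboolT.
  exists false; apply: filterS (open_nbhs_nbhs (conj oV Vz)) => x Vx _.
  by rewrite asboolF // => Ux; exact: (dUV x).
rewrite asboolT //=.
have bz := gb z gz tz; have [t /andP[ht0 ht1] Et] := tz.
have nW : ~ W z by apply.
have ht : t0 < t < t1.
  have nd t' : chart_dom d (tau t') -> sq (chart_fun d (tau t') - w) = r1 -> W (tau t').
    by move=> h1 h2; apply: discW; split => //; rewrite h2; case/andP: r12.
  rewrite !lt_neqAle ht0 ht1 !andbT; apply/andP; split; apply/eqP => e; apply: nW.
    by rewrite -Et -e; exact: nd.
  by rewrite -Et e; exact: nd.
(* Near [z], which is far from the disc, the curve coincides with the circle. *)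
have N1 : nbhs z (~` cdisc d w r2).
  apply: open_nbhs_nbhs; split; first exact/closed_openC/(closed_cdisc hA).
  by move=> /HW.
have ht' : nbhs t [set s | t0 < s < t1].
  have : nbhs t `]t0, t1[%classic by apply: near_in_itvoo; rewrite in_itv.
  by apply: filterS => s /=; rewrite in_itv.
have N2 := cparam_near hA r0 Hball Ev ht'; rewrite -/tau Et in N2.
have [tb _ Etb] := bz.
have Nbz : nbhs (b tb) [set x | range b x <-> C x].
  rewrite Etb; apply: filterS2 N1 N2 => x n1 n2; split=> [/rb[[t' h' ->]|[dx hx]]|/n2[t' /andP[h1 h2] Ex]].
  - exact: tauC.
  - by exfalso; apply: n1; split => //; exact: ltW.
  - rewrite Ex; apply: br; first by rewrite !ltW.
    by rewrite -/tau -Ex => -[dx hx]; apply: n1; split => //; exact: ltW.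
have [N [P [Q [NN [cP cQ] [PN QN] NPQ clo]]]] := sides hA sb Nbz.
rewrite Etb in NN Nbz.
have offC Z : Z `<=` [set x | range b x <-> C x] `\` range b -> Z `<=` D `|` Ext.
  by move=> ZN x /ZN[/= H nb]; apply: circle_compl => Cx; apply: nb; exact/H.
have offb Z : Z `<=` [set x | range b x <-> C x] `\` range b -> Z `<=` U `|` V.
  by move=> ZN x /ZN[_ nb]; rewrite UVE.
have Cz : C z by rewrite -Et; exact: tauC.
have Nz : nbhs z (N `&` [set x | range b x <-> C x]) by exact: filterI.
have flip (X Y : set S) : X `&` Y = set0 -> P `<=` X \/ P `<=` Y -> Q `<=` X \/ Q `<=` Y ->
    (exists2 x, X x & (P `|` Q) x) -> (exists2 y, Y y & (P `|` Q) y) ->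
    (P `<=` X /\ Q `<=` Y) \/ (P `<=` Y /\ Q `<=` X).
  move=> XY hP hQ [x Xx PQx] [y Yy PQy].
  have dXY u : X u -> Y u -> False by move=> h1 h2; have : (X `&` Y) u by []; rewrite XY.
  case: hP => hP; case: hQ => hQ; [|by left|by right|]; exfalso.
    by case: PQy => [/hP|/hQ] h; exact: (dXY y).
  by case: PQx => [/hP|/hQ] h; exact: (dXY x).
have [cU cV] := cl z bz.
have [cD cE] := circle_closure r0 Cz.
have notb x : U x \/ V x -> ~ range b x.
  by move=> h; rewrite -[~ _]/((~` range b) x) -UVE.
have FU : (P `<=` U /\ Q `<=` V) \/ (P `<=` V /\ Q `<=` U).
  apply: flip => //.
  - exact: (connected_split cP (offb P PN) oU oV UV).
  - exact: (connected_split cQ (offb Q QN) oU oV UV).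
  - have [x [Ux Nx]] := cU N NN; exists x => //; apply: NPQ; split => //.
    by apply: notb; left.
  - have [x [Vx Nx]] := cV N NN; exists x => //; apply: NPQ; split => //.
    by apply: notb; right.
have FD : (P `<=` D /\ Q `<=` Ext) \/ (P `<=` Ext /\ Q `<=` D).
  apply: flip => //.
  - exact: (connected_split cP (offC P PN) oD oE DE).
  - exact: (connected_split cQ (offC Q QN) oD oE DE).
  - have [x [Dx [Nx bC]]] := cD _ Nz; exists x => //; apply: NPQ; split => // /bC.
    exact: disc_not_circle.
  - have [x [Ex [Nx bC]]] := cE _ Nz; exists x => //; apply: NPQ; split => // /bC.
    exact: ext_not_circle.
have sV (Z : set S) : Z `<=` V -> forall x, Z x -> `[< U x >] = false.
  by move=> ZV x /ZV Vx; rewrite asboolF // => Ux; exact: (dUV x).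
have sU (Z : set S) : Z `<=` U -> forall x, Z x -> `[< U x >] = true.
  by move=> ZU x /ZU Ux; rewrite asboolT.
have sE (Z : set S) : Z `<=` Ext -> forall x, Z x -> `[< D x >] = false.
  move=> ZE x /ZE Ex; rewrite asboolF // => -[dx hx]; apply: Ex; split => //; exact: ltW.
have sD (Z : set S) : Z `<=` D -> forall x, Z x -> `[< D x >] = true.
  by move=> ZD x /ZD Dx; rewrite asboolT.
have inPQ x : (N `&` [set x | range b x <-> C x]) x -> ~ C x -> P x \/ Q x.
  by move=> [Nx bC] nC; apply: NPQ; split => // /bC.
case: FU => -[hP hQ]; case: FD => -[kP kQ].
- exists false; apply: filterS Nz => x Nx nC; case: (inPQ x Nx nC) => h.
    by rewrite (sU P) // (sD P).
  by rewrite (sV Q) // (sE Q).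
- exists true; apply: filterS Nz => x Nx nC; case: (inPQ x Nx nC) => h.
    by rewrite (sU P) // (sE P).
  by rewrite (sV Q) // (sD Q).
- exists true; apply: filterS Nz => x Nx nC; case: (inPQ x Nx nC) => h.
    by rewrite (sV P) // (sD P).
  by rewrite (sU Q) // (sE Q).
- exists false; apply: filterS Nz => x Nx nC; case: (inPQ x Nx nC) => h.
    by rewrite (sV P) // (sE P).
  by rewrite (sU Q) // (sD Q).
Qed.

End Coloring.

(** * Existence of a smooth nonseparating curve *)

Section Existence.
Context {R : realType} {S : topologicalType}.
Local Notation plane := 'rV[R]_2.
Context (A : set (chart R S)) (hA : smooth_surface A) (hconn : connected [set: S]).

Lemma circle_off (c : chart R S) z0 (r : R) (z : S) (N : set S) : 0 < r -> nbhs z N ->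
  exists2 x, N x & ~ circle c z0 r x.
Proof.
move=> r0 HN; have [Cz|nC] := pselect (circle c z0 r z); last first.
  by exists z => //; exact: nbhs_singleton.
have [cD _] := circle_closure r0 Cz; have [x [Dx Nx]] := cD N HN.
by exists x => //; exact: disc_not_circle.
Qed.

(** Correcting the colour by the side of the circle gives a function that is
    locally constant along the connected set [Z], whereas the correction differs
    at [p] and [q]. *)
Lemma no_full_coloring (c : chart R S) z0 (r : R) (Z : set S) (p q : S) (s : S -> bool) :
  0 < r -> (forall z, sq (z - z0) <= r -> (chart_fun c @` chart_dom c) z) ->
  connected Z -> Z p -> Z q -> disc c z0 r p -> ~ cdisc c z0 r q -> s p = s q ->
  (forall z, Z z -> exists k : bool, \forall x \near z, ~ circle c z0 r x ->
     s x = k (+) (`[< circle c z0 r z >] && `[< disc c z0 r x >])) -> False.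
Proof.
move=> r0 Hball cZ Zp Zq Dp nq spq H.
pose C := circle c z0 r; pose D := disc c z0 r.
have oD : open D by exact: disc_open.
have oE : open (~` cdisc c z0 r) by exact/closed_openC/(closed_cdisc hA).
have H' z : Z z -> exists k : bool, \forall x \near z, ~ C x -> s x (+) `[< D x >] = k.
  move=> Zz; have [k Hk] := H z Zz; have [Cz|nC] := pselect (C z).
    exists k; apply: filterS Hk => x hx nCx; rewrite hx // (asboolT Cz) /=.
    by rewrite -addbA addbb addbF.
  rewrite (asboolF nC) /= in Hk; case: (circle_compl nC) => [Dz|Ez].
    exists (k (+) true); apply: filterS2 (open_nbhs_nbhs (conj oD Dz)) Hk => x Dx hx nCx.
    by rewrite hx // (asboolT Dx) addbF.
  exists k; apply: filterS2 (open_nbhs_nbhs (conj oE Ez)) Hk => x Ex hx nCx.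
  rewrite hx // (asboolF (P := D x)) ?addbF // => -[dx lx].
  by apply: Ex; split => //; exact: ltW.
have npC : ~ C p by exact: disc_not_circle.
have nqC : ~ C q by apply: ext_not_circle.
pose P (z : S) := \forall x \near z, ~ C x -> s x (+) `[< D x >] = s p (+) true.
have Pq : P q.
  apply: (connected_ind (P := P) cZ) => //.
  - exists p => //; have [k Hk] := H' p Zp; have := nbhs_singleton Hk npC.
    by rewrite (asboolT (P := D p)) // /P => ->.
  - move=> x _ Px; have := nbhs_interior Px.
    by apply: filterS => y Py _; exact: Py.
  - move=> x Zx nP; have [k Hk] := H' x Zx.
    apply: filterS (nbhs_interior Hk) => y Hy _ Py; apply: nP.
    have Hy' : \forall x \near y, ~ C x -> s x (+) `[< D x >] = k by exact: Hy.
    have [u [h1 h2] nCu] := @circle_off c z0 r y _ r0 (filterI Hy' Py).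
    by apply: filterS Hk => v hv nCv; rewrite hv // -(h1 nCu) h2.
have := nbhs_singleton Pq nqC; rewrite (asboolF (P := D q)) ?addbF.
  by rewrite spq; case: (s q).
by move=> [dx lx]; apply: nq; split => //; exact: ltW.
Qed.

(** By contradiction: the time spent by the circle in the small disc off [g]
    changes no colour, each excursion is handled by [col_excursion], and the
    colourings are glued along the circle into one that [no_full_coloring]
    forbids. *)
Theorem smooth_nonseparating_exists : nonspherical R S ->
  exists b, smooth_param A b /\ nonseparating (range b).
Proof.
move=> [_ [[g scg <-] nsg]]; apply: contrapT => none.
have Hsep b : smooth_param A b -> ~ nonseparating (range b).
  by move=> sb nb; apply: none; exists b.
have [cg ig] := scg.
pose W := ~` range g.
have oW : open W by exact/closed_openC/(closed_curve hA).
set p := g 0; set q := g (1 / 2).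
have pq : p <> q.
  by move=> /(curve_inj scg); rewrite sub0r normrN gtr0_norm ?divr_gt0 // => H; have := H ltac:(lra); lra.
have [c Ac cp] := chart_at hA p.
have Nq : nbhs p (~` [set q]).
  apply: open_nbhs_nbhs; split; last by [].
  apply/closed_openC/accessible_closed_set1/hausdorff_accessible; by case: hA.
have [rr rr0 Hrr] := disc_nbhs (filterI (chart_img_nbhs cp) (near_chart_inv cp Nq)).
pose r := rr / 2; set z0 := chart_fun c p in Hrr.
have r0 : 0 < r by rewrite divr_gt0.
have rrr : r < rr by rewrite /r; lra.
have Hball z : sq (z - z0) <= r -> (chart_fun c @` chart_dom c) z.
  by move=> hz; have [] := Hrr z (le_lt_trans hz rrr).
have pD : disc c z0 r p by split => //; rewrite subrr sq0.
have qD : ~ cdisc c z0 r q.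
  move=> [dq hq]; have [_] := Hrr _ (le_lt_trans hq rrr).
  by rewrite /= chart_funK.
pose C := circle c z0 r.
set arc1 := g @` [set s | 0 <= s <= 1 / 2]; set arc2 := g @` [set s | 1 / 2 <= s <= 1].
have [p1 q1] := arc1_ends g; have [p2 q2] := arc2_ends scg.
have cov := arcs_cover scg; have [sub1 sub2] := arcs_sub g.
have cl1 : closed arc1 by exact: (closed_curve_arc hA).
have cl2 : closed arc2 by exact: (closed_curve_arc hA).
have npC : ~ C p by exact: disc_not_circle.
have nqC : ~ C q by apply: ext_not_circle.
have apart x : C x -> arc1 x -> arc2 x -> False.
  by move=> Cx h1 h2; case: (arcs_meet scg h1 h2) => E; [apply: npC; rewrite /p -E|apply: nqC; rewrite /q -E].
have conn1 := arc1_conn scg; have conn2 := arc2_conn scg.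
have crosses := arc_crosses hA Hball pD qD.
(* The circle leaves [g]: inside [g], it would be split between the two arcs,
   both of which it meets. *)
have [x0 [Cx0 Wx0]] : exists x, C x /\ W x.
  apply: contrapT => nx; have Cg x : C x -> range g x.
    by move=> Cx; apply: contrapT => ng; apply: nx; exists x.
  pose v1 := vec (Num.sqrt r) 0.
  have Ev1 : sq v1 = r.
    by rewrite /v1 sqE vec0 vec1 sqr_sqrtr ?ltW // expr0n addr0.
  have cC := connected_circle Ac r0 Hball Ev1.
  have C1 : forall x, C x -> arc1 x.
    apply: (connected_ind cC).
    - by have [x h1 h2] := crosses arc1 conn1 p1 q1; exists x.
    - move=> x Cx a1x; have n2 : (~` arc2) x by move=> a2x; exact: (apart x).
      apply: filterS (open_nbhs_nbhs (conj (closed_openC cl2) n2)) => y n2y Cy.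
      by case: (cov y (Cg y Cy)).
    - move=> x Cx n1; apply: filterS (open_nbhs_nbhs (conj (closed_openC cl1) n1)) => y n1y _.
      exact: n1y.
  have [x a2x Cx] := crosses arc2 conn2 p2 q2.
  exact: (apart x Cx (C1 x Cx) a2x).
(* The parametrisation of the circle misses [x0], which is off [g]; so times of
   large absolute value are off [g] as well. *)
have [cx0 Ex0] := Cx0; pose v := chart_fun c x0 - z0.
have Ev : sq v = r by [].
have Evx : chart_inv c (z0 + v) = x0 by rewrite /v addrC subrK chart_funK.
pose tau := cparam c z0 v.
have ctau : continuous tau by exact: (cparam_continuous Ac r0 Hball Ev).
have tauC t : C (tau t) by exact: (cparam_circle Hball Ev).
have NW : nbhs (chart_inv c (z0 + v)) W by rewrite Evx; exact: open_nbhs_nbhs.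
have [M M0 HM] := cparam_far r0 Hball Ev NW; rewrite -/tau in HM.
pose X := tau @^-1` arc1; pose Y := tau @^-1` arc2.
have cX : closed X by apply: closed_comp => // t _; exact: ctau.
have cY : closed Y by apply: closed_comp => // t _; exact: ctau.
have XY : X `&` Y = set0 by apply/seteqP; split=> // t [h1 h2]; exact: (apart (tau t)).
have MM : - M <= M by rewrite ge0_cp // ltW.
have [F [HF HFbr]] := breaks cX cY XY MM.
have inM t : range g (tau t) -> - M <= t <= M.
  move=> gt; rewrite -ler_norml leNgt; apply/negP => /ltW/HM; exact.
have sW : forall x, x \in x0 :: [seq tau f | f <- F] -> W x.
  move=> x; rewrite inE => /orP[/eqP -> //|/mapP[f /HF[n1 n2] ->]].
  by move=> /cov[].
have [d [w [r1 [r2 [Ad r12 Hd HW Hin]]]]] := gather hA oW nsg (ex_intro _ x0 Wx0) sW.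
have /andP[r10 r1r2] := r12.
have HWc : cdisc d w r2 `<=` W by move=> x [dx hx]; exact: HW.
have c12 : cdisc d w r1 `<=` cdisc d w r2.
  by move=> x [dx hx]; split => //; exact: le_trans (ltW r1r2).
have dc x : disc d w r1 x -> cdisc d w r1 x by move=> [dx hx]; split => //; exact: ltW.
have Hd1 z : sq (z - w) <= r1 -> (chart_fun d @` chart_dom d) z.
  by move=> hz; apply: Hd; exact: le_trans (ltW r1r2).
pose E := tau @^-1` (cdisc d w r1).
have cE : closed E by apply: closed_comp; [move=> t _; exact: ctau|exact: (closed_cdisc hA)].
have EW t : E t -> W (tau t) by move=> /c12/HWc.
have oWt : open (tau @^-1` W) by apply: open_comp => // t _; exact: ctau.
have Nx0 : nbhs (chart_inv c (z0 + v)) (disc d w r1).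
  rewrite Evx; apply: open_nbhs_nbhs; split; first exact: disc_open.
  by apply: Hin; rewrite /= mem_head.
have [M2 M20 HM2] := cparam_far r0 Hball Ev Nx0; rewrite -/tau in HM2.
pose K := M + M2.
have EK t : K <= `|t| -> E t.
  by move=> ht; apply/dc/HM2; apply: le_trans ht; rewrite lerDr ltW.
have K0 : 0 < K by rewrite addr_gt0.
have glue := col_glue r0 Ev Hball.
(* A connectedness argument on the segment: for [t] near a given time, the part
   of the circle in between is off [g] or belongs to a single excursion. *)
have main : forall t, - K <= t <= K -> forall s, - K <= s <= t -> E s -> col g c z0 r v (- K) s.
  apply: (connected_ind (@connected_cc R (- K) K)).
  - exists (- K); first by rewrite /= lexx ge0_cp // ltW.
    move=> s /andP[h1 h2] Es; apply: col_local => t /andP[h3 h4].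
    have -> : t = s by apply/eqP; rewrite eq_le h4 (le_trans h2).
    exact: EW.
  - move=> t /andP[h1 h2] Pt; have [Et|nEt] := pselect (E t).
      have [e e0 He] := nbhs_line (open_nbhs_nbhs (conj oWt (EW t Et))).
      have : nbhs t [set y | `|y - t| < e].
        by apply: line_nbhs.
      apply: filterS => y hy /andP[h3 h4] s /andP[h5 h6] Es.
      have [st|ts] := lerP s t; first by apply: Pt; rewrite ?h5.
      apply: (glue g _ t) => //; [exact: ltW|exact: EW|by apply: Pt; rewrite ?h1 ?lexx|].
      apply: col_local => u /andP[h7 h8]; apply: He.
      move: hy; rewrite /= !ltr_distl => /andP[_ h9].
      by rewrite (lt_le_trans _ h7) ?gtrBl //= (le_lt_trans h8) // (le_lt_trans h6).
    have [e e0 He] := nbhs_line (open_nbhs_nbhs (conj (closed_openC cE) nEt)).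
    have : nbhs t [set y | `|y - t| < e].
      by apply: line_nbhs.
    apply: filterS => y hy /andP[h3 h4] s /andP[h5 h6] Es.
    have [st|ts] := lerP s t; first by apply: Pt; rewrite ?h5.
    exfalso; apply: (He s) => //; move: hy; rewrite /= !ltr_distl => /andP[_ h9].
    by rewrite (lt_trans _ ts) ?gtrBl //= (le_lt_trans h6).
  - move=> t /andP[h1 h2] nP; have [Et|nEt] := pselect (E t); last first.
      have [e e0 He] := nbhs_line (open_nbhs_nbhs (conj (closed_openC cE) nEt)).
      have : nbhs t [set y | `|y - t| < e].
        by apply: line_nbhs.
      apply: filterS => y hy /andP[h3 h4] Py; apply: nP => s /andP[h5 h6] Es.
      have [sy|ys] := lerP s y; first by apply: Py; rewrite ?h5.
      exfalso; apply: (He s) => //; move: hy; rewrite /= !ltr_distl => /andP[h9 _].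
      by rewrite (lt_trans h9) //= (le_lt_trans h6) // ltrDl.
    have [e e0 He] := nbhs_line (open_nbhs_nbhs (conj oWt (EW t Et))).
    have : nbhs t [set y | `|y - t| < e].
      by apply: line_nbhs.
    apply: filterS => y hy /andP[h3 h4] Py; apply: nP => s /andP[h5 h6] Es.
    have [sy|ys] := lerP s y; first by apply: Py; rewrite ?h5.
    have near_t u : y <= u -> u <= s -> W (tau u).
      move=> yu us; apply: He; move: hy; rewrite /= !ltr_distl => /andP[h9 _].
      by rewrite (lt_le_trans h9) //= (le_lt_trans us) // (le_lt_trans h6) // ltrDl.
    have [Ey|nEy] := pselect (E y).
      apply: (glue g _ y) => //; [exact: ltW|exact: EW|by apply: Py; rewrite ?h3 ?lexx|].
      by apply: col_local => u /andP[h7 h8]; exact: near_t.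
    have EmK : E (- K) by apply: EK; rewrite normrN gtr0_norm.
    have [y0 [y1 [/andP[k1 k2] E0 E1 [k3 k4] gap]]] := gap_ends cE nEy h3 (ltW ys) EmK Es.
    have y01 : y0 < y1 by exact: lt_trans k2.
    (* The ends of an excursion are on the boundary of the disc, as they are
       limits of times outside it. *)
    have edge u : E u -> (forall e, 0 < e -> exists2 u', `|u' - u| < e & ~ E u') ->
        chart_dom d (tau u) /\ sq (chart_fun d (tau u) - w) = r1.
      move=> [du hu] Hu; split => //; apply/eqP; rewrite eq_le hu leNgt; apply/negP => lt1.
      have Nu : nbhs u (tau @^-1` disc d w r1).
        by apply: ctau; apply: open_nbhs_nbhs; split; [exact: disc_open|].
      have [e' e'0 He'] := nbhs_line Nu; have [u' hu' nE] := Hu e' e'0.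
      by apply: nE; apply/dc/He'.
    have [d0 q0] : chart_dom d (tau y0) /\ sq (chart_fun d (tau y0) - w) = r1.
      apply: edge => // e' e'0; have yy : 0 < y1 - y0 by rewrite subr_gt0.
      have [h [hh1 hh2 hh3]] := small_pos e'0 yy.
      exists (y0 + h); first by rewrite addrAC subrr add0r gtr0_norm.
      by apply: gap; rewrite ltrDl hh1 -ltrBrDl.
    have [d1 q1'] : chart_dom d (tau y1) /\ sq (chart_fun d (tau y1) - w) = r1.
      apply: edge => // e' e'0; have yy : 0 < y1 - y0 by rewrite subr_gt0.
      have [h [hh1 hh2 hh3]] := small_pos e'0 yy.
      exists (y1 - h); first by rewrite addrAC subrr add0r normrN gtr0_norm.
      by apply: gap; rewrite gtrBl hh1 andbT ltrBrDl -ltrBrDr.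
    have nobreak f : f \in F -> ~ (y0 < f < y1).
      move=> fF /gap; apply; apply/dc/Hin.
      by rewrite /= inE map_f ?orbT.
    have miss : (forall u, y0 <= u <= y1 -> ~ arc1 (tau u)) \/
                (forall u, y0 <= u <= y1 -> ~ arc2 (tau u)).
      have [[u hu a1u]|n1] := pselect (exists2 u, y0 <= u <= y1 & arc1 (tau u)); last first.
        by left=> u hu a1u; apply: n1; exists u.
      right=> u' hu' a2u'.
      have /andP[b1 b2] := inM u (sub1 _ a1u); have /andP[b3 b4] := inM u' (sub2 _ a2u').
      have [uu|uu|uu] := ltgtP u u'.
      - have [f fF /andP[f1 f2]] := HFbr u u' b1 uu b4 (or_introl (conj a1u a2u')).
        apply: (nobreak f fF); case/andP: hu => hu1 _; case/andP: hu' => _ hu2.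
        by rewrite (le_lt_trans hu1) // (lt_le_trans f2).
      - have [f fF /andP[f1 f2]] := HFbr u' u b3 uu b2 (or_intror (conj a2u' a1u)).
        apply: (nobreak f fF); case/andP: hu' => hu1 _; case/andP: hu => _ hu2.
        by rewrite (le_lt_trans hu1) // (lt_le_trans f2).
      - by apply: (apart (tau u)) => //; rewrite uu.
    have exc := col_excursion hA hconn scg Hsep Ac r0 Ev Hball Ad r12 Hd HWc y01 d0 q0 d1 q1' gap miss.
    apply: (glue g _ y1) => //; [exact: le_trans k3 (ltW y01)|exact: EW| |].
      apply: (glue g _ y0) => //; [exact: ltW|exact: EW|].
      by apply: Py => //; rewrite k3 ltW.
    apply: col_local => u /andP[h7 h8]; apply: near_t => //.
    by apply: le_trans h7; exact: ltW.
have [s [spq Hs]] : col g c z0 r v (- K) K.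
  apply: (main K); rewrite ?lexx ?andbT ?ge0_cp ?ltW //.
  by apply: EK; rewrite gtr0_norm.
apply: (no_full_coloring (s := s) r0 Hball conn1 p1 q1 pD qD spq) => z /sub1 gz.
have [k Hk] := Hs z gz; exists k; apply: filterS Hk => x hx nCx; rewrite hx //; congr (_ (+) (_ && _)).
apply/asboolP/asboolP => [[t ht <-]|Cz]; first exact: tauC.
have zx : z != chart_inv c (z0 + v).
  by apply/eqP => e; move: gz; rewrite e Evx.
have Ez := cparam_onto r0 Ev Cz zx; exists (unstereo v (chart_fun c z - z0)) => //=.
rewrite -ler_norml leNgt; apply/negP => /ltW/EK/EW; apply.
by rewrite /tau -Ez.
Qed.

End Existence.

(** * A plane homeomorphism preserving a family of loops *)

Section Model.
Context {R : realType}.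
Local Notation plane := 'rV[R]_2.
Implicit Types (z : plane).

Lemma diff_eps (V W : normedModType R) (f : V -> W) (x : V) (e : R) : 0 < e ->
  differentiable f x ->
  \forall h \near (0 : V), `|f (h + x) - f x - 'd f x h| <= e * `|h|.
Proof.
move=> e0 df; have := diff_locally df; move/eqaddoP => /(_ e e0).
apply: filterS => h /=; rewrite !fctE /= opprD addrA; exact.
Qed.

Lemma mvt_near (f : R -> R) t : smooth_at f t -> f t = 0 ->
  \forall s \near t, exists2 c, `|c - t| <= `|s - t| & f s = derive1 f c * (s - t).
Proof.
move=> sf ft; have [e e0 He] := nbhs_line (smooth_at_near sf).
have : nbhs t [set s | `|s - t| < e].
  by apply: line_nbhs.
apply: filterS => s /= hs.
have near c : `|c - t| <= `|s - t| -> smooth_at f c by move=> h; apply: He; exact: le_lt_trans hs.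
have drv c : smooth_at f c -> is_derive c (1 : R) f (derive1 f c).
  move=> sc; rewrite derive1E; apply: derivableP.
  exact/derivable1_diffP/(smooth_at_differentiable sc).
have seg a b : a <= b -> (forall c, a <= c <= b -> `|c - t| <= `|s - t|) ->
    exists2 c, a <= c <= b & f b - f a = derive1 f c * (b - a).
  move=> ab hb; have [||c] := @MVT_segment _ f (derive1 f) a b ab.
  - by move=> x; rewrite in_itv /= => /andP[h1 h2]; apply/drv/near/hb; rewrite !ltW.
  - apply: continuous_in_subspaceT => x; rewrite inE /= in_itv /= => hx.
    by apply: smooth_at_continuous; exact/near/hb.
  - by rewrite in_itv /=; exists c.
have [st|ts] := lerP s t.
  have [|c hc Ec] := seg s t st; last first.
    exists c; last by move: Ec; rewrite ft sub0r => Ec; rewrite -[f s]opprK Ec; ring.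
    by case/andP: hc => h1 h2; rewrite !ler0_norm ?subr_le0 //; lra.
  by move=> c /andP[h1 h2]; rewrite !ler0_norm ?subr_le0 //; lra.
have ts' := ltW ts.
have [|c hc Ec] := seg t s ts'; last first.
  exists c; last by move: Ec; rewrite ft subr0.
  by case/andP: hc => h1 h2; rewrite !ger0_norm ?subr_ge0 //; lra.
by move=> c /andP[h1 h2]; rewrite !ger0_norm ?subr_ge0 //; lra.
Qed.

Lemma first_order (f : R -> R) t e : smooth_at f t -> f t = 0 -> 0 < e ->
  \forall s \near t, `|f s - derive1 f t * (s - t)| <= e * `|s - t|.
Proof.
move=> sf ft e0; have cd := smooth_at_continuous (smooth_at_derive1 sf).
have [d d0 Hd] := nbhs_line ((cvgrPdist_le _ _).1 cd e e0).
have : nbhs t [set s | `|s - t| < d].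
  by apply: line_nbhs.
apply: filterS2 (mvt_near sf ft) => s [c hc ->] /= hs.
rewrite -mulrBl normrM ler_wpM2r // distrC.
by apply: Hd; exact: le_lt_trans hs.
Qed.

(** Two applications of the mean value theorem. *)
Lemma second_order (f : R -> R) t : smooth_at f t -> f t = 0 -> derive1 f t = 0 ->
  exists2 M, 0 < M & \forall s \near t, `|f s| <= M * `|s - t| ^+ 2.
Proof.
move=> sf ft dft; have sd := smooth_at_derive1 sf.
exists (`|derive1 (derive1 f) t| + 1); first by rewrite ltr_wpDl.
have [d d0 Hd] := nbhs_line (first_order sd dft ltr01).
have : nbhs t [set s | `|s - t| < d].
  by apply: line_nbhs.
apply: filterS2 (mvt_near sf ft) => s [c hc ->] /= hs.
have h := Hd c (le_lt_trans hc hs); rewrite mul1r in h.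
have h1 : `|derive1 f c| <= (`|derive1 (derive1 f) t| + 1) * `|c - t|.
  rewrite -[derive1 f c](subrK (derive1 (derive1 f) t * (c - t))).
  apply: le_trans (ler_normD _ _) _; rewrite mulrDl mul1r addrC normrM.
  by rewrite lerD2l.
rewrite normrM expr2 mulrA ler_wpM2r //; apply: le_trans h1 _.
by rewrite ler_wpM2l // addr_ge0.
Qed.

(** The level curves in the upper half plane are loops through the origin, where
    [y] is equivalent to a multiple of [|x|^(4/3)]. *)
Definition level z : R := z 0 1 ^+ 3 / sq z ^+ 2.

(** The abscissa is stretched by [lam (level z)], then a homothety of ratio
    [q ^+ 2] brings the point back to its loop. As the level is preserved,
    inverting [lam] inverts the map ([loopsK]). *)
Definition loops (lam : R -> R) z : plane :=
  let l := lam (level z) in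
  let q := sq z / (l ^+ 2 * z 0 0 ^+ 2 + z 0 1 ^+ 2) in
  q ^+ 2 *: vec (l * z 0 0) (z 0 1).

Lemma loops0 lam : loops lam 0 = 0.
Proof. by rewrite /loops; apply: plane_eq; rewrite !coordE !mulr0. Qed.

Lemma den_gt0 (l : R) z : 0 < l -> z != 0 -> 0 < l ^+ 2 * z 0 0 ^+ 2 + z 0 1 ^+ 2.
Proof.
move=> l0 z0; have := sq_gt0 z0; rewrite sqE => h.
have [x0|x0] := eqVneq (z 0 0) 0; first by move: h; rewrite x0 expr0n /= mulr0 !add0r.
have h1 : 0 < z 0 0 ^+ 2 by rewrite exprn_even_gt0.
by apply: ltr_wpDr; [exact: sqr_ge0|apply: mulr_gt0 => //; exact: exprn_gt0].
Qed.

Section OneLam.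
Variable lam : R -> R.
Hypothesis lam0 : forall s, 0 < lam s.

Lemma loops_sq z : z != 0 ->
  let l := lam (level z) in
  let q := sq z / (l ^+ 2 * z 0 0 ^+ 2 + z 0 1 ^+ 2) in
  sq (loops lam z) = q ^+ 3 * sq z.
Proof.
move=> z0 l q; have dn := lt0r_neq0 (den_gt0 (lam0 (level z)) z0).
rewrite /loops -/l -/q sqZ.
have -> : sq (vec (l * z 0 0) (z 0 1)) = l ^+ 2 * z 0 0 ^+ 2 + z 0 1 ^+ 2.
  by rewrite sqE !coordE exprMn.
have <- : q * (l ^+ 2 * z 0 0 ^+ 2 + z 0 1 ^+ 2) = sq z by rewrite /q divfK.
ring.
Qed.

Lemma loops_level z : level (loops lam z) = level z.
Proof.
have [->|z0] := eqVneq z 0; first by rewrite loops0.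
rewrite /level loops_sq //; have dn := den_gt0 (lam0 (level z)) z0.
have sn := sq_gt0 z0.
set q := sq z / _; have q0 : q != 0 by rewrite mulf_neq0 ?invr_eq0 ?lt0r_neq0.
have -> : loops lam z 0 1 = q ^+ 2 * z 0 1 by rewrite /loops !coordE.
have s0 := lt0r_neq0 sn.
by field; rewrite s0 q0.
Qed.

Lemma loops_neq0 z : z != 0 -> loops lam z != 0.
Proof.
move=> z0; rewrite -sq_eq0 loops_sq // mulf_neq0 ?sq_eq0 // expf_neq0 //.
by rewrite mulf_neq0 ?invr_eq0 ?sq_eq0 // lt0r_neq0 // den_gt0.
Qed.

Lemma loops_id z : lam (level z) = 1 -> loops lam z = z.
Proof.
have [->|z0] := eqVneq z 0; first by rewrite loops0.
move=> E; rewrite /loops E; have s0 : sq z != 0 by rewrite sq_eq0.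
rewrite expr1n mul1r -sqE divff // expr1n scale1r mul1r.
exact: esym (plane_vec z).
Qed.

Lemma smooth_loops z : (forall s, smooth_at lam s) -> z != 0 -> smooth_at (loops lam) z.
Proof.
move=> slam z0; have FR := @framed_R R.
have sx i : smooth_at (fun z : plane => z 0 i) z by exact: smooth_coord.
have ssq : smooth_at (@sq R) z.
  have := smooth_sq 0 z; have -> // : (fun z => sq (z - 0)) = @sq R.
  by apply/funext => u; rewrite subr0.
have s0 : sq z != 0 by rewrite sq_eq0.
have slev : smooth_at level z.
  apply: smooth_atM.
    by apply: smooth_atM => //; apply: smooth_atM.
  by apply: smooth_atV; [rewrite expf_neq0|apply: smooth_atM].
have sl : smooth_at (fun z => lam (level z)) z.
  exact: (smooth_at_compR (f := level) FR slev (slam _)).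
have sq_ : smooth_at (fun z => sq z / (lam (level z) ^+ 2 * z 0 0 ^+ 2 + z 0 1 ^+ 2)) z.
  apply: smooth_atM => //; apply: smooth_atV; first by rewrite lt0r_neq0 // den_gt0.
  by apply: smooth_atD; [apply: smooth_atM; apply: smooth_atM|apply: smooth_atM].
have sq2 : smooth_at (fun z => (sq z / (lam (level z) ^+ 2 * z 0 0 ^+ 2 + z 0 1 ^+ 2)) ^+ 2) z.
  exact: smooth_atM.
have -> : loops lam = fun z => vec
   ((sq z / (lam (level z) ^+ 2 * z 0 0 ^+ 2 + z 0 1 ^+ 2)) ^+ 2 * (lam (level z) * z 0 0))
   ((sq z / (lam (level z) ^+ 2 * z 0 0 ^+ 2 + z 0 1 ^+ 2)) ^+ 2 * z 0 1).
  by apply/funext => u; apply: plane_eq; rewrite /loops !coordE.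
by apply: smooth_at_vec; apply: smooth_atM => //; apply: smooth_atM.
Qed.

(** The bound serves only for continuity at the origin. *)
Lemma loops_bound z : (forall s, 1 / 2 <= lam s) -> sq (loops lam z) <= 64 * sq z.
Proof.
move=> hl; have [->|z0] := eqVneq z 0; first by rewrite loops0 sq0 mulr0.
rewrite loops_sq // ler_wpM2r ?sq_ge0 //.
set q := sq z / _; have dn := den_gt0 (lam0 (level z)) z0.
have q0 : 0 <= q by rewrite divr_ge0 ?sq_ge0 ?ltW.
have q4 : q <= 4.
  rewrite ler_pdivrMr // sqE; have := hl (level z); set l := lam _ => h.
  have h2 : 1 / 4 <= l ^+ 2 by nra.
  have := sqr_ge0 (z 0 0); have := sqr_ge0 (z 0 1); nra.
have -> : 64 = 4 ^+ 3 :> R by ring.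
by rewrite lerXn2r // nnegrE.
Qed.

Lemma continuous_loops : (forall s, smooth_at lam s) -> (forall s, 1 / 2 <= lam s) ->
  continuous (loops lam).
Proof.
move=> slam hl z; have [->|z0] := eqVneq z 0; last first.
  by apply: smooth_at_continuous; exact: smooth_loops.
rewrite /continuous_at loops0 => N /disc_nbhs[e e0 He].
have e64 : 0 < e / 64 by rewrite divr_gt0.
apply: filterS (nbhs_disc (0 : plane) e64) => u /= hu; apply: He.
move: hu; rewrite !subr0 => hu; have h := loops_bound u hl; lra.
Qed.

End OneLam.

Lemma loopsK lam z : (forall s, 0 < lam s) ->
  loops (fun s => (lam s)^-1) (loops lam z) = z.
Proof.
move=> lam0; have [->|z0] := eqVneq z 0; first by rewrite !loops0.
rewrite {1}/loops loops_level // loops_sq //.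
have dn := lt0r_neq0 (den_gt0 (lam0 (level z)) z0).
have ln := lt0r_neq0 (lam0 (level z)).
have sn : sq z != 0 by rewrite sq_eq0.
rewrite /loops; set l := lam (level z) in dn ln *; set q := sq z / _.
have qn : q != 0 by rewrite mulf_neq0 ?invr_eq0.
have E : q ^+ 3 * sq z / (l^-1 ^+ 2 * (q ^+ 2 *: vec (l * z 0 0) (z 0 1)) 0 0 ^+ 2 +
   (q ^+ 2 *: vec (l * z 0 0) (z 0 1)) 0 1 ^+ 2) = q^-1.
  rewrite !coordE.
  have -> : l^-1 ^+ 2 * (q ^+ 2 * (l * z 0 0)) ^+ 2 + (q ^+ 2 * z 0 1) ^+ 2 = q ^+ 4 * sq z.
    by rewrite sqE; field.
  by field; rewrite sn qn.
rewrite E; apply: plane_eq; rewrite !coordE; field; rewrite ?ln ?qn //.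
Qed.

End Model.

(** * Smooth curves through the singular point, and the lack of differential *)

Section Profile.
Context {R : realType}.
Local Notation plane := 'rV[R]_2.
Implicit Types (z : plane) (k : R).

Lemma ler_exp n (x y : R) : 0 <= x -> x <= y -> x ^+ n <= y ^+ n.
Proof. by move=> x0 xy; apply: lerXn2r => //; rewrite nnegrE // (le_trans x0). Qed.

(** The map [loops lam] moves points only at levels between [k] and [3 * k]. The
    positive lower bound keeps it away from the neighbourhood of smooth curves
    with a horizontal velocity at the origin, the upper bound from the others;
    [k] also governs the size of the support ([loops_far]). *)
Record profile k (lam : R -> R) : Prop := Profile {
  prof_smooth : forall s, smooth_at lam s;
  prof_ge : forall s, 1 / 2 <= lam s;
  prof_away : forall s, k <= `|s - 2 * k| -> lam s = 1;
  prof_peak : lam (2 * k) != 1 }.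

Lemma profile_exists k : 0 < k ->
  exists lam, profile k lam /\ profile k (fun s => (lam s)^-1).
Proof.
move=> k0; have [B [SB B0 B1 Bd]] := smooth_bump (2 * k) k0.
have d0 x : 1 + B x != 0 by rewrite gt_eqF // ltr_pwDl.
pose lam x := 1 + B x / (1 + B x).
have sl x : smooth_at lam x.
  apply: smooth_atD; first exact: smooth_at_cst.
  apply: smooth_atM => //; apply: smooth_atV => //.
  by apply: smooth_atD => //; exact: smooth_at_cst.
have l1 x : 1 <= lam x by rewrite lerDl divr_ge0 ?B0 // addr_ge0.
have l2 x : lam x <= 2.
  have -> : 2 = 1 + 1 :> R by ring.
  by rewrite lerD2l ler_pdivrMr ?mul1r ?lerDr // ltr_pwDl.
have l0 x : lam x != 0 by rewrite gt_eqF // (lt_le_trans ltr01).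
have pk : lam (2 * k) != 1.
  by rewrite /lam B1 -subr_eq0 addrAC subrr add0r mul1r invr_eq0.
have aw s : k <= `|s - 2 * k| -> lam s = 1 by move=> /Bd h; rewrite /lam h mul0r addr0.
exists lam; split; split=> //.
- by move=> s; have := l1 s; lra.
- by move=> s; apply: smooth_atV.
- move=> s; rewrite mul1r lef_pV2 ?posrE //; exact: lt_le_trans ltr01 (l1 s).
- by move=> s /aw ->; rewrite invr1.
- by rewrite invr_eq1.
Qed.

Section OneProfile.
Variables (k : R) (lam : R -> R).
Hypotheses (k0 : 0 < k) (P : profile k lam).

Let lam0 s : 0 < lam s. Proof. by have := prof_ge P s; lra. Qed.

Lemma loops_low z : z 0 1 ^+ 3 <= k * sq z ^+ 2 -> loops lam z = z.
Proof.
have [->|z0] := eqVneq z 0; first by rewrite loops0.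
move=> h; apply: loops_id; apply: (prof_away P).
have s0 := sq_gt0 z0.
have : level z <= k by rewrite /level ler_pdivrMr // exprn_gt0.
move=> lk; have kp := k0; rewrite ler0_norm; [lra|lra].
Qed.

Lemma loops_high z : 3 * k * sq z ^+ 2 <= `|z 0 1| ^+ 3 -> loops lam z = z.
Proof.
have [->|z0] := eqVneq z 0; first by rewrite loops0.
move=> h; apply: loops_id; apply: (prof_away P).
have s0 := sq_gt0 z0.
have : 3 * k <= `|level z|.
  by rewrite /level normrM normfV !normrX (ger0_norm (sq_ge0 z)) ler_pdivlMr // exprn_gt0.
move=> lk; apply: le_trans (lerB_dist _ _); have kp := k0; rewrite (ger0_norm (_ : 0 <= 2 * k)); [lra|lra].
Qed.

(** As [y^3 <= |z|^3], levels above [k] occur only in the disc of squared radius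
    [k ^- 2]. *)
Lemma loops_far z : k ^- 2 <= sq z -> loops lam z = z.
Proof.
move=> h; apply: loops_low.
have k20 : 0 < k ^+ 2 by rewrite exprn_gt0.
have h1 : 1 <= sq z * k ^+ 2 by rewrite -ler_pdivrMr // mul1r.
have b0 : 0 <= k * sq z ^+ 2 by rewrite mulr_ge0 ?exprn_ge0 ?sq_ge0 // ltW.
have [y0|y0] := lerP (z 0 1) 0.
  apply: le_trans b0; have := sqr_ge0 (z 0 1); nra.
rewrite -(@ler_pXn2r _ 2) ?nnegrE ?exprn_ge0 ?(ltW y0) //.
have y2 : z 0 1 ^+ 2 <= sq z by rewrite sqE lerDr sqr_ge0.
have y6 : (z 0 1 ^+ 3) ^+ 2 <= sq z ^+ 3.
  have -> : (z 0 1 ^+ 3) ^+ 2 = (z 0 1 ^+ 2) ^+ 3 by ring.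
  by rewrite lerXn2r // ?nnegrE ?sq_ge0 // sqr_ge0.
apply: le_trans y6 _.
have -> : (k * sq z ^+ 2) ^+ 2 = sq z ^+ 3 * (sq z * k ^+ 2) by ring.
by rewrite ler_peMr // exprn_ge0 // sq_ge0.
Qed.

(** Let [h] be the time elapsed. If the velocity is not horizontal, [|y|] is at
    least of the order of [h] and [sq z] at most of the order of [h^2], so the
    level blows up. If it is horizontal, [|y| <= M h^2] while [sq z] is at least
    of the order of [h^2], and the level tends to 0. In both cases it leaves the
    range where [lam] differs from 1. *)
Lemma loops_curve (u : R -> plane) t : u t = 0 -> smooth_at u t ->
  derive1 u t != 0 -> {near t, loops lam \o u =1 u}.
Proof.
move=> ut su du.
have sc i : smooth_at (fun s => u s 0 i) t by exact: (smooth_at_coord u t).1 su i.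
have c0 i : u t 0 i = 0 by rewrite ut mxE.
pose a := `|derive1 u t 0 0|; pose b := `|derive1 u t 0 1|.
have up i : \forall s \near t, `|u s 0 i| <= (`|derive1 u t 0 i| + 1) * `|s - t|.
  apply: filterS (first_order (sc i) (c0 i) ltr01) => s; rewrite (derive1_coord _ su) => h.
  rewrite -[u s 0 i](subrK (derive1 u t 0 i * (s - t))).
  by apply: le_trans (ler_normD _ _) _; rewrite normrM mulrDl addrC lerD2l.
have low i : derive1 u t 0 i != 0 ->
    \forall s \near t, `|derive1 u t 0 i| / 2 * `|s - t| <= `|u s 0 i|.
  move=> di; have e0 : 0 < `|derive1 u t 0 i| / 2 by rewrite divr_gt0 // normr_gt0.
  apply: filterS (first_order (sc i) (c0 i) e0) => s; rewrite (derive1_coord _ su) => h.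
  have := lerB_dist (derive1 u t 0 i * (s - t)) (u s 0 i).
  by rewrite distrC normrM; lra.
have small e : 0 < e -> \forall s \near t, `|s - t| <= e.
  move=> e0; apply/nbhs_ballP; exists e => // s; rewrite /ball /= distrC; exact: ltW.
have [b0|b0] := eqVneq (derive1 u t 0 1) 0; last first.
  pose M := (a + 1) ^+ 2 + (b + 1) ^+ 2.
  have a1 : 0 < a + 1 by rewrite ltr_wpDl // normr_ge0.
  have b1 : 0 < b + 1 by rewrite ltr_wpDl // normr_ge0.
  have M0 : 0 < M by apply: addr_gt0; exact: exprn_gt0.
  have bp : 0 < b / 2 by rewrite divr_gt0 // normr_gt0.
  have d0 : 0 < (b / 2) ^+ 3 / (3 * k * M ^+ 2).
    by rewrite divr_gt0 ?exprn_gt0 // !mulr_gt0 // exprn_gt0.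
  apply: filterS3 (filterI (up 0) (up 1)) (low 1 b0) (small _ d0) => s [/= x1 y1] y2.
  rewrite ler_pdivlMr; last by rewrite !mulr_gt0 // exprn_gt0.
  move: (`|s - t|) (normr_ge0 (s - t)) x1 y1 y2 => h h0 x1 y1 y2 hs /=.
  apply: loops_high.
  have sM : sq (u s) <= M * h ^+ 2.
    rewrite sqE -[u s 0 0 ^+ 2]real_normK ?num_real // -[u s 0 1 ^+ 2]real_normK ?num_real //.
    rewrite /M mulrDl -!exprMn.
    by apply: lerD; apply: ler_exp.
  apply: (@le_trans _ _ ((b / 2 * h) ^+ 3)); last first.
    by apply: ler_exp => //; exact: mulr_ge0 (ltW bp) h0.
  apply: (@le_trans _ _ (3 * k * (M * h ^+ 2) ^+ 2)).
    apply: ler_wpM2l; first by apply: mulr_ge0 => //; exact: ltW k0.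
    exact: (ler_exp 2 (sq_ge0 _) sM).
  have -> : 3 * k * (M * h ^+ 2) ^+ 2 = h * (3 * k * M ^+ 2) * h ^+ 3 by ring.
  by rewrite exprMn ler_wpM2r // exprn_ge0.
have a0 : derive1 u t 0 0 != 0.
  apply: contra_neq du => a0; apply: plane_eq; rewrite ?a0 ?b0 mxE //.
have ap : 0 < a / 2 by rewrite divr_gt0 // normr_gt0.
have [M M0 HM] : exists2 M, 0 < M & \forall s \near t, `|u s 0 1| <= M * `|s - t| ^+ 2.
  by apply: second_order => //; rewrite derive1_coord.
have d0 : 0 < k * (a / 2) ^+ 4 / M ^+ 3 by apply: divr_gt0; [apply: mulr_gt0 => //|]; exact: exprn_gt0.
apply: filterS3 HM (low 0 a0) (filterI (small _ d0) (small _ ltr01)) => s y1 x1 [/= hs h1].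
move: hs; rewrite ler_pdivlMr ?exprn_gt0 //.
move: (`|s - t|) (normr_ge0 (s - t)) h1 x1 y1 => h h0 h1 x1 y1 hs /=.
apply: loops_low.
apply: (@le_trans _ _ (`|u s 0 1| ^+ 3)); first by rewrite -normrX ler_norm.
apply: (@le_trans _ _ ((M * h ^+ 2) ^+ 3)).
  by apply: ler_exp => //; exact: normr_ge0.
apply: (@le_trans _ _ (k * ((a / 2 * h) ^+ 2) ^+ 2)); last first.
  rewrite ler_wpM2l ?(ltW k0) //; apply: ler_exp; first by rewrite exprn_ge0 // mulr_ge0 // ltW.
  rewrite sqE -[u s 0 0 ^+ 2]real_normK ?num_real //.
  apply: (@le_trans _ _ (`|u s 0 0| ^+ 2)); last by rewrite lerDl sqr_ge0.
  by apply: ler_exp => //; exact: mulr_ge0 (ltW ap) h0.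
have -> : (M * h ^+ 2) ^+ 3 = h * M ^+ 3 * (h * h ^+ 4) by ring.
have -> : k * ((a / 2 * h) ^+ 2) ^+ 2 = k * (a / 2) ^+ 4 * h ^+ 4 by field.
have h4 : 0 <= h ^+ 4 by rewrite exprn_ge0.
apply: ler_pM => //; rewrite ?mulr_ge0 ?exprn_ge0 // ?(ltW M0) //.
by rewrite ler_piMl.
Qed.

End OneProfile.

(** On the loop of level [2 * k], the map multiplies the abscissa by nearly
    [l ^- 3], where [l = lam (2 * k)] is not 1. It also fixes the horizontal
    axis, to which the loop is tangent at the origin, so a differential would
    have two different values on the same vector. *)
Lemma loops_not_differentiable k lam : 0 < k -> profile k lam ->
  ~ differentiable (loops lam) 0.
Proof.
move=> k0 P df; set D := 'd (loops lam) 0 in df.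
set l := lam (2 * k).
have l0 : 0 < l by have := prof_ge P (2 * k); rewrite -/l; lra.
(* [c s] is the point of slope [s] on the loop of level [2 * k], and [ax s] its
   projection to the horizontal axis. *)
pose rho s : R := (2 * k * (1 + s ^+ 2) ^+ 2)^-1.
pose c s := vec (s ^+ 3 * rho s) (s ^+ 4 * rho s).
pose ax s := vec (s ^+ 3 * rho s) 0.
pose phi (s : R) := ((1 + s ^+ 2) / (l ^+ 2 + s ^+ 2)) ^+ 2 * l - 1.
have sX n (s : R) : smooth_at (fun s : R => s ^+ n) s.
  elim: n => [|n IH]; first by under [X in smooth_at X]eq_fun do rewrite expr0; exact: smooth_at_cst.
  under [X in smooth_at X]eq_fun do rewrite exprS.
  by apply: smooth_atM => //; exact: smooth_at_id.
have s1 (s : R) : smooth_at (fun s : R => 1 + s ^+ 2) s.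
  by apply: smooth_atD; [exact: smooth_at_cst|exact: sX].
have n1 (s : R) : 1 + s ^+ 2 != 0 by exact: den_neq0.
have nl (s : R) : l ^+ 2 + s ^+ 2 != 0 by rewrite gt_eqF // ltr_pwDl ?sqr_ge0 // exprn_gt0.
have k2 : 2 * k != 0 by rewrite mulf_neq0 // gt_eqF.
have sr s : smooth_at rho s.
  apply: smooth_atV; first by rewrite mulf_neq0 // expf_neq0.
  by apply: smooth_atM; [exact: smooth_at_cst|apply: smooth_atM].
have scv s : smooth_at c s by apply: smooth_at_vec; apply: smooth_atM.
have sax s : smooth_at ax s.
  by apply: smooth_at_vec; [exact: smooth_atM|exact: smooth_at_cst].
have sphi s : smooth_at phi s.
  have sq_ : smooth_at (fun s : R => (1 + s ^+ 2) / (l ^+ 2 + s ^+ 2)) s.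
    apply: smooth_atM => //; apply: smooth_atV => //.
    by apply: smooth_atD; [exact: smooth_at_cst|exact: sX].
  apply: smooth_atB; last exact: smooth_at_cst.
  by apply: smooth_atM; [exact: smooth_atM|exact: smooth_at_cst].
have phi0 : phi 0 != 0.
  rewrite /phi expr0n /= !addr0 subr_eq0.
  have -> : (1 / l ^+ 2) ^+ 2 * l = l ^- 3 by field; rewrite gt_eqF.
  rewrite invr_eq1 pexprn_eq1 //; [exact: prof_peak P|exact: ltW].
have lc s : s != 0 -> level (c s) = 2 * k.
  move=> s0; rewrite /level sqE !coordE.
  have kn : k != 0 by rewrite gt_eqF.
  have -> : (s ^+ 3 * rho s) ^+ 2 + (s ^+ 4 * rho s) ^+ 2 =
    (s ^+ 3 * rho s) ^+ 2 * (1 + s ^+ 2) by ring.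
  have rn : rho s != 0 by rewrite invr_neq0 // mulf_neq0 // expf_neq0.
  have -> : (s ^+ 4 * rho s) ^+ 3 / ((s ^+ 3 * rho s) ^+ 2 * (1 + s ^+ 2)) ^+ 2 =
    (rho s)^-1 * (1 + s ^+ 2) ^- 2.
    by move: (n1 s) => n1s; field; rewrite s0 rn n1s.
  by rewrite invrK mulfK // expf_neq0.
have Fc s : s != 0 -> loops lam (c s) 0 0 = (1 + phi s) * (c s 0 0).
  move=> s0; rewrite /loops lc // -/l /phi sqE !coordE.
  have rn : rho s != 0 by rewrite invr_neq0 // mulf_neq0 // expf_neq0.
  have -> : l ^+ 2 * (s ^+ 3 * rho s) ^+ 2 + (s ^+ 4 * rho s) ^+ 2 =
    (s ^+ 3 * rho s) ^+ 2 * (l ^+ 2 + s ^+ 2) by ring.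
  have -> : (s ^+ 3 * rho s) ^+ 2 + (s ^+ 4 * rho s) ^+ 2 =
    (s ^+ 3 * rho s) ^+ 2 * (1 + s ^+ 2) by ring.
  rewrite -mulf_div divff ?mul1r; last by rewrite expf_neq0 // mulf_neq0 // expf_neq0.
  ring.
have Fa s : loops lam (ax s) = ax s.
  apply: (loops_low k0 P); rewrite !coordE expr0n /= mulr_ge0 ?exprn_ge0 ?sq_ge0 //; exact: ltW.
set m := `|phi 0|; have m0 : 0 < m by rewrite normr_gt0.
set C := `|D (vec 0 1) 0 0|.
have e0 : 0 < m / 16 by rewrite divr_gt0.
have close (g : R -> plane) : (forall s, smooth_at g s) -> g 0 = 0 ->
    \forall s \near (0 : R), `|(loops lam (g s) - D (g s)) 0 0| <= m / 16 * `|g s|.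
  move=> sg g0; have := smooth_at_continuous (sg 0); rewrite /prop_for /continuous_at g0 => cg.
  have N : \forall s \near (0 : R), `|loops lam (g s + 0) - loops lam 0 - 'd (loops lam) 0 (g s)| <= m / 16 * `|g s|.
    exact: (cg _ (diff_eps e0 df)).
  apply: filterS N => s; rewrite addr0 loops0 subr0.
  by apply: le_trans; exact: coord_norm.
have c0 : c 0 = 0 by apply: plane_eq; rewrite !coordE expr0n /= mul0r.
have a0 : ax 0 = 0 by apply: plane_eq; rewrite !coordE ?expr0n /= ?mul0r.
have Nphi : \forall s \near (0 : R), `|phi 0 - phi s| <= m / 2.
  have m2 : 0 < m / 2 by rewrite divr_gt0.
  exact: ((cvgrPdist_le _ _).1 (smooth_at_continuous (sphi 0)) (m / 2) m2).
have [d d0 Hd] := nbhs_line (filterI (filterI (close c scv c0) (close ax sax a0)) Nphi).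
have C0 : 0 <= C by exact: normr_ge0.
pose s := Num.min (d / 2) (Num.min 1 (m / (8 * (C + 1)))).
have C10 : 0 < 8 * (C + 1) by rewrite mulr_gt0 // ltr_wpDl.
have sp : 0 < s by rewrite !lt_min ltr01 (divr_gt0 d0) // (divr_gt0 m0 C10).
have [[Hc Ha] Hp] : ((`|(loops lam (c s) - D (c s)) 0 0| <= m / 16 * `|c s|) /\
    `|(loops lam (ax s) - D (ax s)) 0 0| <= m / 16 * `|ax s|) /\ `|phi 0 - phi s| <= m / 2.
  apply: Hd; rewrite subr0 gtr0_norm //.
  have : s <= d / 2 by rewrite ge_min lexx.
  by move=> h; lra.
have sl1 : s <= 1 by rewrite !ge_min lexx orbT.
have sC : C * s <= m / 8.
  have : s <= m / (8 * (C + 1)) by rewrite !ge_min lexx !orbT.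
  rewrite ler_pdivlMr // => h; nra.
set x := s ^+ 3 * rho s.
have x0 : 0 < x.
  have p1 : 0 < 1 + s ^+ 2 by rewrite ltr_pwDl // sqr_ge0.
  by apply: mulr_gt0; [exact: exprn_gt0|rewrite invr_gt0 mulr_gt0 // ?mulr_gt0 // exprn_gt0].
have nc : `|c s| <= 2 * x.
  have h : sq (c s) <= (2 * x) ^+ 2.
    rewrite sqE !coordE -/x.
    have -> : s ^+ 4 * rho s = s * x by rewrite /x; ring.
    have : (s * x) ^+ 2 <= x ^+ 2.
      by apply: ler_exp; [exact: ltW (mulr_gt0 sp x0)|rewrite ler_piMl // ltW].
    have := sqr_ge0 x; lra.
  have x2 : 0 <= 2 * x by apply: mulr_ge0 => //; exact: ltW.
  by rewrite -(@ler_pXn2r _ 2) ?nnegrE //; exact: le_trans (norm_sq _) h.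
have na : `|ax s| <= x.
  rewrite -(@ler_pXn2r _ 2) ?nnegrE ?(ltW x0) //.
  by apply: le_trans (norm_sq _) _; rewrite sqE !coordE expr0n /= addr0.
have Ec : c s = ax s + (s * x) *: vec 0 1.
  by apply: plane_eq; rewrite !coordE /x; ring.
have Dc : D (c s) = D (ax s) + (s * x) *: D (vec 0 1).
  by rewrite Ec linearD linearZ.
have sn : s != 0 by rewrite gt_eqF.
have h1 : phi s * x = (loops lam (c s) - D (c s)) 0 0 - (loops lam (ax s) - D (ax s)) 0 0
   + s * x * D (vec 0 1) 0 0.
  have sub (y z : plane) : (y - z) 0 0 = y 0 0 - z 0 0 by rewrite !coordE.
  rewrite !sub Dc Fa Fc // !coordE -/x; ring.
have h2 : `|phi s| * x <= m / 16 * (2 * x) + m / 16 * x + s * x * C.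
  rewrite -[X in _ * X](gtr0_norm x0) -normrM h1.
  apply: le_trans (ler_normD _ _) _; apply: lerD; last first.
    by rewrite normrM (gtr0_norm (mulr_gt0 sp x0)).
  apply: le_trans (ler_normB _ _) _; apply: lerD.
    apply: le_trans Hc _. nra.
  apply: le_trans Ha _; nra.
have h3 : `|phi s| <= 3 * m / 16 + m / 8.
  rewrite -(ler_pM2r x0); apply: le_trans h2 _.
  have : C * s * x <= m / 8 * x by rewrite ler_wpM2r // ltW.
  have -> : s * x * C = C * s * x by ring.
  move=> h; lra.
have := lerB_dist (phi 0) (phi s); rewrite -/m => h4.
lra.
Qed.

End Profile.

(** * Rigidity of the action on curves, and conclusion *)

Section Conjugate.
Context {R : realType}.
Local Notation plane := 'rV[R]_2.
Implicit Types (w z : plane) (F G : plane -> plane).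

Definition recenter w F z := w + F (z - w).

Lemma recenterK w F G : cancel F G -> cancel (recenter w F) (recenter w G).
Proof. by move=> FK z; rewrite /recenter addrAC subrr add0r FK addrC subrK. Qed.

Lemma recenter_center w F : F 0 = 0 -> recenter w F w = w.
Proof. by move=> F0; rewrite /recenter subrr F0 addr0. Qed.

Lemma smooth_recenter w F z : smooth_at F (z - w) -> smooth_at (recenter w F) z.
Proof.
move=> sF; apply: smooth_atD; first exact: smooth_at_cst.
apply: (smooth_at_comp (f := fun z => z - w)) => //; first exact: (@framed_rV R 1).
by apply: smooth_atD; [exact: smooth_at_id|exact: smooth_at_cst].
Qed.

Lemma continuous_recenter w F : continuous F -> continuous (recenter w F).
Proof.
move=> cF z; apply: (@continuousD _ _ _ (cst w) (fun z => F (z - w))); first exact: cst_continuous.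
apply: (@continuous_comp _ _ _ (fun z => z - w)); last exact: cF.
by apply: (@continuousB _ _ _ id (cst w)); [exact: cvg_id|exact: cst_continuous].
Qed.

Lemma recenter_differentiable w F :
  differentiable (recenter w F) w -> differentiable F 0.
Proof.
move=> dF; have E : F = (fun z => recenter w F (z + w) - w).
  by apply/funext => z; rewrite /recenter addrK addrAC subrr add0r.
rewrite E; apply: differentiableB => //.
by apply: differentiable_comp => //; rewrite add0r.
Qed.

Lemma recenter_loops_good k lam w z : 0 < k -> profile k lam ->
  profile k (fun s => (lam s)^-1) ->
  plane_good_at (recenter w (loops lam)) (recenter w (loops (fun s => (lam s)^-1))) z.
Proof.
move=> k0 P P'; have lam0 s : 0 < lam s by have := prof_ge P s; lra.
have lam0' s : 0 < (lam s)^-1 by rewrite invr_gt0.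
have [->|zw] := eqVneq z w; last first.
  have zw0 : z - w != 0 by rewrite subr_eq0.
  left; split; apply: smooth_recenter; first exact: (smooth_loops lam0 (prof_smooth P) zw0).
  rewrite /recenter addrAC subrr add0r.
  exact: (smooth_loops lam0' (prof_smooth P') (loops_neq0 lam0 zw0)).
right; split; first by rewrite recenter_center // loops0.
move=> u t ut su du.
have su' : smooth_at (fun s => u s - w) t by apply: smooth_atD => //; exact: smooth_at_cst.
have du' : derive1 (fun s => u s - w) t = derive1 u t.
  have d := smooth_at_differentiable su.
  rewrite !derive1E; have := @deriveB _ _ _ u (cst w) t 1 _ _.
  rewrite derive_cst subr0; apply; [exact: diff_derivable|exact: derivable_cst].
have u0 : u t - w = 0 by rewrite ut subrr.
rewrite -du' in du.
apply: filterS (loops_curve k0 P u0 su' du) => s /= Es.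
by rewrite /recenter Es addrC subrK.
Qed.

Lemma supported_loops (S : topologicalType) (c : chart R S) k lam w : 0 < k ->
  profile k lam ->
  (forall z, sq (z - w) <= k ^- 2 -> (chart_fun c @` chart_dom c) z) ->
  supported c [set z | sq (z - w) <= k ^- 2] (recenter w (loops lam))
    (recenter w (loops (fun s => (lam s)^-1))).
Proof.
move=> k0 P H; have lam0 s : 0 < lam s by have := prof_ge P s; lra.
have lam0' s : 0 < (lam s)^-1 by rewrite invr_gt0.
have K' : cancel (loops (fun s => (lam s)^-1)) (loops lam).
  move=> z; have := loopsK z lam0'.
  by have -> : (fun s => ((lam s)^-1)^-1) = lam by apply/funext => s; rewrite invrK.
split=> //.
- exact: compact_disc.
- by apply: recenterK => z; exact: loopsK.
- exact: recenterK.
- apply: continuous_recenter.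
  exact: (continuous_loops lam0 (prof_smooth P) (prof_ge P)).
- move=> z /= /negP; rewrite -ltNge => /ltW h; rewrite /recenter (loops_far k0 P) //.
  by rewrite addrC subrK.
Qed.

End Conjugate.

Section Final.
Context {R : realType} {S : topologicalType}.
Local Notation plane := 'rV[R]_2.
Context (A : set (chart R S)) (hA : smooth_surface A).

Lemma differentiable_at_congr (f g : S -> S) p : continuous f ->
  {near p, f =1 g} -> differentiable_at A f p -> differentiable_at A g p.
Proof.
move=> cf nE df c d Ac Ad cp dgp.
have dfp : chart_dom d (f p) by rewrite (nbhs_singleton nE).
have nE' : {near chart_fun c p, chart_fun d \o f \o chart_inv c =1
                                chart_fun d \o g \o chart_inv c}.
  by apply: filterS (near_chart_inv cp nE) => y /= ->.
exact: (near_eq_diff nE' (df c d Ac Ad cp dfp)).1.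
Qed.

(** In the chart itself, the planted map reads as [F]. *)
Lemma transplant_not_differentiable c K F G p : A c -> chart_dom c p ->
  supported c K F G -> F (chart_fun c p) = chart_fun c p ->
  ~ differentiable F (chart_fun c p) -> ~ differentiable_at A (transplant c F) p.
Proof.
move=> Ac cp sFG Fp nd df; apply: nd.
have [cFp _] := transplant_in sFG cp.
have nE : {near chart_fun c p, chart_fun c \o transplant c F \o chart_inv c =1 F}.
  apply: filterS (chart_img_nbhs cp) => y /chart_imgP[y1 y2] /=.
  by have [_ ->] := transplant_in sFG y2; rewrite y1.
exact: (near_eq_diff nE (df c c Ac Ac cp cFp)).1.
Qed.

(** The centres are the two other vertices of the square of diagonal [v]; the
    circles about them through the ends of [v] meet nowhere else. *)
Lemma two_circles (v z : plane) : z != 0 -> z != v ->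
  exists2 s : R, s ^+ 2 = 1 &
    sq (z - (2^-1 *: v + (s / 2) *: perp v)) != sq v / 2.
Proof.
move=> z0 zv.
have E (s : R) : s ^+ 2 = 1 -> sq (z - (2^-1 *: v + (s / 2) *: perp v)) - sq v / 2 =
   sq z - dot v z - s * dot (perp v) z.
  move=> s1; rewrite /sq /dot !coordE.
  apply: subr0_eq; rewrite -[LHS](_ : (s ^+ 2 - 1) * (v 0 0 ^+ 2 + v 0 1 ^+ 2) / 4 = _).
    by rewrite s1 subrr !mul0r.
  by field.
have [h|h] := eqVneq (sq (z - (2^-1 *: v + (1 / 2) *: perp v))) (sq v / 2); last first.
  by exists 1; rewrite ?expr1n.
have [h'|h'] := eqVneq (sq (z - (2^-1 *: v + (-1 / 2) *: perp v))) (sq v / 2); last first.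
  by exists (-1); rewrite // sqrrN expr1n.
exfalso.
have e1 := E 1 (expr1n _ _); have := E (-1); rewrite sqrrN expr1n => /(_ erefl) e2.
rewrite h subrr mul1r in e1; rewrite h' subrr mulN1r in e2.
have d0 : dot (perp v) z = 0 by lra.
have dv : sq z = dot v z by lra.
have [v0|v0] := eqVneq v 0.
  by move: dv (sq_gt0 z0); rewrite v0 /dot !coordE !mul0r addr0 => ->; rewrite ltxx.
have pv0 : perp v != 0 by rewrite -sq_eq0 sq_perp sq_eq0.
have Ez := perp_line pv0 d0.
set l := _ / _ in Ez.
have {}Ez : z = - l *: v.
  by rewrite Ez; apply: plane_eq; rewrite !coordE; ring.
have sv := sq_gt0 v0.
have : (- l) * (- l - 1) * sq v = 0.
  by move: dv; rewrite Ez sqZ /sq /dot !coordE => dv; nra.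
move=> /eqP; rewrite !mulf_eq0 (gt_eqF sv) orbF => /orP[/eqP l0|].
  by move: z0; rewrite Ez l0 scale0r eqxx.
by rewrite subr_eq0 => /eqP l1; move: zv; rewrite Ez l1 scale1r eqxx.
Qed.

(** There are two circles along which [p] can be pushed to [x], and [y] is off
    one of them ([two_circles]); the push is supported in a thin annulus around
    that circle. *)
Lemma push_avoiding c p : A c -> chart_dom c p -> exists N, [/\ open N, N p &
  forall x y, N x -> x <> y -> p <> y -> exists f g,
    [/\ diffeo_pair A f g, f p = x & f y = y /\ g y = y]].
Proof.
move=> Ac cp; have [r r0 Hr] := disc_nbhs (chart_img_nbhs cp).
(* If [sq v < r / 4], the disc swept by a push lies within squared distance
   [2 * sq v + 2 * d] of the centre, with [d <= r / 8]. *)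
exists (disc c (chart_fun c p) (r / 4)); split; first exact: disc_open.
  by split => //; rewrite subrr sq0 divr_gt0.
move=> x y [cx hx] xy py; set v := chart_fun c x - chart_fun c p in hx.
have main s d : s ^+ 2 = 1 -> 0 < d -> d <= r / 8 ->
    (chart_dom c y -> d <= `|sq (chart_fun c y -
       (chart_fun c p + 2^-1 *: v + (s / 2) *: perp v)) - sq v / 2|) ->
    exists f g, [/\ diffeo_pair A f g, f p = x & f y = y /\ g y = y].
  move=> s1 d0 dr Hy.
  have [|f [g [fg fp fy]]] := @push _ _ A hA c p x s d Ac cp cx s1 d0.
    rewrite -/v => z hz; apply: Hr.
    set w' := _ + _ + _ in hz.
    have Ew : z - chart_fun c p = (z - w') + (2^-1 *: v + (s / 2) *: perp v).
      by apply: plane_eq; rewrite /w' !coordE; ring.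
    have sw : sq (2^-1 *: v + (s / 2) *: perp v) = sq v / 2.
      by rewrite sqD !sqZ sq_perp /dot !coordE exprMn s1; field.
    rewrite Ew sqD sw; have := sq_ge0 ((z - w') - (2^-1 *: v + (s / 2) *: perp v)).
    rewrite sqD sqN sw => h.
    have dN (a b : plane) : dot a (- b) = - dot a b by rewrite /dot !coordE; ring.
    rewrite dN in h; lra.
  by exists f, g; split => //; exact: fy.
have [cy|ncy] := pselect (chart_dom c y); last first.
  by apply: (main 1 (r / 8)); rewrite ?expr1n // divr_gt0.
have z0 : chart_fun c y - chart_fun c p != 0.
  rewrite subr_eq0; apply/eqP => E; apply: py.
  by rewrite -(chart_funK cp) -E chart_funK.
have zv : chart_fun c y - chart_fun c p != v.
  apply/eqP => /addIr E; apply: xy.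
  by rewrite -(chart_funK cx) -E chart_funK.
have [s s1 hs] := two_circles z0 zv.
rewrite -subr_eq0 -normr_gt0 in hs.
set m := `|_| in hs.
apply: (main s (Num.min (r / 8) m)) => //.
- by rewrite lt_min hs divr_gt0.
- by rewrite ge_min lexx.
- move=> _; rewrite ge_min; apply/orP; right; rewrite /m.
  by rewrite [chart_fun c y - (_ + _ + _)](_ : _ =
    chart_fun c y - chart_fun c p - (2^-1 *: v + (s / 2) *: perp v)) //; apply: plane_eq; rewrite !coordE; ring.
Qed.

(** If [k] moved a point [x] off the curve and close to [b 0], some
    diffeomorphism would push [b 0] to [x] while fixing [k x], and the pushed
    curve would be a vertex containing [x] but not [k x]. The points of the
    curve follow by continuity, being limits of such points [x] ([sides]). *)
Lemma vertex_rigid (k : S -> S) (b : R -> S) : continuous k -> injective k ->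
  smooth_param A b -> nonseparating (range b) ->
  (forall v, smooth_curve A v -> nonseparating v -> k @` v = v) ->
  {near b 0, k =1 id}.
Proof.
move=> ck ki sb nb Hk; have [c Ac cp] := chart_at hA (b 0).
have [N [oN Np push]] := push_avoiding Ac cp.
have sa : smooth_curve A (range b) by exists b.
have off x : N x -> ~ range b x -> k x = x.
  move=> Nx nax; apply: contrapT => kx.
  have nay : ~ range b (k x).
    rewrite -(Hk _ sa nb) => -[q aq /ki E]; apply: nax; by rewrite -E.
  have [||f [g [fg fp [fy gy]]]] := push x (k x) Nx.
  - by move=> E; apply: kx.
  - by move=> E; apply: nay; rewrite -E; exists 0.
  have [gp _] := diffeo_pair_good fg; have [[_ _ fK gK] _ _] := fg.
  have := Hk _ (good_curve hA gp sa) (homeo_nonseparating gp.1 nb).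
  have fx : (f @` range b) x by exists (b 0) => //; exists 0.
  move=> E; have : (f @` range b) (k x) by rewrite -E; exists x.
  by move=> [q aq Eq]; apply: nay; rewrite -gy -Eq fK.
have nN x : N x -> nbhs x N by move=> Nx; exact: open_nbhs_nbhs.
apply: filterS (nN _ Np) => x Nx /=.
have [[t _ Et]|] := pselect (range b x); last exact: off.
subst x; have [M [P [Q [nM _ [sP _] _ cl]]]] := sides hA sb (nN _ Nx).
have [cP _] := cl _ (nbhs_singleton nM) (imageT b t).
have hS : hausdorff_space S by case: hA.
apply: hS => U V nU nV.
have [z [Pz [Vz Uz]]] := cP _ (filterI nV (ck _ _ nU)).
have [Nz az] := sP _ Pz.
by exists z; split => //; move: Uz => /=; rewrite off.
Qed.

End Final.

Theorem proposition1p3 (R : realType) (S : topologicalType)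
    (A : set (chart R S))
    (hA : smooth_surface A)
    (hconn : connected [set: S])
    (hns : nonspherical R S) :
  (exists f g : S -> S,
     [/\ homeomorphism_pair f g,
         preserves_smooth_curves A f /\ preserves_smooth_curves A g,
         preserves_transversality A f /\ preserves_transversality A g,
         ~ differentiable_map A f
       & ~ differentiable_map A g]) /\
  (exists N : Diff A -> NC_Aut A,
     natural_map N /\ ~ set_surj [set: Diff A] [set: NC_Aut A] N).
Proof.
have [b [sb nb]] := smooth_nonseparating_exists hA hconn hns.
have [c Ac cp] := chart_at hA (b 0).
set w := chart_fun c (b 0).
have [r r0 Hr] := disc_nbhs (chart_img_nbhs cp).
(* The support, of squared radius [k ^- 2], has to fit in the chart. *)
pose k : R := 1 + r^-1.
have k0 : 0 < k by rewrite addr_gt0 // invr_gt0.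
have kr : k ^- 2 < r.
  rewrite invf_plt ?posrE ?exprn_gt0 // /k.
  have ri : 0 < r^-1 by rewrite invr_gt0.
  nra.
have [lam [P P']] := profile_exists k0.
pose F := recenter w (loops lam).
pose G := recenter w (loops (fun s => (lam s)^-1)).
have lamE : (fun s => ((lam s)^-1)^-1) = lam by apply/funext => s; rewrite invrK.
have inK z : sq (z - w) <= k ^- 2 -> (chart_fun c @` chart_dom c) z.
  by move=> h; apply: Hr; exact: le_lt_trans kr.
have sFG := supported_loops k0 P inK.
have sGF := supported_loops k0 P' inK.
rewrite lamE -/F -/G in sFG sGF.
have goodF z : plane_good_at F G z := recenter_loops_good w z k0 P P'.
have goodG z : plane_good_at G F z.
  by have := recenter_loops_good w z k0 P'; rewrite lamE; apply.
have fg := transplant_good hA Ac sFG (supp_F sGF) goodF.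
have gf := transplant_good hA Ac sGF (supp_F sFG) goodG.
set f := transplant c F in fg gf; set g := transplant c G in fg gf.
have Fw : F w = w by rewrite /F recenter_center // loops0.
have Gw : G w = w by rewrite /G recenter_center // loops0.
have ndf : ~ differentiable_at A f (b 0).
  apply: (transplant_not_differentiable Ac cp sFG Fw) => /recenter_differentiable.
  exact: loops_not_differentiable k0 P.
have ndg : ~ differentiable_at A g (b 0).
  apply: (transplant_not_differentiable Ac cp sGF Gw) => /recenter_differentiable.
  exact: loops_not_differentiable k0 P'.
split.
  exists f, g; split; first exact: fg.1.
  - by split; [exact: (good_curve hA fg)|exact: (good_curve hA gf)].
  - by split; [exact: (good_transverse hA fg)|exact: (good_transverse hA gf)].
  - by move=> df; exact: ndf (df _).
  - by move=> dg; exact: ndg (dg _).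
have [N NN] := natural_map_exists hA; exists N; split => // sN.
have [h _ hE] := sN (graph_aut hA fg gf) I.
have act v : smooth_curve A v -> nonseparating v -> sval h @` v = f @` v.
  move=> sv nv; have := NN h (exist _ v (conj sv nv)).
  by rewrite hE.
have [[cf cg fK gK] _] := fg.
have [hinv [[[ch _ hK _] _] _]] := diff_good h.
(* [h] and [f] act in the same way on the vertices. *)
have kid : {near b 0, g \o sval h =1 id}.
  apply: (vertex_rigid hA) => //.
  - by move=> x; apply: continuous_comp; [exact: ch|exact: cg].
  - by move=> x y /= /(can_inj gK) /(can_inj hK).
  - move=> v sv nv; rewrite -image_comp act // image_comp.
    by apply/seteqP; split => [_ [x vx <-]|x vx] /=; [rewrite fK|exists x; rewrite //= fK].
apply: ndf; apply: (differentiable_at_congr (f := sval h)) => //.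
  by apply: filterS kid => x /= E; rewrite -{2}E gK.
by apply: (smooth_pt_diff); apply: (smooth_map_pt A _).1; case: (svalP h).
Qed.
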